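(* Let $\mathcal{F}$ be a graph family admitting strongly sublinear separators, and let $$r_{\mathcal{F}}:=\sup\left\{\frac{\tau(H)}{\mathsf{v}(H)} : kH\in\mathcal{F}\text{ for every }k\in\mathbb{N}\right\}.$$ If $r_{\mathcal{F}}\ge 2/3$, then for every graph $H\in\mathcal{F}$, $c(H)\le (r_{\mathcal{F}}+o(1))\mathsf{v}(H)$ (with $o(1)\to0$ as $\mathsf{v}(H)\to\infty$), and there exist arbitrarily large graphs $H\in\mathcal{F}$ with $c(H)=(r_{\mathcal{F}}+o(1))\mathsf{v}(H)$.
   Context: All graphs are finite and simple; ratios are taken over non-null graphs. $kH$ denotes the disjoint union of $k$ copies of $H$. $\mathsf{v}(G)$, $\mathsf{e}(G)$ are the numbers of vertices and edges; $\mathsf{d}(G)=\mathsf{e}(G)/\mathsf{v}(G)$. For $\mathsf{v}(H)\ge2$, $c(H)$ is the supremum of $\mathsf{d}(G)$ over non-null graphs $G$ with no $H$ minor. $\tau(H)$ is the minimum size of a vertex cover of $H$. A separation of $G$ is a pair $(A_1,A_2)$ of subsets of $V(G)$ with $G=G[A_1]\cup G[A_2]$, $A_1\setminus A_2\ne\emptyset\ne A_2\setminus A_1$, of order $|A_1\cap A_2|$, balanced if $|A_1|,|A_2|\ge\mathsf{v}(G)/3$. A family $\mathcal{F}$ admits strongly sublinear separators if it is closed under subgraphs and there are $\beta<1$, $c>0$ such that every $G\in\mathcal{F}$ has a balanced separation of order at most $c\,\mathsf{v}(G)^\beta$. *)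

(* Defs.v *)
From HB Require Import structures.
From mathcomp Require Import all_boot all_order all_algebra.
From mathcomp Require Import all_classical all_reals all_analysis.

Set Implicit Arguments.
Unset Strict Implicit.
Unset Printing Implicit Defensive.

Import Order.TTheory GRing.Theory Num.Theory.

Local Open Scope ring_scope.

(* Finite simple graphs; the null graph (no vertices) is allowed. *)
Record sgraph := SGraph {
  vertex :> finType;
  adj : rel vertex;
  adj_sym : symmetric adj;
  adj_irrefl : irreflexive adj }.

Definition nverts (G : sgraph) : nat := #|G|.

Definition edges (G : sgraph) : {set {set G}} :=
  [set s : {set G} |
    [exists x : G, exists y : G, adj x y && (s == [set x; y])]]%SET.

Definition nedges (G : sgraph) : nat := #|edges G|.

Definition density (R : realType) (G : sgraph) : R :=
  (nedges G)%:R / (nverts G)%:R.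

Definition copies_adj (k : nat) (H : sgraph) : rel ('I_k * H) :=
  fun p q => (p.1 == q.1) && adj p.2 q.2.

Lemma copies_adj_sym (k : nat) (H : sgraph) : symmetric (@copies_adj k H).
Proof. by move=> p q; rewrite /copies_adj eq_sym adj_sym. Qed.

Lemma copies_adj_irrefl (k : nat) (H : sgraph) : irreflexive (@copies_adj k H).
Proof. by move=> p; rewrite /copies_adj adj_irrefl andbF. Qed.

Definition copies (k : nat) (H : sgraph) : sgraph :=
  SGraph (@copies_adj_sym k H) (@copies_adj_irrefl k H).

(* [H] is isomorphic to a (not necessarily induced) subgraph of [G]. *)
Definition subgraph (H G : sgraph) : Prop :=
  exists f : H -> G, injective f /\ forall x y : H, adj x y -> adj (f x) (f y).

Definition connected_in (G : sgraph) (B : {set G}) : Prop :=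
  B != finset.set0 /\
  forall x y : G, x \in B -> y \in B ->
    connect [rel a b | [&& a \in B, b \in B & adj a b]] x y.

(* [H] is a minor of [G]: [B x] is the set of vertices of [G] that are
   contracted to the vertex [x] of [H]. *)
Definition minor (H G : sgraph) : Prop :=
  exists B : H -> {set G},
    [/\ forall x : H, connected_in (B x),
        forall x y : H, x != y -> [disjoint B x & B y] &
        forall x y : H, adj x y ->
          exists a b : G, [/\ a \in B x, b \in B y & adj a b]].

(* Meaningful for [2 <= nverts H], when some non-null graph has no [H] minor.
   The value is an extended real, so that bounding it includes the assertion
   that the supremum is finite. *)
Definition extremal_c (R : realType) (H : sgraph) : \bar R :=
  ereal_sup [set x : \bar R | exists G : sgraph,
    [/\ (0 < nverts G)%N, ~ minor H G & x = (density R G)%:E]]%classic.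

Definition vertex_cover (H : sgraph) (S : {set H}) : bool :=
  [forall x : H, forall y : H, adj x y ==> (x \in S) || (y \in S)].

Definition tau (H : sgraph) : nat :=
  #|[arg min_(S < [set: H]%SET | vertex_cover S) #|S| ]|.

Definition separation (G : sgraph) (A1 A2 : {set G}) : Prop :=
  [/\ (A1 :|: A2 = [set: G])%SET,
      forall x y : G, adj x y ->
        ((x \in A1) && (y \in A1)) || ((x \in A2) && (y \in A2)),
      (A1 :\: A2 != finset.set0)%SET &
      (A2 :\: A1 != finset.set0)%SET].

Definition sep_order (G : sgraph) (A1 A2 : {set G}) : nat := #|(A1 :&: A2)%SET|.

Definition balanced (R : realType) (G : sgraph) (A1 A2 : {set G}) : Prop :=
  (nverts G)%:R / 3 <= #|A1|%:R :> R /\ (nverts G)%:R / 3 <= #|A2|%:R :> R.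

Definition subgraph_closed (F : sgraph -> Prop) : Prop :=
  forall G H : sgraph, subgraph H G -> F G -> F H.

(* Complete graphs, in particular the one-vertex graph, have no separation
   with both differences nonempty.  Balanced separations are therefore only
   demanded of graphs with at least [n0] vertices: with [n0 = 0], the empty
   family would be the only one admitting strongly sublinear separators. *)
Definition strongly_sublinear_separators (R : realType) (F : sgraph -> Prop) :
    Prop :=
  subgraph_closed F /\
  exists (beta C : R) (n0 : nat),
    [/\ beta < 1, 0 < C &
        forall G : sgraph, F G -> (n0 <= nverts G)%N ->
          exists A1 A2 : {set G},
            [/\ separation A1 A2, balanced R A1 A2 &
                (sep_order A1 A2)%:R <= C * ((nverts G)%:R `^ beta)]].

(* The ratios lie in [0, 1]; if there is no such [H], then [sup] yields 0. *)
Definition cover_ratio (R : realType) (F : sgraph -> Prop) : R :=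
  sup [set x : R | exists H : sgraph,
    [/\ (0 < nverts H)%N, forall k : nat, F (copies k H) &
        x = (tau H)%:R / (nverts H)%:R]]%classic.

(* Main.v *)
(* Write r for the cover ratio.  For the upper bound, let D be slightly larger
   than r v(H), and let G have density above D but no H minor.  A minor-minimal
   such G has minimum degree above D, has at least D triangles on every edge and
   has no small cuts; from it one obtains a host minor of G with O(D) vertices
   which still has minimum degree about D and in addition has all edges in about
   D triangles and 2D vertices, or has 3D vertices, or splits into two regions of
   minimum degree about D.  In each case a linear-programming inequality over
   edges and triangles holds, and a packing argument with the Kovari-Sos-Turan
   theorem turns it into disjoint complete bipartite and tripartite tiles of any
   prescribed bounded size, as many as that inequality allows.

   Separators cut H, after deletion of a small set X, into groups of bounded
   size.  A group whose isomorphism type occurs very often can be repeated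
   arbitrarily often inside the family, so each of its subsets contains an
   independent set of proportion 1 - r; the other types contribute boundedly many
   groups, which are moved into X.  Removing two or three independent sets in turn
   shows that each group is a minor of each tile: independent sets go to the
   sides of the tile, the remaining vertices to edges of the tile.  The
   hypothesis r >= 2/3 makes the sizes needed for the two kinds of tile
   compatible.  The vertices of X become small connected sets that dominate
   almost all of the host, so that most tiles see them.

   For the lower bound, the complete bipartite graph with sides tau(H) - 1 and m
   has no H minor, because the branch sets meeting the first side would form a
   vertex cover of H. *)

Require Import Defs.
From HB Require Import structures.
From Stdlib Require Import Classical_Prop.
From mathcomp Require Import all_boot all_order all_algebra.
From mathcomp Require boolp.
From mathcomp Require Import zify.

Set Implicit Arguments.
Unset Strict Implicit.
Unset Printing Implicit Defensive.

(** * Contractions, deletions and minor-minimal graphs *)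

(** Where [r] comes from: the tiles for groups of size [q] have second and third parts of about
    [r * q] vertices together, and the linear-programming inequality yields about [D / (r * q)]
    tiles. So the [v(H) / q] groups fit once [D] exceeds [r * v(H)].

    The obstacle is the order of the constants. Group sizes, hence tile sizes, grow exponentially
    with the depth [J] of the separators, but the fraction of occupied vertices that the packing
    tolerates is fixed before the tile size. This works because [X] shrinks like [1 / 2 ^ J], while
    the connected sets replacing its vertices grow only linearly in [J].

    No regularity partition is used: the parts of a packing by much larger tiles act as clusters,
    the weights put into the linear-programming inequality are derivatives of a quadratic overload
    potential, and each round gains a fixed fraction of the host, so boundedly many rounds suffice.

    Density is measured by [2 * D * v < arcs + 2 * D * p]; the slack [2 * D * p] pays for the
    overlap of the two sides of a separation of order below [p]. *)

Definition nbr (G : sgraph) (x : G) : {set G} := [set y | adj x y].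

Lemma in_nbr (G : sgraph) (x y : G) : (y \in nbr x) = adj x y.
Proof. by rewrite inE. Qed.

Lemma adjC (G : sgraph) (x y : G) : adj x y = adj y x.
Proof. exact: adj_sym. Qed.

Lemma adjxx (G : sgraph) (x : G) : adj x x = false.
Proof. exact: adj_irrefl. Qed.

Lemma adj_neq (G : sgraph) (x y : G) : adj x y -> x != y.
Proof. by move=> h; apply/eqP => e; rewrite e adjxx in h. Qed.

Definition radj (G : sgraph) (B : {set G}) : rel G :=
  [rel a b | [&& a \in B, b \in B & adj a b]].

Lemma radjE (G : sgraph) (B : {set G}) a b :
  radj B a b = [&& a \in B, b \in B & adj a b].
Proof. by []. Qed.

Lemma radj_connect_sym (G : sgraph) (B : {set G}) : connect_sym (radj B).
Proof.
apply: sym_connect_sym => a b; rewrite !radjE adjC.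
by case: (a \in B); case: (b \in B).
Qed.

Lemma radj_sub (G : sgraph) (A B : {set G}) (x y : G) :
  A \subset B -> connect (radj A) x y -> connect (radj B) x y.
Proof.
move=> sAB; apply: connect_sub => a b /and3P[aA bA ab]; apply: connect1.
by rewrite radjE (subsetP sAB _ aA) (subsetP sAB _ bA).
Qed.

Lemma connect_closed (G : sgraph) (B C : {set G}) (x y : G) :
  (forall a b, a \in C -> b \in B -> adj a b -> b \in C) ->
  x \in C -> connect (radj B) x y -> y \in C.
Proof.
move=> cl xC /connectP[p pp ->]; elim: p x xC pp => //= z p IH x xC /andP[].
by move=> /and3P[_ zB xz] pp; apply: IH pp; apply: cl xz.
Qed.

Lemma conn_rooted (G : sgraph) (B : {set G}) (r : G) : r \in B ->
  (forall x, x \in B -> connect (radj B) r x) -> connected_in B.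
Proof.
move=> rB h; split; first by apply/set0Pn; exists r.
move=> x y xB yB; apply: connect_trans (h y yB).
by rewrite -/(radj B) radj_connect_sym h.
Qed.

Lemma conn_connect (G : sgraph) (B : {set G}) (x y : G) : connected_in B ->
  x \in B -> y \in B -> connect (radj B) x y.
Proof. by move=> [_ h]; apply: h. Qed.

Lemma conn1 (G : sgraph) (x : G) : connected_in [set x].
Proof.
apply: (conn_rooted (r := x)); first by rewrite inE.
by move=> y; rewrite inE => /eqP ->; apply: connect0.
Qed.

Lemma connU (G : sgraph) (A B : {set G}) (a b : G) :
  connected_in A -> connected_in B -> a \in A -> b \in B ->
  (a == b) || adj a b -> connected_in (A :|: B).
Proof.
move=> cA cB aA bB ab; apply: (conn_rooted (r := a)).
  by rewrite inE aA.
have sA : A \subset A :|: B by rewrite subsetUl.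
have sB : B \subset A :|: B by rewrite subsetUr.
have cab : connect (radj (A :|: B)) a b.
{ case/orP: ab => [/eqP -> | ab]; first exact: connect0.
  by apply: connect1; rewrite radjE !inE aA bB ab orbT. }
move=> x; rewrite inE => /orP[xA | xB].
  by apply: radj_sub sA _; apply: conn_connect.
by apply: connect_trans cab _; apply: radj_sub sB _; apply: conn_connect.
Qed.

Lemma conn_add (G : sgraph) (A : {set G}) (a b : G) :
  connected_in A -> a \in A -> adj a b -> connected_in (b |: A).
Proof.
move=> cA aA ab; rewrite setUC.
by apply: (connU (a := a) (b := b)) => //; [exact: conn1|rewrite inE|rewrite ab orbT].
Qed.

(** A path in [S] lifts to a walk through the sets [C y]: cross each set inside itself and pass to
    the next one by the given edge. *)
Lemma conn_bigcup (K G : sgraph) (S : {set K}) (C : K -> {set G}) :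
  connected_in S -> (forall y, y \in S -> connected_in (C y)) ->
  (forall y z, y \in S -> z \in S -> adj y z ->
     exists a b : G, [/\ a \in C y, b \in C z & adj a b]) ->
  connected_in (\bigcup_(y in S) C y).
Proof.
move=> cS cC e; have [/set0Pn[y0 y0S] _] := cS.
have [/set0Pn[r rC] _] := cC _ y0S.
have sub y : y \in S -> C y \subset \bigcup_(y in S) C y by move=> yS; apply: bigcup_sup.
apply: (conn_rooted (r := r)); first by apply: (subsetP (sub _ y0S)).
move=> x /bigcupP[y yS xC].
have /connectP[p pp yl] := conn_connect cS y0S yS.
elim: p y0 r y0S rC pp yl => [|z p IH] y0 r y0S rC /=.
  move=> _ yy; rewrite yy in xC.
  by apply: radj_sub (sub _ y0S) _; apply: conn_connect => //; apply: cC.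
move=> /andP[/and3P[_ zS yz] pp] yl.
have [a [b [aC bC ab]]] := e _ _ y0S zS yz.
apply: connect_trans (IH _ _ zS bC pp yl).
have h1 : connect (radj (\bigcup_(y in S) C y)) r a.
  by apply: radj_sub (sub _ y0S) _; apply: conn_connect => //; apply: cC.
apply: connect_trans h1 _; apply: connect1.
by rewrite radjE (subsetP (sub _ y0S)) // (subsetP (sub _ zS)).
Qed.

Lemma minor_trans (H K G : sgraph) : minor H K -> minor K G -> minor H G.
Proof.
move=> [B [cB dB eB]] [C [cC dC eC]].
exists (fun x => \bigcup_(y in B x) C y); split.
- by move=> x; apply: conn_bigcup => // y z _ _; apply: eC.
- move=> x y xy; apply/pred0P => z /=; apply/negP => /andP[].
  move=> /bigcupP[u uB zu] /bigcupP[v vB zv].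
  have [uv | uv] := eqVneq u v.
    by have /pred0P/(_ u) /= := dB _ _ xy; rewrite uB uv vB.
  by have /pred0P/(_ z) /= := dC _ _ uv; rewrite zu zv.
- move=> x y /eB[a [b [aB bB ab]]].
  have [u [v [uC vC uv]]] := eC _ _ ab.
  by exists u, v; split=> //; apply/bigcupP; [exists a|exists b].
Qed.

Definition induced_adj (G : sgraph) (S : {set G}) : rel {x : G | x \in S} :=
  fun x y => adj (val x) (val y).

Lemma induced_sym (G : sgraph) (S : {set G}) : symmetric (@induced_adj G S).
Proof. by move=> x y; rewrite /induced_adj adjC. Qed.

Lemma induced_irrefl (G : sgraph) (S : {set G}) : irreflexive (@induced_adj G S).
Proof. by move=> x; rewrite /induced_adj adjxx. Qed.

Definition induced (G : sgraph) (S : {set G}) : sgraph :=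
  SGraph (@induced_sym G S) (@induced_irrefl G S).

Lemma subgraph_minor (H G : sgraph) : subgraph H G -> minor H G.
Proof.
move=> [f [fi fe]]; exists (fun x => [set f x]); split.
- by move=> x; apply: conn1.
- by move=> x y xy; rewrite disjoints1 inE (inj_eq fi).
- by move=> x y /fe h; exists (f x), (f y); rewrite !inE.
Qed.

Lemma induced_subgraph (G : sgraph) (S : {set G}) : subgraph (induced S) G.
Proof. by exists val; split=> //; apply: val_inj. Qed.

Lemma induced_minor (G : sgraph) (S : {set G}) : minor (induced S) G.
Proof. exact: subgraph_minor (induced_subgraph S). Qed.

Lemma nverts_induced (G : sgraph) (S : {set G}) : nverts (induced S) = #|S|.
Proof. by rewrite /nverts /= card_sig; apply: eq_card => x; rewrite inE. Qed.

(* Ordered adjacent pairs, hence twice the number of edges. *)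
Definition arcs (G : sgraph) : nat := \sum_(x : G) #|nbr x|.
Definition arcs_in (G : sgraph) (S : {set G}) : nat := \sum_(x in S) #|nbr x :&: S|.

Lemma arcs_setT (G : sgraph) : arcs_in [set: G] = arcs G.
Proof. by rewrite /arcs_in /arcs; apply: eq_big => x; rewrite ?inE // setIT. Qed.

Lemma arcs_induced (G : sgraph) (S : {set G}) : arcs (induced S) = arcs_in S.
Proof.
rewrite /arcs /arcs_in [RHS]big_sub /=; apply: eq_bigr => x _.
rewrite -(card_imset _ val_inj); apply: eq_card => y; rewrite !inE.
apply/imsetP/idP => [[z]|/andP[xy yS]].
  by rewrite inE => xz ->; rewrite (valP z) andbT.
by exists (Sub y yS); rewrite ?inE // SubK.
Qed.

Lemma card_nbrI (G : sgraph) (x : G) (S : {set G}) :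
  #|nbr x :&: S| = \sum_(y in S) adj x y.
Proof.
rewrite -sum1_card big_mkcond [RHS]big_mkcond /=; apply: eq_bigr => y _.
by rewrite !inE; case: (adj x y); case: (y \in S).
Qed.

Lemma card_nbr (G : sgraph) (x : G) : #|nbr x| = \sum_(y : G) adj x y.
Proof. by rewrite -[nbr x]setIT card_nbrI; apply: eq_bigl => y; rewrite inE. Qed.

Definition arcset (G : sgraph) (S : {set G}) : {set G * G} :=
  [set p | [&& p.1 \in S, p.2 \in S & adj p.1 p.2]].

Lemma arcs_inE (G : sgraph) (S : {set G}) : arcs_in S = #|arcset S|.
Proof.
rewrite -sum1_card (eq_bigl (fun p => (p.1 \in S) && ((p.2 \in S) && adj p.1 p.2))); last first.
  by move=> p; rewrite inE.
rewrite -(pair_big_dep (mem S) (fun x y => (y \in S) && adj x y) (fun _ _ => 1)) /=.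
by apply: eq_bigr => x _; rewrite -sum1_card; apply: eq_bigl => y; rewrite !inE andbC.
Qed.

Lemma arcs_cover (G : sgraph) (S A1 A2 : {set G}) :
  (forall x y, x \in S -> y \in S -> adj x y ->
     ((x \in A1) && (y \in A1)) || ((x \in A2) && (y \in A2))) ->
  arcs_in S <= arcs_in A1 + arcs_in A2.
Proof.
move=> h; rewrite !arcs_inE; apply: leq_trans (leq_card_setU _ _).
apply: subset_leq_card; apply/subsetP => -[x y]; rewrite !inE /= => /and3P[xS yS xy].
by rewrite xy !andbT; apply: h.
Qed.

Lemma arcs_del (G : sgraph) (x : G) : arcs G = arcs_in [set~ x] + (#|nbr x|).*2.
Proof.
rewrite /arcs (bigD1 x) //= -addnn addnA addnC; congr addn.
rewrite /arcs_in [X in _ + X]card_nbr [X in _ = _ + X](bigD1 x) //= adjxx add0n.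
rewrite (eq_bigl (mem [set~ x])); last by move=> i; rewrite !inE.
rewrite [X in _ + X](eq_bigl (mem [set~ x])); last by move=> i; rewrite !inE.
rewrite -big_split /=; apply: eq_bigr => y _; rewrite card_nbrI card_nbr (bigD1 x) //= addnC adjC; congr addn.
by apply: eq_bigl => z; rewrite !inE.
Qed.

Lemma arcs_le (G : sgraph) : arcs G <= nverts G * (nverts G).-1.
Proof.
rewrite /arcs -sum_nat_const; apply: leq_sum => x _.
have -> : (nverts G).-1 = #|[set~ x]| by rewrite cardsC1.
by apply: subset_leq_card; apply/subsetP => y; rewrite !inE => /adj_neq; rewrite eq_sym.
Qed.

Lemma arcsE (G : sgraph) : arcs G = (nedges G).*2.
Proof.
pose A := [set p : G * G | adj p.1 p.2].
have hA : arcs G = #|A|.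
{ rewrite -arcs_setT arcs_inE; apply: eq_card => p; by rewrite !inE. }
rewrite hA -sum1_card (partition_big (fun p => [set p.1; p.2]) (mem (edges G))) /=; last first.
{ move=> [x y]; rewrite !inE /= => xy.
  by apply/existsP; exists x; apply/existsP; exists y; rewrite xy eqxx. }
rewrite -muln2 /nedges -sum_nat_const; apply: eq_bigr => s.
rewrite inE => /existsP[x /existsP[y /andP[xy /eqP ->]]].
have xny := adj_neq xy.
rewrite sum1_card -[RHS](_ : #|[set (x, y); (y, x)]| = 2); last first.
{ by rewrite cards2 xpair_eqE (negPf xny). }
apply: eq_card => -[a b]; rewrite !inE /= !xpair_eqE unfold_in /= inE /=.
apply/idP/idP.
- move=> /andP[ab /eqP E].
  have : a \in [set x; y] by rewrite -E !inE eqxx.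
  have : b \in [set x; y] by rewrite -E !inE eqxx orbT.
  have anb := adj_neq ab.
  rewrite !inE => /orP[] /eqP eb /orP[] /eqP ea; subst a b; rewrite ?eqxx ?orbT //.
  + by rewrite eqxx in anb.
  + by rewrite eqxx in anb.
- move=> /orP[] /andP[/eqP -> /eqP ->]; first by rewrite xy eqxx.
  by rewrite adjC xy /= setUC.
Qed.

(** * Contracting or deleting an edge, and the effect on the number of arcs *)

Section Contract.
Variables (G : sgraph) (x y : G).
Definition cverts : {set G} := [set~ y].
(** [x] stands for the contracted edge and inherits the neighbours of [y]; the condition [a != b]
    removes the loop that this would create at [x]. *)
Definition cadj0 (a b : G) : bool :=
  (a != b) && [|| adj a b, (a == x) && adj y b | (b == x) && adj y a].

Definition contract_adj : rel {z : G | z \in cverts} := fun a b => cadj0 (val a) (val b).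

Lemma cadj0C a b : cadj0 a b = cadj0 b a.
Proof. by rewrite /cadj0 eq_sym adjC; congr andb; congr orb; rewrite orbC. Qed.

Lemma contract_sym : symmetric contract_adj.
Proof. by move=> a b; apply: cadj0C. Qed.

Lemma contract_irrefl : irreflexive contract_adj.
Proof. by move=> a; rewrite /contract_adj /cadj0 eqxx. Qed.

Definition contract : sgraph := SGraph contract_sym contract_irrefl.

Hypothesis xy : adj x y.

Lemma contract_minor : minor contract G.
Proof.
have yx : y != x by rewrite eq_sym adj_neq.
pose C (a : contract) : {set G} := if val a == x then [set x; y] else [set val a].
exists C; split.
- move=> a; rewrite /C; case: eqP => _; last exact: conn1.
  by rewrite setUC; apply: (conn_add (a := x)) => //; [exact: conn1|rewrite inE].
- move=> a b ab; have vab : val a != val b by rewrite (inj_eq val_inj).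
  have ay := valP a; have by' := valP b; rewrite !inE in ay by'.
  apply/pred0P => z /=; rewrite /C; apply/negP => /andP[].
  case: eqP => ea; case: eqP => eb; rewrite !inE.
  + by rewrite ea eb eqxx in vab.
  + move=> /orP[]/eqP -> /eqP e; first by rewrite ea e eqxx in vab.
    by rewrite -e eqxx in by'.
  + move=> /eqP -> /orP[]/eqP e; first by rewrite eb e eqxx in vab.
    by rewrite e eqxx in ay.
  + by move=> /eqP -> /eqP e; rewrite e eqxx in vab.
- move=> a b /andP[_ /or3P[h|/andP[/eqP ea h]|/andP[/eqP eb h]]].
  + by exists (val a), (val b); rewrite /C; split=> //; case: eqP => e; rewrite !inE ?e ?eqxx.
  + exists y, (val b); rewrite /C ea eqxx; split=> //; first by rewrite !inE eqxx orbT.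
    by case: eqP => e; rewrite !inE ?e ?eqxx.
  + exists (val a), y; rewrite /C eb eqxx; split=> //; last by rewrite adjC.
      by case: eqP => e; rewrite !inE ?e ?eqxx.
    by rewrite !inE eqxx orbT.
Qed.

Lemma nverts_contract : nverts contract = (nverts G).-1.
Proof. by have := nverts_induced cverts; rewrite cardsC1. Qed.

(** Besides the edge itself, contraction loses one edge for each common neighbour, whose two edges
    become parallel; every edge counts as two arcs. *)
Lemma arcs_contract :
  arcs G <= arcs contract + 2 + (#|nbr x :&: nbr y|).*2.
Proof.
have yx : y != x by rewrite eq_sym adj_neq.
pose M (a : G) : {set G} := [set b in cverts | cadj0 a b].
have -> : arcs contract = \sum_(a in cverts) #|M a|.
{ rewrite /arcs [RHS]big_sub /=; apply: eq_bigr => a _.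
  rewrite -(card_imset _ val_inj); apply: eq_card => b; rewrite !inE.
  apply/imsetP/idP => [[z]|/andP[bC ab]].
    by rewrite inE => az ->; have := valP z; rewrite !inE => ->.
  have bC' : b \in cverts by rewrite !inE.
  by exists (Sub b bC'); rewrite ?inE ?SubK. }
rewrite /arcs (bigD1 y) //= (bigD1 x) /=; last by rewrite eq_sym.
rewrite [X in _ <= X + _ + _](bigD1 x) /=; last by rewrite !inE eq_sym.
pose c := #|nbr x :&: nbr y|.
have h1 : #|nbr y| + #|nbr x| <= #|M x| + 2 + c.
{ have sub : (nbr x :|: nbr y) \subset M x :|: [set x; y].
    apply/subsetP => z; rewrite !inE /cadj0 eqxx /=.
    have [-> //|zx] := eqVneq z x; first by rewrite orbT.
    have [->|zy] := eqVneq z y; first by rewrite !orbT.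
    by move=> /orP[] ->; rewrite /= ?orbT.
  have := subset_leq_card sub; have [le _] := leq_card_setU (M x) [set x; y].
  have := cardsUI (nbr x) (nbr y); move: le; rewrite cards2 -/c; case: (x != y) => /=; lia. }
(* A vertex other than [x] and [y] loses a neighbour only if it is adjacent to both. *)
have h2 : \sum_(i | (i != y) && (i != x)) #|nbr i| <=
    \sum_(i in cverts | i != x) #|M i| + c.
{ have cc : \sum_(i | (i != y) && (i != x)) (adj i x && adj i y) <= c.
    rewrite /c -sum1_card big_mkcond [leqRHS]big_mkcond /=.
    apply: leq_sum => i _; rewrite !inE [adj x i]adjC [adj y i]adjC.
    by case: (i != y); case: (i != x); case: (adj i x); case: (adj i y).
  apply: leq_trans (leq_add (leqnn _) cc).
  have -> : \sum_(i in cverts | i != x) #|M i| = \sum_(i | (i != y) && (i != x)) #|M i|.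
    by apply: eq_bigl => i; rewrite !inE.
  rewrite -big_split /=; apply: leq_sum => a /andP[ay ax].
  have sub : nbr a :\ y \subset M a.
    apply/subsetP => z; rewrite !inE /cadj0 => /andP[-> az] /=.
    by rewrite az (adj_neq az).
  have [ayE|ayE] := boolP (adj a y); last first.
    rewrite andbF addn0; apply: leq_trans (subset_leq_card sub).
    by rewrite [leqLHS](cardsD1 y) inE (negPf ayE).
  have [axE|axE] := boolP (adj a x).
    by have := subset_leq_card sub; have := cardsD1 y (nbr a); rewrite inE ayE; lia.
  have sub2 : x |: (nbr a :\ y) \subset M a.
    rewrite subUset sub andbT sub1set !inE /cadj0 ax eqxx [adj y a]adjC ayE /= orbT.
    by rewrite orbT andbT eq_sym.
  have := subset_leq_card sub2; have := cardsD1 y (nbr a).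
  by rewrite cardsU1 !inE ayE (negPf axE) andbF /=; lia. }
rewrite -/c; move: h1 h2; lia.
Qed.
End Contract.

Section DelEdge.
Variables (G : sgraph) (x y : G).
Definition del_adj : rel G :=
  fun a b => adj a b && ~~ (((a == x) && (b == y)) || ((a == y) && (b == x))).
Lemma del_sym : symmetric del_adj.
Proof. by move=> a b; rewrite /del_adj adjC orbC [(a == y) && _]andbC [(a == x) && _]andbC. Qed.
Lemma del_irrefl : irreflexive del_adj.
Proof. by move=> a; rewrite /del_adj adjxx. Qed.
Definition del_edge : sgraph := SGraph del_sym del_irrefl.
Lemma del_edge_minor : minor del_edge G.
Proof. by apply: subgraph_minor; exists id; split=> // a b /andP[]. Qed.
Lemma arcs_del_edge : adj x y -> arcs G <= arcs del_edge + 2.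
Proof.
move=> xy; rewrite -!arcs_setT !arcs_inE.
have sub : arcset [set: G] \subset arcset [set: del_edge] :|: [set (x, y); (y, x)].
  apply/subsetP => -[a b]; rewrite !inE /= => ab; rewrite /del_adj ab /= !xpair_eqE.
  by case: (_ && _); case: (_ && _).
apply: leq_trans (subset_leq_card sub) _; apply: leq_trans (leq_card_setU _ _) _.
by rewrite leq_add2l cards2; case: eqP.
Qed.
Lemma lt_arcs_del_edge : adj x y -> arcs del_edge < arcs G.
Proof.
move=> xy; rewrite -!arcs_setT !arcs_inE; apply: proper_card; apply/properP; split.
  by apply/subsetP => -[a b]; rewrite !inE /= => /andP[].
by exists (x, y); rewrite !inE //= /del_adj !eqxx xy.
Qed.
End DelEdge.

Lemma ex_minimal (P : sgraph -> Prop) (mu : sgraph -> nat) (G0 : sgraph) :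
  P G0 -> exists G, P G /\ forall G', P G' -> mu G <= mu G'.
Proof.
move: {2}(mu G0) (leqnn (mu G0)) => k; elim/ltn_ind: k G0 => k IH G0 le P0.
case: (classic (exists G', P G' /\ mu G' < mu G0)) => [[G' [PG' lt]]|h].
  by apply: (IH (mu G') _ G') => //; apply: leq_trans lt le.
exists G0; split=> // G' PG'; rewrite leqNgt; apply/negP => lt.
by apply: h; exists G'.
Qed.

Lemma not_connected (G : sgraph) (B : {set G}) : B != set0 -> ~ connected_in B ->
  exists x y, [/\ x \in B, y \in B & ~~ connect (radj B) x y].
Proof.
move=> B0 nc; apply: NNPP => h; apply: nc; split=> // x y xB yB.
by apply/negPn/negP => nxy; apply: h; exists x, y.
Qed.

(* If one of the listed properties failed, then deleting a vertex or an edge,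
   contracting an edge, or passing to one side of a small separation would give a
   smaller graph with [2 * D * v < arcs + 2 * D * p]. *)
Lemma minimal_graph (P : sgraph -> Prop) (D p : nat) (G0 : sgraph) :
  (forall G G', P G -> minor G' G -> P G') -> 0 < p -> 2 * p <= D ->
  P G0 -> 2 * p <= nverts G0 -> 2 * D * nverts G0 < arcs G0 + 2 * D * p ->
  exists G : sgraph, P G /\
    [/\ forall x : G, D < #|nbr x|,
        forall x y : G, adj x y -> D <= #|nbr x :&: nbr y|,
        forall Z : {set G}, #|Z| < p -> connected_in (~: Z),
        2 * D <= nverts G + 2 * p &
        arcs G + 2 * D * p <= 2 * D * nverts G + 2].
Proof.
move=> Pm p0 pD PG0 v0 e0.
(* The lower bound on the order excludes the graphs with fewer than [p] vertices, which satisfy the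
   inequality trivially. *)
pose Cl G := [/\ P G, 2 * p <= nverts G & 2 * D * nverts G < arcs G + 2 * D * p].
(* The cube makes the order lexicographic: by [arcs_le], the loss of a vertex outweighs any change
   in the number of arcs. *)
have [G [[PG vG eG] min]] :=
  @ex_minimal Cl (fun G => nverts G ^ 3 + arcs G) G0 (And3 PG0 v0 e0).
exists G; split=> //.
have red G' : minor G' G ->
    (nverts G' < nverts G) || (nverts G' == nverts G) && (arcs G' < arcs G) ->
    2 * p <= nverts G' -> arcs G' + 2 * D * p <= 2 * D * nverts G'.
  move=> mG lt v'; rewrite leqNgt; apply/negP => e'.
  have m := min G' (And3 (Pm _ _ PG mG) v' e').
  case/orP: lt => [lt|/andP[/eqP e lt]]; last by move: m; rewrite e; lia.
  have := arcs_le G'; move: m lt; rewrite !expnS expn0 !muln1.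
  move: (nverts G) (nverts G') (arcs G) (arcs G') => u u' a a' h1 h2 h3.
  have h4 : u'.+1 * (u'.+1 * u'.+1) <= u * (u * u) by rewrite !leq_mul.
  nia.
have aG := arcs_le G.
have vD : D < nverts G.
  by rewrite ltnNge; apply/negP => vD; nia.
have deg (x : G) : D < #|nbr x|.
{ have := arcs_del x; rewrite -arcs_induced => E.
  have nv : nverts (induced [set~ x]) = (nverts G).-1 by rewrite nverts_induced cardsC1.
  by have := red (induced [set~ x]) (induced_minor _); rewrite nv; nia. }
split=> //.
- move=> x y xy.
  have := red (contract x y) (contract_minor xy).
  have := arcs_contract xy; rewrite nverts_contract => h1 h2.
  nia.
- move=> Z Zp; apply: NNPP => nc.
  have Z0 : ~: Z != set0.
    rewrite -card_gt0 cardsCs setCK; move: vD; rewrite /nverts; lia.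
  have [x [y [xZ yZ nxy]]] := not_connected Z0 nc.
  (* The sides [A :|: Z] and [~: A] overlap in [Z] only. Adding their two inequalities costs
     [2 * D * #|Z|] for the overlap but gains a second slack [2 * D * p], which is more. *)
  pose A := [set z | connect (radj (~: Z)) x z].
  have xA : x \in A by rewrite inE connect0.
  have yA : y \notin A by rewrite inE.
  have AZ z : z \in A -> z \notin Z.
    rewrite inE => h; rewrite -in_setC; apply: (connect_closed _ xZ h) => //.
  have cl a b : a \in A -> b \notin Z -> adj a b -> b \in A.
    move=> aA bZ ab; have aZ := AZ _ aA; rewrite !inE in aA *.
    by apply: connect_trans aA _; apply: connect1; rewrite radjE !inE aZ bZ ab.
  have cov : forall a b, a \in [set: G] -> b \in [set: G] -> adj a b ->
     ((a \in A :|: Z) && (b \in A :|: Z)) || ((a \in ~: A) && (b \in ~: A)).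
    move=> a b _ _ ab; rewrite !in_setU !in_setC.
    have := cl a b; have := cl b a; rewrite [adj b a]adjC ab.
    have := AZ a; have := AZ b.
    case: (a \in A); case: (b \in A); case: (a \in Z); case: (b \in Z) => //= h1 h2 h3 h4;
    first [by have := h1 isT | by have := h2 isT | by have := h3 isT isT isT
      | by have := h4 isT isT isT].
  have cu := arcs_cover cov; rewrite arcs_setT -!arcs_induced in cu.
  have nA : #|A :|: Z| = #|A| + #|Z|.
    rewrite cardsU; have -> : A :&: Z = set0; last by rewrite cards0 subn0.
    by apply/setP => z; rewrite !inE; apply/negP => /andP[zA zZ]; have := AZ z; rewrite inE zA zZ => /(_ isT).
  have nAc : #|~: A| + #|A| = nverts G by rewrite addnC cardsC.
  have d1 : D <= #|A :|: Z|.
    apply: leq_trans (ltnW (deg x)) _; apply: subset_leq_card; apply/subsetP => z.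
    rewrite in_nbr => xz; rewrite in_setU; case: (boolP (z \in Z)); rewrite ?orbT // => zZ.
    by rewrite (cl x).
  have d2 : D <= #|~: A|.
    apply: leq_trans (ltnW (deg y)) _; apply: subset_leq_card; apply/subsetP => z.
    rewrite in_nbr in_setC => yz; apply/negP => zA; move: yA; rewrite (cl z) //.
      by rewrite -in_setC.
    by rewrite adjC.
  have A0 : 0 < #|A| by apply/card_gt0P; exists x.
  have Ac0 : #|A :|: Z| < nverts G.
    rewrite ltnNge; apply/negP => h.
    have /eqP/setP/(_ y) : A :|: Z == [set: G] by rewrite eqEcard subsetT cardsT.
    by rewrite in_setU (negPf yA) in_setT -[y \in Z]negbK -in_setC yZ.
  have m1 := red (induced (A :|: Z)) (induced_minor _).
  have m2 := red (induced (~: A)) (induced_minor _).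
  have l1 : arcs (induced (A :|: Z)) <= arcs G.
    rewrite arcs_induced -arcs_setT !arcs_inE; apply: subset_leq_card.
    by apply/subsetP => u; rewrite !inE /= => /and3P[_ _ ->].
  have l2 : arcs (induced (~: A)) <= arcs G.
    rewrite arcs_induced -arcs_setT !arcs_inE; apply: subset_leq_card.
    by apply/subsetP => u; rewrite !inE /= => /and3P[_ _ ->].
  rewrite !nverts_induced in m1 m2.
  have M1 : arcs (induced (A :|: Z)) + 2 * D * p <= 2 * D * #|A :|: Z| by apply: m1; lia.
  have M2 : arcs (induced (~: A)) + 2 * D * p <= 2 * D * #|~: A| by apply: m2; lia.
  nia.
- rewrite leqNgt; apply/negP => h.
  have h1 : 2 * p <= nverts G by [].
  (* Concavity of [v * (2 * D - v)] in [v]: between [2 * p] and [2 * D - 2 * p] it is at least its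
     common value at these ends. *)
  have h2 : (nverts G - 2 * p) * (2 * D - 2 * p - nverts G) + nverts G * nverts G
     + 2 * p * (2 * D - 2 * p) <= 2 * D * nverts G by nia.
  nia.
- have [x [y xy]] : exists x y : G, adj x y.
  { apply: NNPP => no; have a0 : arcs G = 0.
      rewrite /arcs big1 // => x _; apply/eqP; rewrite cards_eq0; apply/eqP/setP => y.
      by rewrite !inE; apply/negP => xy; apply: no; exists x, y.
    by have := deg; nia. }
  have := red (del_edge x y) (del_edge_minor x y) .
  have := arcs_del_edge xy; have := lt_arcs_del_edge xy.
  have -> : nverts (del_edge x y) = nverts G by [].
  lia.
Qed.

(** * Complete tripartite subgraphs of dense triple systems *)

Lemma subset_of_card (T : finType) (X : {set T}) s : s <= #|X| ->
  exists S : {set T}, S \subset X /\ #|S| = s.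
Proof.
move=> le; exists [set x in take s (enum X)]; split.
  by apply/subsetP => x; rewrite inE => /mem_take; rewrite mem_enum.
rewrite cardsE; have /card_uniqP -> : uniq (take s (enum X)) by rewrite take_uniq ?enum_uniq.
by rewrite size_takel // -cardE.
Qed.

Lemma card_bigcup_le (I T : finType) (P : {pred I}) (F : I -> {set T}) :
  #|\bigcup_(i in P) F i| <= \sum_(i in P) #|F i|.
Proof.
elim/big_rec2: _ => [|i m X _ le]; first by rewrite cards0.
by have [h _] := leq_card_setU (F i) X; apply: leq_trans h _; rewrite leq_add2l.
Qed.

(** Discarding an element with the least value never lowers the average. *)
Lemma heavy_subset (T : finType) (A : {set T}) (f : T -> nat) (n c : nat) :
  n <= #|A| -> #|A| * c <= \sum_(a in A) f a ->
  exists A0 : {set T}, [/\ A0 \subset A, #|A0| = n & n * c <= \sum_(a in A0) f a].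
Proof.
move: {2}(#|A| - n) (erefl (#|A| - n)) => k; elim: k A => [|k IH] A e le h.
  by exists A; have <- : #|A| = n by lia.
have [a0 a0A] : exists a, a \in A by apply/card_gt0P; lia.
case: (arg_minnP f (a0A : [pred a | a \in A] a0)) => a /= aA amin.
have cA := cardsD1 a A; rewrite aA in cA.
have sA : \sum_(x in A) f x = f a + \sum_(x in A :\ a) f x.
  by rewrite (big_setD1 a aA).
have fa : #|A| * f a <= \sum_(x in A) f x.
  by rewrite -sum_nat_const; apply: leq_sum => x; apply: amin.
case: (IH (A :\ a)) => [|||A0 [s1 s2 s3]]; [lia|lia| |].
  by nia.
by exists A0; split=> //; apply: subset_trans s1 (subsetDl _ _).
Qed.

(** Restrict to [2 * d * s] elements of [A] whose average degree is no lower. At least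
    [#|B| / (2 * d)] elements of [B] then have [s] neighbours among them, and some [s]-set is shared
    by a proportion of at least [1 / 2 ^ (2 * d * s)] of these. The conclusion keeps a positive
    proportion of [B], so the lemma can be iterated. *)
Lemma kst_bip (T1 T2 : finType) (A : {set T1}) (B : {set T2}) (R : T1 -> T2 -> bool) d s :
  0 < d -> 2 * d * s <= #|A| ->
  #|A| * #|B| <= d * \sum_(a in A) #|[set b in B | R a b]| ->
  exists S : {set T1}, [/\ S \subset A, #|S| = s &
    #|B| <= 2 * d * 2 ^ (2 * d * s) * #|[set b in B | [forall (a | a \in S), R a b]]|].
Proof.
move=> d0 nA h; set n := 2 * d * s in nA *.
have [|A0 [sA0 cA0 hA0]] := @heavy_subset _ A (fun a => d * #|[set b in B | R a b]|) n #|B| nA.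
  by rewrite -big_distrr.
rewrite -big_distrr /= in hA0.
pose N b := [set a in A0 | R a b].
pose Bp := [set b in B | s <= #|N b|].
have dc : \sum_(a in A0) #|[set b in B | R a b]| = \sum_(b in B) #|N b|.
{ transitivity (\sum_(a in A0) \sum_(b in B) R a b).
    apply: eq_bigr => a _; rewrite -sum1_card big_mkcond [RHS]big_mkcond /=.
    by apply: eq_bigr => b _; rewrite inE; case: (b \in B); case: (R a b).
  rewrite exchange_big /=; apply: eq_bigr => b _.
  rewrite -sum1_card big_mkcond [RHS]big_mkcond /=.
  by apply: eq_bigr => a _; rewrite inE; case: (a \in A0); case: (R a b). }
have ub : \sum_(b in B) #|N b| <= #|Bp| * n + #|B| * s.
{ rewrite -!sum_nat_const (big_setID Bp) /=.
  have -> : B :&: Bp = Bp by apply/setP => b; rewrite !inE andbA andbb.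
  apply: leq_add.
    apply: leq_sum => b _; rewrite -cA0; apply: subset_leq_card.
    by apply/subsetP => a; rewrite inE => /andP[].
  rewrite [leqRHS](big_setID Bp) /=; apply: leq_trans _ (leq_addl _ _).
  apply: leq_sum => b; rewrite !inE => /andP[]; rewrite negb_and => /orP[/negP //|].
  by rewrite -ltnNge => /ltnW. }
rewrite dc in hA0.
have hB : #|B| <= 2 * d * #|Bp|.
{ case: (posnP s) => [s0|s0].
    suff -> : Bp = B by nia.
    by apply/setP => b; rewrite !inE s0 leq0n andbT.
  have h1 : n * #|B| <= d * (#|Bp| * n + #|B| * s) by apply: leq_trans hA0 _; rewrite leq_mul2l ub orbT.
  have n0 : 0 < d * s by rewrite muln_gt0 d0.
  have h2 : (d * s) * #|B| <= (d * s) * (2 * d * #|Bp|) by rewrite /n in h1; nia.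
  by rewrite leq_pmul2l in h2. }
pose C (S : {set T1}) := [set b in B | [forall (a | a \in S), R a b]].
pose P := [set S in powerset A0 | #|S| == s].
have [S0 [sS0 cS0]] : exists S : {set T1}, S \subset A0 /\ #|S| = s.
  by apply: subset_of_card; rewrite cA0 /n; nia.
have S0P : S0 \in P by rewrite !inE sS0 cS0 eqxx.
case: (arg_maxnP (fun S => #|C S|) (S0P : [pred X | X \in P] S0)) => S /=; rewrite !inE => /andP[sS /eqP cS] Smax.
exists S; split=> //; first exact: subset_trans sS sA0.
have cP : #|P| <= 2 ^ n.
  rewrite -cA0 -card_powerset; apply: subset_leq_card.
  by apply/subsetP => X; rewrite inE => /andP[].
have sub : Bp \subset \bigcup_(X in P) C X.
{ apply/subsetP => b; rewrite inE => /andP[bB sN].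
  have [X [sX cX]] := subset_of_card sN.
  apply/bigcupP; exists X.
    rewrite !inE cX eqxx andbT; apply: subset_trans sX _.
    by apply/subsetP => a; rewrite inE => /andP[].
  rewrite inE bB /=; apply/forall_inP => a aX; have := subsetP sX a aX.
  by rewrite inE => /andP[]. }
have h3 : #|Bp| <= #|P| * #|C S|.
{ apply: leq_trans (subset_leq_card sub) _.
  apply: leq_trans (card_bigcup_le _ _) _ => //=.
  rewrite -sum_nat_const; apply: leq_sum => X; exact: Smax. }
have h4 : #|P| * #|C S| <= 2 ^ n * #|C S| by rewrite leq_mul2r cP orbT.
rewrite -/(C S); apply: leq_trans hB _; rewrite -[leqRHS]mulnA leq_mul2l.
by rewrite (leq_trans h3 h4) orbT.
Qed.

(** The summands are what the two uses of [kst_bip] and the final choice of an [s]-set in [kst3]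
    require. *)
Definition kst_bound (d s : nat) : nat :=
  let d1 := 2 * d * 2 ^ (2 * d * s) in
  let d2 := 2 * d1 * 2 ^ (2 * d1 * s) in
  2 * d * s + 2 * d1 * s + d2 * s.

(** Two uses of [kst_bip]: between [A0] and the pairs in [setX A1 A2], then between [A1] and [A2]
    along the pairs [C] common to all of [S0]. *)
Lemma kst3 (V : finType) (A0 A1 A2 : {set V}) (T : V * (V * V) -> bool) (d s : nat) :
  0 < d -> kst_bound d s <= #|A0| -> kst_bound d s <= #|A1| -> kst_bound d s <= #|A2| ->
  #|A0| * (#|A1| * #|A2|) <= d * #|[set x in setX A0 (setX A1 A2) | T x]| ->
  exists S0 S1 S2 : {set V},
    [/\ S0 \subset A0 /\ #|S0| = s, S1 \subset A1 /\ #|S1| = s, S2 \subset A2 /\ #|S2| = s &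
     forall x, x \in setX S0 (setX S1 S2) -> T x].
Proof.
rewrite /kst_bound.
set d1 := 2 * d * 2 ^ _; set d2 := 2 * d1 * 2 ^ (2 * d1 * s) => d0 h0 h1 h2 h.
have [||S0 [sS0 cS0 hS0]] := @kst_bip _ _ A0 (setX A1 A2) (fun a b => T (a, b)) d s d0.
- lia.
- rewrite cardsX; apply: leq_trans h _; rewrite leq_mul2l; apply/orP; right.
  rewrite -sum1_card (eq_bigl (fun p => (p.1 \in A0) && ((p.2 \in setX A1 A2) && T (p.1, p.2)))); last first.
    by move=> [a [b c]]; rewrite !inE /= -!andbA.
  rewrite -(pair_big_dep (mem A0) (fun x y => (y \in setX A1 A2) && T (x, y)) (fun _ _ => 1)) /=.
  by apply: leq_sum => a _; rewrite -sum1_card; rewrite (eq_bigl (fun y => (y \in setX A1 A2) && T (a, y))) // => b; rewrite inE.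
set C := [set b in setX A1 A2 | _] in hS0.
have d10 : 0 < d1 by rewrite /d1 !muln_gt0 d0 expn_gt0.
have [||S1 [sS1 cS1 hS1]] := @kst_bip _ _ A1 A2 (fun b c => (b, c) \in C) d1 s d10.
- lia.
- rewrite cardsX in hS0; apply: leq_trans hS0 _; rewrite leq_mul2l; apply/orP; right.
  rewrite -sum1_card (eq_bigl (fun p => (p.1 \in A1) && ((p.2 \in A2) && ((p.1, p.2) \in C)))); last first.
    move=> [a b] /=; rewrite !inE /=; case: (a \in A1) => //=; case: (b \in A2) => //=.
  rewrite -(pair_big_dep (mem A1) (fun x y => (y \in A2) && ((x, y) \in C)) (fun _ _ => 1)) /=.
  apply: leq_sum => a _; rewrite -sum1_card [leqRHS](eq_bigl (fun y => (y \in A2) && ((a, y) \in C))) //.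
  by move=> b; rewrite inE.
set C2 := [set b in A2 | _] in hS1.
have [S2 [sS2 cS2]] : exists S : {set V}, S \subset C2 /\ #|S| = s.
{ apply: subset_of_card.
  have d20 : 0 < d2 by rewrite /d2 muln_gt0 expn_gt0 muln_gt0 d10.
  by rewrite -(leq_pmul2l d20); apply: leq_trans hS1; lia. }
exists S0, S1, S2; split=> //.
  by split=> //; apply: subset_trans sS2 _; apply/subsetP => x; rewrite inE => /andP[].
move=> [a [b c]]; rewrite !inE /= => /and3P[aS bS cS].
have := subsetP sS2 _ cS; rewrite inE => /andP[_ /forall_inP/(_ _ bS)].
by rewrite inE => /andP[_ /forall_inP/(_ _ aS)].
Qed.

(** * Disjoint connectors between two sets *)

Section Menger.
Variable V : finType.
Implicit Types (e : rel V) (A B S T X Y : {set V}) (l q r : seq V).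

Definition head_in A l := if l is x :: _ then x \in A else false.
Definition last_in A l := if l is x :: p then last x p \in A else false.
Definition walk e A B l := [&& head_in A l, sorted e l & last_in B l].

Lemma head_in_rcons A q t r : head_in A (rcons q t ++ r) = head_in A (rcons q t).
Proof. by case: q. Qed.

Lemma last_in_rcons A q t : last_in A (rcons q t) = (t \in A).
Proof. by case: q => //= x q; rewrite last_rcons. Qed.

Lemma last_in_cat A q t r : last_in A (q ++ t :: r) = last_in A (t :: r).
Proof. by case: q => //= x q; rewrite last_cat. Qed.

Lemma head_in_rev A l : head_in A (rev l) = last_in A l.
Proof. by elim/last_ind: l => // l x _; rewrite rev_rcons last_in_rcons. Qed.

Lemma last_in_rev A l : last_in A (rev l) = head_in A l.
Proof. by rewrite -head_in_rev revK. Qed.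

Lemma sorted_rcons_cat e q t r :
  sorted e (rcons q t ++ r) = sorted e (rcons q t) && path e t r.
Proof. by case: q => //= x q; rewrite cat_path last_rcons. Qed.

Definition separates e A B S : Prop := forall l, walk e A B l -> has (mem S) l.

(** Walks may repeat vertices; disjointness is required only between different walks, and [I] is
    merely a set of labels. *)
Definition linked e A B k : Prop :=
  exists (I : {set V}) (P : V -> seq V), [/\ #|I| = k,
    forall i, i \in I -> walk e A B (P i) &
    forall i j z, i \in I -> j \in I -> z \in P i -> z \in P j -> i = j].

(** Each walk is cut at its first vertex in [X]. Since there are as many walks as vertices of [X],
    every vertex of [X] is reached by exactly one, and the walks can be indexed by their ends. *)
Lemma linked_end e A X k : linked e A X k -> #|X| = k ->
  exists P : V -> seq V, [/\
    forall t, t \in X -> head_in A (rcons (P t) t) && sorted e (rcons (P t) t),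
    forall t z, t \in X -> z \in P t -> z \notin X &
    forall t u z, t \in X -> u \in X -> z \in rcons (P t) t -> z \in rcons (P u) u -> t = u].
Proof.
move=> [I [P [cI hP dP]]] cX.
pose f i := find (mem X) (P i).
pose t i := nth i (P i) (f i).
pose q i := take (f i) (P i).
have main i : i \in I -> [/\ t i \in X, ~~ has (mem X) (q i) & exists r, P i = rcons (q i) (t i) ++ r].
{ move=> iI; have /and3P[_ _ lX] := hP i iI.
  have hX : has (mem X) (P i).
    case: (P i) lX => // x p lX; apply/hasP; exists (last x p) => //; exact: mem_last.
  rewrite /t /q /f; case: (split_find_nth i hX) => z s1 s2 zX ns1; split=> //.
  by exists s2. }
have sub i z : i \in I -> z \in rcons (q i) (t i) -> z \in P i.
  by move=> /main[_ _ [r ->]] zq; rewrite mem_cat zq.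
have tinj : {in I &, injective t}.
  move=> i j iI jI e'; apply: (dP i j (t i)) => //.
    by apply: sub => //; rewrite mem_rcons inE eqxx.
  by apply: sub => //; rewrite e' mem_rcons inE eqxx.
have tX : t @: I = X.
{ apply/eqP; rewrite eqEcard card_in_imset // cI cX leqnn andbT.
  by apply/subsetP => z /imsetP[i /main[h _ _] ->]. }
pose g u := odflt u [pick i | (i \in I) && (t i == u)].
have hg u : u \in X -> g u \in I /\ t (g u) = u.
{ rewrite -tX => /imsetP[i iI ->]; rewrite /g; case: pickP => [j /andP[jI /eqP e']|none] //=.
  by have := none i; rewrite iI eqxx. }
exists (fun u => q (g u)); split.
- move=> u uX; have [gI gu] := hg u uX; have [_ _ [r E]] := main _ gI.
  rewrite -{2 4}gu; have /and3P[h1 h2 _] := hP _ gI.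
  rewrite E head_in_rcons in h1; rewrite E sorted_rcons_cat in h2.
  by rewrite h1; case/andP: h2.
- move=> u z uX zq; have [gI gu] := hg u uX; have [_ nh _] := main _ gI.
  by apply/negP => zX; move/hasP: nh; apply; exists z.
- move=> u v z uX vX zu zv; have [gI gu] := hg u uX; have [gI' gv] := hg v vX.
  rewrite -gu -gv; congr t; apply: (dP _ _ z) => //; apply: sub => //.
    by rewrite gu.
  by rewrite gv.
Qed.

Section Del.
Variables (e : rel V) (x y : V).
Definition del_arc : rel V := fun a b => e a b && ~~ ((a == x) && (b == y)).

Lemma sorted_del_source l t : sorted e (rcons l t) -> x \notin l -> sorted del_arc (rcons l t).
Proof.
case: l => //= a l; elim: l a => [|b l IH] a /=.
  by rewrite !andbT inE eq_sym /del_arc => -> /negPf ->.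
move=> /andP[ab pp]; rewrite inE negb_or => /andP[xa xb].
by rewrite IH // andbT /del_arc ab eq_sym (negPf xa).
Qed.

Lemma sorted_del_target t l : sorted e (t :: l) -> y \notin l -> sorted del_arc (t :: l).
Proof.
rewrite /=; elim: l t => //= b l IH t /andP[tb pp]; rewrite inE negb_or => /andP[yb yl].
by rewrite IH // andbT /del_arc tb [b == y]eq_sym (negPf yb) andbF.
Qed.

Lemma sorted_del_sub l : sorted del_arc l -> sorted e l.
Proof. by apply: sub_sorted => a b /andP[]. Qed.
End Del.

(* Goering's proof of Menger's theorem, by induction on the number of arcs. *)
Theorem menger_rel e A B k : (forall S, separates e A B S -> k <= #|S|) -> linked e A B k.
Proof.
pose na (e : rel V) := #|[set p : V * V | e p.1 p.2]|.
move: {2}(na e) (leqnn (na e)) => n; elim: n e A B k => [|n IH] e A B k hn hsep.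
{ have noe a b : e a b = false.
    apply/negP => ab; move: hn; rewrite leqn0 cards_eq0 => /eqP/setP/(_ (a, b)).
    by rewrite !inE ab.
  have [T [sT cT]] : exists T : {set V}, T \subset A :&: B /\ #|T| = k.
    apply: subset_of_card; apply: hsep => -[|a [|b l]] /and3P[] //=; last by rewrite noe.
    by move=> aA _ aB; rewrite inE aA aB.
  exists T, (fun t => [:: t]); split=> //.
    by move=> i /(subsetP sT); rewrite /walk /= inE.
  by move=> i j z _ _; rewrite !inE => /eqP -> /eqP. }
case: (posnP (na e)) => [e0|]; first by apply: IH => //; rewrite e0.
rewrite card_gt0 => /set0Pn[[x y]]; rewrite inE /= => xy.
pose e' := del_arc e x y.
have lt : na e' < na e.
{ apply: proper_card; apply/properP; split.
    by apply/subsetP => -[a b]; rewrite !inE => /andP[].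
  by exists (x, y); rewrite !inE //= /e' /del_arc !eqxx andbF. }
(* Either the arc can be deleted, or some [S] with fewer than [k] vertices separates without it;
   adding either end of the arc to [S] then gives a separator of size exactly [k]. *)
case: (classic (forall S, separates e' A B S -> k <= #|S|)) => [h|].
{ have [|I [P [cI hP dP]]] := IH e' A B k _ h; first by move: lt hn; clear; lia.
  exists I, P; split=> // i /hP/and3P[h1 h2 h3].
  by rewrite /walk h1 h3 (sorted_del_sub h2). }
move=> nall; have [S [hS cS]] : exists S, separates e' A B S /\ #|S| < k.
  apply: NNPP => no; apply: nall => S hS; rewrite leqNgt; apply/negP => lt'.
  by apply: no; exists S.
have noX l : sorted e l -> x \notin l -> sorted e' l.
  elim/last_ind: l => // l t _ sl; rewrite mem_rcons inE negb_or => /andP[_ nl].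
  exact: sorted_del_source.
have noY l : sorted e l -> y \notin l -> sorted e' l.
  by case: l => // t l sl; rewrite inE negb_or => /andP[_ nl]; apply: sorted_del_target.
have cxS : k <= #|x |: S|.
{ apply: hsep => l /and3P[h1 h2 h3]; have [xl|xl] := boolP (x \in l).
    by apply/hasP; exists x => //; rewrite /= !inE eqxx.
  have /hasP[z zl zS] : has (mem S) l by apply: hS; rewrite /walk h1 h3 noX.
  by apply/hasP; exists z => //; move: zS; rewrite /= !inE => ->; rewrite orbT. }
have cyS : k <= #|y |: S|.
{ apply: hsep => l /and3P[h1 h2 h3]; have [yl|yl] := boolP (y \in l).
    by apply/hasP; exists y => //; rewrite /= !inE eqxx.
  have /hasP[z zl zS] : has (mem S) l by apply: hS; rewrite /walk h1 h3 noY.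
  by apply/hasP; exists z => //; move: zS; rewrite /= !inE => ->; rewrite orbT. }
have xS : x \notin S by apply/negP => h; move: cxS; rewrite cardsU1 h add0n leqNgt cS.
have yS : y \notin S by apply/negP => h; move: cyS; rewrite cardsU1 h add0n leqNgt cS.
have eX : #|x |: S| = k by apply/eqP; rewrite eqn_leq cxS andbT cardsU1 xS.
have eY : #|y |: S| = k by apply/eqP; rewrite eqn_leq cyS andbT cardsU1 yS.
have sepX : separates e A B (x |: S).
{ move=> l /and3P[h1 h2 h3]; have [xl|xl] := boolP (x \in l).
    by apply/hasP; exists x => //; rewrite /= !inE eqxx.
  have /hasP[z zl zS] : has (mem S) l by apply: hS; rewrite /walk h1 h3 noX.
  by apply/hasP; exists z => //; move: zS; rewrite /= !inE => ->; rewrite orbT. }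
have sepY : separates e A B (y |: S).
{ move=> l /and3P[h1 h2 h3]; have [yl|yl] := boolP (y \in l).
    by apply/hasP; exists y => //; rewrite /= !inE eqxx.
  have /hasP[z zl zS] : has (mem S) l by apply: hS; rewrite /walk h1 h3 noY.
  by apply/hasP; exists z => //; move: zS; rewrite /= !inE => ->; rewrite orbT. }
(* The part of a walk up to its first vertex in [x |: S] cannot use the arc from [x] to [y], so a
   set separating [A] from [x |: S] without this arc separates [A] from [B] with it. *)
have LX : linked e' A (x |: S) k.
{ apply: IH; first by move: lt hn; clear; lia.
  move=> T hT; apply: hsep => l wl; have hX := sepX l wl.
  case/and3P: wl => h1 h2 h3; case: (split_find_nth x hX) h1 h2 h3 => z q r zX nq h1 h2 _.
  rewrite head_in_rcons in h1; rewrite sorted_rcons_cat in h2; case/andP: h2 => h2 _.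
  rewrite has_cat; apply/orP; left; apply: hT; rewrite /walk h1 last_in_rcons (zX : z \in _) andbT /=.
  apply: sorted_del_source => //; apply/negP => xq; move/hasP: nq; apply; exists x => //.
  by rewrite /= !inE eqxx. }
have LY : linked (fun a b => e' b a) B (y |: S) k.
{ apply: IH.
    suff -> : na (fun a b => e' b a) = na e' by move: lt hn; clear; lia.
    have swi : injective (fun p : V * V => (p.2, p.1)) by move=> [a b] [c d] [-> ->].
    rewrite /na -(card_imset _ swi); apply: eq_card => -[a b].
    rewrite !inE /=; apply/imsetP/idP => [[[c d]]|h].
      by rewrite inE /= => h [-> ->].
    by exists (b, a) => //; rewrite inE.
  move=> T hT; apply: hsep => l wl.
  have wl' : walk (fun a b => e b a) B A (rev l).
    by case/and3P: wl => h1 h2 h3; rewrite /walk head_in_rev last_in_rev h1 h3 rev_sorted h2.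
  have hY : has (mem (y |: S)) (rev l) by rewrite has_rev; apply: sepY.
  rewrite -has_rev; case/and3P: wl' => h1 h2 h3.
  case: (split_find_nth x hY) h1 h2 h3 => z q r zX nq h1 h2 _.
  rewrite head_in_rcons in h1; rewrite sorted_rcons_cat in h2; case/andP: h2 => h2 _.
  rewrite has_cat; apply/orP; left; apply: hT; rewrite /walk h1 last_in_rcons (zX : z \in _) andbT /=.
  rewrite -rev_sorted rev_rcons; apply: sorted_del_target.
    by rewrite -rev_rcons rev_sorted.
  rewrite mem_rev; apply/negP => xq; move/hasP: nq; apply; exists y => //.
  by rewrite /= !inE eqxx. }
have [P [hP nP dP]] := linked_end LX eX.
have [Q [hQ nQ dQ]] := linked_end LY eY.
(* Two half-walks meet only in a common end: otherwise they could be spliced at [z] into a walk from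
   [A] to [B] that uses neither the arc nor [S]. *)
have cross u v z : u \in x |: S -> v \in y |: S -> z \in rcons (P u) u -> z \in rcons (Q v) v -> u = v.
{ move=> uX vY zu zv; have /andP[hA sA] := hP u uX; have /andP[hB sB] := hQ v vY.
  have cut l t X : (forall w, w \in l -> w \notin X) -> z \in rcons l t ->
      exists q, [/\ exists r, rcons l t = rcons q z ++ r &
        forall w, w \in rcons q z -> w \in X -> w = t /\ w = z].
  { move=> nX zl; have [q [r E]] : exists q r, rcons l t = rcons q z ++ r.
      by case/path.splitP: zl => q r; exists q, r.
    exists q; split; first by exists r.
    move=> w wq wX.
    have wt : w = t.
      have : w \in rcons l t by rewrite E mem_cat wq.
      by rewrite mem_rcons inE => /orP[/eqP //|/nX]; rewrite wX.
    split=> //; move: wq; rewrite mem_rcons inE => /orP[/eqP //|wq].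
    have : w \in l.
    { case/lastP: r E => [|r s]; first by rewrite cats0 => /rcons_inj[-> _].
      by rewrite -rcons_cat => /rcons_inj[-> _]; rewrite mem_cat mem_rcons inE wq orbT. }
    by move=> /nX; rewrite wX. }
  have [q1 [[r1 E1] c1]] := cut _ _ _ (fun w => nP u w uX) zu.
  have [q2 [[r2 E2] c2]] := cut _ _ _ (fun w => nQ v w vY) zv.
  rewrite E1 head_in_rcons in hA; rewrite E1 sorted_rcons_cat in sA; case/andP: sA => sA _.
  rewrite E2 head_in_rcons in hB; rewrite E2 sorted_rcons_cat in sB; case/andP: sB => sB _.
  have : has (mem S) (rcons q1 z ++ rev q2).
  { apply: hS; rewrite /walk head_in_rcons hA sorted_rcons_cat sA /=.
    rewrite cat_rcons last_in_cat -rev_rcons last_in_rev hB andbT.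
    by move: sB; rewrite -rev_sorted rev_rcons. }
  move=> /hasP[w]; rewrite mem_cat mem_rev => /orP[w1|w2] /= wS.
  - have [wu wz] : w = u /\ w = z by apply: c1 => //; rewrite !inE wS orbT.
    have zY : z \in y |: S by rewrite -wz !inE wS orbT.
    have : z \in rcons q2 z by rewrite mem_rcons inE eqxx.
    by move=> /c2 h; have [e2 _] := h zY; rewrite -wu wz.
  - have w2' : w \in rcons q2 z by rewrite mem_rcons inE w2 orbT.
    have [wu wz] : w = v /\ w = z by apply: c2 => //; rewrite !inE wS orbT.
    have zX : z \in x |: S by rewrite -wz !inE wS orbT.
    have : z \in rcons q1 z by rewrite mem_rcons inE eqxx.
    by move=> /c1 h; have [e2 _] := h zX; rewrite -wu wz e2. }
(* The half-walks at [x] and [y] are joined by the deleted arc, all others at their common vertex of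
   [S]. *)
pose sg t := if t == y then x else t.
have sgX t : t \in y |: S -> sg t \in x |: S.
  by rewrite /sg !inE; case: (t == y) => /= [_|->]; rewrite ?eqxx ?orbT.
have sg_cross t u : t \in y |: S -> u \in y |: S -> sg t = u -> t = u.
{ rewrite /sg !inE; case: eqP => [-> _ + E|_ _ _ //].
  by rewrite -E (negPf xS) orbF => /eqP ->. }
have sg_inj t u : t \in y |: S -> u \in y |: S -> sg t = sg u -> t = u.
{ rewrite /sg !inE; case: eqP => [->|nt]; case: eqP => [->|nu] //=.
  - by move=> _ uS xu; rewrite -xu (negPf xS) in uS.
  - by move=> tS _ tx; rewrite tx (negPf xS) in tS. }
pose mid t := if t == y then [:: y] else [::].
pose W t := rcons (P (sg t)) (sg t) ++ mid t ++ rev (Q t).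
have inW t z : z \in W t -> z \in rcons (P (sg t)) (sg t) \/ z \in rcons (Q t) t.
{ rewrite /W !mem_cat mem_rev => /or3P[h|h|h]; first by left.
    by right; move: h; rewrite /mid; case: eqP => // ->; rewrite !inE mem_rcons inE => ->.
  by right; rewrite mem_rcons inE h orbT. }
exists (y |: S), W; split=> //.
- move=> t tY; have /andP[h1 h2] := hP _ (sgX _ tY); have /andP[h3 h4] := hQ _ tY.
  rewrite -rev_sorted rev_rcons /= in h4.
  have h4' : path e t (rev (Q t)) by apply: sub_path h4 => a b /andP[].
  have h2' := sorted_del_sub h2.
  have l4 : last_in B (t :: rev (Q t)) by rewrite -rev_rcons last_in_rev.
  rewrite /walk /W head_in_rcons h1 sorted_rcons_cat h2' /=.
  rewrite /mid /sg; case: eqP => [ty|nt].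
    by rewrite -ty cat1s last_in_cat l4 /= h4' ty xy.
  by rewrite cat0s cat_rcons last_in_cat l4 h4'.
- move=> i j z iY jY /inW[zi|zi] /inW[zj|zj].
  + by apply: sg_inj => //; apply: dP zi zj; apply: sgX.
  + by apply: sg_cross => //; apply: cross zi zj; rewrite ?sgX.
  + by apply/esym/sg_cross => //; apply: cross zj zi; rewrite ?sgX.
  + exact: dQ zi zj.
Qed.
End Menger.

Section Connectors.
Variables (G : sgraph) (R1 R2 : {set G}).
Hypothesis dR : [disjoint R1 & R2].

Lemma not_both x : x \in R1 -> x \in R2 -> False.
Proof. by move=> h1 h2; have /pred0P/(_ x) := dR; rewrite /= h1 h2. Qed.

(** Contracting [C] into [a] produces an edge from [a] to [b] and touches no other vertex of the two
    regions. *)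
Definition connector (a b : G) (C : {set G}) : Prop :=
  [/\ connected_in C, C :&: R1 = [set a], C :&: R2 = set0, b \in R2 &
      exists2 c, c \in C & adj c b].

(** Follow the path to its first vertex in [R2], restarting the set at every vertex of [R1] met on
    the way; [C0] is the segment since the last restart. *)
Lemma extract_connector p x (C0 : {set G}) (a : G) :
  connected_in C0 -> C0 :&: R1 = [set a] -> C0 :&: R2 = set0 -> x \in C0 ->
  path (@adj G) x p -> last x p \in R2 ->
  exists a' b C, [/\ connector a' b C, b \in p & forall z, z \in C -> z \in C0 \/ z \in p].
Proof.
elim: p x C0 a => [|y p IH] x C0 a cC C1 C2 xC /=.
  by move=> _ xR; have : x \in C0 :&: R2; [rewrite inE xC|rewrite C2 inE].
move=> /andP[xy pp] lR.
have [yR|yR] := boolP (y \in R2).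
  by exists a, y, C0; split; [split=> //; exists x|rewrite inE eqxx|by left].
have [yR1|yR1] := boolP (y \in R1).
  have [|||a' [b [C [h1 h2 h3]]]] := IH y [set y] y (conn1 y) _ _ _ pp lR.
  - by apply/setP => z; rewrite !inE; case: eqP => // ->; rewrite yR1.
  - by apply/setP => z; rewrite !inE; apply/negP => /andP[/eqP -> yR2]; rewrite yR2 in yR.
  - by rewrite inE.
  exists a', b, C; split=> //; first by rewrite inE h2 orbT.
  by move=> z /h3; rewrite !inE => -[->|->]; right; rewrite ?orbT.
have [||||a' [b [C [h1 h2 h3]]]] := IH y (y |: C0) a _ _ _ _ pp lR.
- exact: conn_add xC xy.
- by rewrite setIUl C1; apply/setP => z; rewrite !inE; case: (z =P y) => [->|//]; rewrite (negPf yR1).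
- by rewrite setIUl C2; apply/setP => z; rewrite !inE; case: (z =P y) => [->|//]; rewrite (negPf yR).
- by rewrite !inE eqxx.
exists a', b, C; split=> //; first by rewrite inE h2 orbT.
by move=> z /h3; rewrite !inE => -[/orP[->|->]|->]; [right|left|right; rewrite orbT].
Qed.

Lemma connectors_exist (k : nat) :
  (k <= #|R1|) -> (k <= #|R2|) ->
  (forall Z : {set G}, #|Z| < k -> connected_in (~: Z)) ->
  exists (I : {set G}) (a b : G -> G) (C : G -> {set G}), [/\ #|I| = k,
    forall i, i \in I -> connector (a i) (b i) (C i),
    forall i j z, i \in I -> j \in I -> z \in C i -> z \in C j -> i = j &
    forall i j, i \in I -> j \in I -> b i = b j -> i = j].
Proof.
move=> k1 k2 hconn.
have [|I [P [cI hP dP]]] := @menger_rel _ (@adj G) R1 R2 k.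
{ move=> S hS; rewrite leqNgt; apply/negP => lt.
  have out (T : {set G}) : k <= #|T| -> exists2 x, x \in T & x \notin S.
    move=> kT; apply: NNPP => no; have : T \subset S.
      apply/subsetP => x xT; apply/negPn/negP => xS; apply: no; by exists x.
    by move=> /subset_leq_card; move: kT lt; clear; lia.
  have [x xR xS] := out _ k1; have [y yR yS] := out _ k2.
  have /connectP[p pp ly] : connect (radj (~: S)) x y.
    by apply: conn_connect (hconn _ lt) _ _; rewrite inE.
  have pS : all (mem (~: S)) (x :: p).
    elim: p x xR xS pp ly => [|z p IH] x xR xS /=; first by rewrite !inE xS.
    move=> /andP[/and3P[_ zS _] pp] ly; rewrite /= !inE xS /=.
    clear -zS pp; rewrite -in_setC zS /=.
    elim: p z zS pp => //= w p IH z zS /andP[/and3P[_ wS _] pp].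
    by rewrite wS /=; apply: IH wS pp.
  have pe : path (@adj G) x p by apply: sub_path pp => u v /and3P[].
  have /hasP[z zl /= zS] : has (mem S) (x :: p) by apply: hS; rewrite /walk /= xR pe -ly yR.
  by have := allP pS _ zl; rewrite /= inE zS. }
pose good i (t : G * (G * {set G})) := connector t.1 t.2.1 t.2.2 /\
  t.2.1 \in P i /\ forall z, z \in t.2.2 -> z \in P i.
have ex i : i \in I -> exists t, good i t.
{ move=> iI; have := hP i iI; case E : (P i) => [|x p]; first by case/and3P.
  move=> /and3P[/= xR pe lR].
  have [|||a [b [C [h1 h2 h3]]]] := extract_connector (a := x) (conn1 x) _ _ _ pe lR.
  - by apply/setP => z; rewrite !inE; case: eqP => // ->; rewrite xR.
  - by apply/setP => z; rewrite !inE; apply/negP => /andP[/eqP -> xR2]; apply: not_both xR xR2.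
  - by rewrite inE.
  exists (a, (b, C)); split=> //; split; first by rewrite E inE h2 orbT.
  by move=> z /h3; rewrite E !inE => -[->|->]; rewrite ?orbT. }
have [f hf] : exists f : G -> G * (G * {set G}), forall i, i \in I -> good i (f i).
{ have : exists f : {ffun G -> G * (G * {set G})}, forall i, i \in enum I -> good i (f i).
    have : {subset enum I <= I} by move=> i; rewrite mem_enum.
    elim: (enum I) (enum_uniq I) => [_ _|i s IH /= /andP[nis us] sub].
      by exists [ffun i => (i, (i, set0))].
    have [|f hf] := IH us; first by move=> j js; apply: sub; rewrite inE js orbT.
    have [|t ht] := ex i; first by apply: sub; rewrite inE eqxx.
    exists [ffun j => if j == i then t else f j] => j; rewrite inE ffunE.
    by case: eqP => [-> //|_ /= js]; apply: hf.
  by move=> [f hf]; exists f => i iI; apply: hf; rewrite mem_enum. }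
exists I, (fun i => (f i).1), (fun i => (f i).2.1), (fun i => (f i).2.2); split=> //.
- by move=> i /hf[].
- move=> i j z iI jI zi zj; have [_ [_ hi]] := hf i iI; have [_ [_ hj]] := hf j jI.
  by apply: (dP i j z) => //; [apply: hi|apply: hj].
- move=> i j iI jI e; have [_ [hi _]] := hf i iI; have [_ [hj _]] := hf j jI.
  by apply: (dP i j (f i).2.1) => //; rewrite e.
Qed.
End Connectors.

(** * Packing disjoint tiles *)

From mathcomp Require Import reals exp.
From mathcomp Require Import ring lra.
Import Order.TTheory GRing.Theory Num.Theory.
Local Open Scope ring_scope.

Definition pos (R : realType) (z : R) : R := Num.max z 0.

Lemma pos_ge0 (R : realType) (z : R) : 0 <= pos z.
Proof. by rewrite /pos le_max lexx orbT. Qed.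

Lemma pos_ge (R : realType) (z : R) : z <= pos z.
Proof. by rewrite /pos le_max lexx. Qed.

(** Second-order Taylor bound: [pos u ^+ 2] has derivative [2 * pos u] and second derivative at most
    2. *)
Lemma pos_sq_add (R : realType) (u h : R) :
  pos (u + h) ^+ 2 <= pos u ^+ 2 + 2 * (pos u * h) + h ^+ 2.
Proof.
rewrite /pos; case: (leP (u + h) 0) => h1; case: (leP u 0) => h2.
- by rewrite expr0n /= mul0r mulr0 !add0r sqr_ge0.
- have -> : u ^+ 2 + 2 * (u * h) + h ^+ 2 = (u + h) ^+ 2 by ring.
  by rewrite expr0n /= sqr_ge0.
- rewrite expr0n /= mul0r mulr0 !add0r; nra.
- by have -> : (u + h) ^+ 2 = u ^+ 2 + 2 * (u * h) + h ^+ 2 by ring.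
Qed.

Lemma sum_setU_le (R : realType) (T : finType) (A B : {set T}) (f : T -> R) :
  (forall x, 0 <= f x) ->
  \sum_(x in A :|: B) f x <= \sum_(x in A) f x + \sum_(x in B) f x.
Proof.
move=> f0; rewrite (big_setID A) /= setUK setDUl setDv set0U.
rewrite lerD2l [leRHS](big_setID A) /= setDE.
by rewrite lerDr sumr_ge0.
Qed.

Lemma le_sum_subset (R : realType) (T : finType) (A B : {set T}) (f : T -> R) :
  (forall x, 0 <= f x) -> A \subset B -> \sum_(x in A) f x <= \sum_(x in B) f x.
Proof.
move=> f0 sAB; rewrite [leRHS](big_setID A) /= (setIidPr sAB) lerDl.
by apply: sumr_ge0.
Qed.

Section Tiles.
Variables (G : sgraph) (a0 a1 a2 : bool -> nat).

(* Tiles of kind [k] have parts of sizes [a0 k], [a1 k], [a2 k], up to a common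
   factor; kind [true] has three nonempty parts, kind [false] will be used with
   an empty middle part, so that its second vertex is unconstrained in [tri]. *)
Definition tri (k : bool) (x : G * (G * G)) : bool :=
  [&& (0 < a0 k)%N && (0 < a1 k)%N ==> adj x.1 x.2.1,
      (0 < a0 k)%N && (0 < a2 k)%N ==> adj x.1 x.2.2 &
      (0 < a1 k)%N && (0 < a2 k)%N ==> adj x.2.1 x.2.2].

Definition tile_type : Type := bool * ({set G} * ({set G} * {set G})).
Definition supp (t : tile_type) : {set G} := t.2.1 :|: (t.2.2.1 :|: t.2.2.2).

Definition complete_to (A B : {set G}) : bool :=
  [forall x, forall y, (x \in A) && (y \in B) ==> adj x y].

Lemma complete_toP (A B : {set G}) :
  reflect (forall x y, x \in A -> y \in B -> adj x y) (complete_to A B).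
Proof.
apply: (iffP forallP) => [h x y xA yB|h x].
  by have /forallP/(_ y) := h x; rewrite xA yB.
by apply/forallP => y; apply/implyP => /andP[xA yB]; apply: h.
Qed.

Lemma complete_toS (A B A' B' : {set G}) : A' \subset A -> B' \subset B ->
  complete_to A B -> complete_to A' B'.
Proof.
move=> sA sB /complete_toP h; apply/complete_toP => x y xA yB.
by apply: h; [apply: (subsetP sA)|apply: (subsetP sB)].
Qed.

Lemma complete_to_disj (A B : {set G}) : complete_to A B -> [disjoint A & B].
Proof.
move=> /complete_toP h; apply/pred0P => x /=; apply/negP => /andP[xA xB].
by have := h _ _ xA xB; rewrite adjxx.
Qed.

Definition is_tile (s : nat) (t : tile_type) : bool :=
  [&& #|t.2.1| == a0 t.1 * s, #|t.2.2.1| == a1 t.1 * s, #|t.2.2.2| == a2 t.1 * s,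
      complete_to t.2.1 t.2.2.1, complete_to t.2.1 t.2.2.2 &
      complete_to t.2.2.1 t.2.2.2]%N.

Definition packing (s : nat) (W : {set G}) (l : seq tile_type) : bool :=
  [&& all (is_tile s) l, all (fun t => [disjoint supp t & W]) l &
      pairwise (fun t u => [disjoint supp t & supp u]) l].

Definition cover_of (l : seq tile_type) : {set G} := \bigcup_(t <- l) supp t.

Lemma cover_cons t l : cover_of (t :: l) = supp t :|: cover_of l.
Proof. by rewrite /cover_of big_cons. Qed.

Lemma cover_cat l1 l2 : cover_of (l1 ++ l2) = cover_of l1 :|: cover_of l2.
Proof. by rewrite /cover_of big_cat. Qed.

Lemma supp_cover t l : t \in l -> supp t \subset cover_of l.
Proof.
elim: l => // u l IH; rewrite inE cover_cons => /orP[/eqP ->|/IH h].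
  by rewrite subsetUl.
by apply: subset_trans h (subsetUr _ _).
Qed.

Lemma packing_cons s W t l :
  packing s W (t :: l) =
  [&& is_tile s t, [disjoint supp t & W], [disjoint supp t & cover_of l] & packing s W l].
Proof.
rewrite /packing /=.
have -> : all (fun u => [disjoint supp t & supp u]) l = [disjoint supp t & cover_of l].
  elim: l => [|u l IH] /=; first by rewrite /cover_of big_nil -setI_eq0 setI0 eqxx.
  by rewrite cover_cons IH -!setI_eq0 setIUr setU_eq0.
case: (is_tile s t); case: [disjoint supp t & W]; rewrite /= ?andbF //.
by case: (all (is_tile s) l); case: (all _ l); rewrite /= ?andbF //.
Qed.

Lemma packing_cat s W l1 l2 : packing s W l1 -> packing s W l2 ->
  [disjoint cover_of l1 & cover_of l2] -> packing s W (l1 ++ l2).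
Proof.
elim: l1 => // t l IH; rewrite cat_cons !packing_cons => /and4P[h1 h2 h3 h4] p2.
rewrite cover_cons -setI_eq0 setIUl setU_eq0 !setI_eq0 => /andP[d1 d2].
by rewrite h1 h2 IH // andbT /= cover_cat -setI_eq0 setIUr setU_eq0 !setI_eq0 h3 d1.
Qed.

Lemma split_tile (s n : nat) (W : {set G}) (k : bool) (U0 U1 U2 : {set G}) :
  complete_to U0 U1 -> complete_to U0 U2 -> complete_to U1 U2 ->
  (a0 k * s * n <= #|U0|)%N -> (a1 k * s * n <= #|U1|)%N -> (a2 k * s * n <= #|U2|)%N ->
  [disjoint U0 :|: (U1 :|: U2) & W] ->
  exists l, [/\ packing s W l, size l = n & cover_of l \subset U0 :|: (U1 :|: U2)].
Proof.
elim: n U0 U1 U2 => [|n IH] U0 U1 U2 c01 c02 c12 n0 n1 n2 dW.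
  by exists [::]; split=> //; rewrite /cover_of big_nil sub0set.
have [A0 [sA0 cA0]] := @subset_of_card _ U0 (a0 k * s) ltac:(nia).
have [A1 [sA1 cA1]] := @subset_of_card _ U1 (a1 k * s) ltac:(nia).
have [A2 [sA2 cA2]] := @subset_of_card _ U2 (a2 k * s) ltac:(nia).
have sD (A U : {set G}) : U :\: A \subset U by apply: subsetDl.
have sU : U0 :\: A0 :|: (U1 :\: A1 :|: U2 :\: A2) \subset U0 :|: (U1 :|: U2).
  by rewrite !setUSS.
have [||||||| l [pl sl cl]] := IH (U0 :\: A0) (U1 :\: A1) (U2 :\: A2).
- exact: complete_toS c01.
- exact: complete_toS c02.
- exact: complete_toS c12.
- by rewrite cardsD (setIidPr sA0) cA0; nia.
- by rewrite cardsD (setIidPr sA1) cA1; nia.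
- by rewrite cardsD (setIidPr sA2) cA2; nia.
- by apply: disjointWl dW.
exists ((k, (A0, (A1, A2))) :: l); split; last first.
- rewrite cover_cons subUset; apply/andP; split; first by rewrite /supp /= !setUSS.
  exact: subset_trans cl sU.
- by rewrite /= sl.
rewrite packing_cons pl andbT; apply/and3P; split.
- rewrite /is_tile /= cA0 cA1 cA2 !eqxx /=; apply/and3P; split.
  + exact: complete_toS c01.
  + exact: complete_toS c02.
  + exact: complete_toS c12.
- by apply: disjointWl dW; rewrite /supp /= !setUSS.
- apply: disjointWr cl _; rewrite /supp /=.
  have d01 := complete_to_disj c01; have d02 := complete_to_disj c02.
  have d12 := complete_to_disj c12.
  apply/pred0P => x /=; apply/negP; rewrite !inE => /andP[].
  have D (U V : {set G}) : [disjoint U & V] -> x \in U -> x \in V -> False.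
    by move=> /pred0P/(_ x) /= h xU xV; rewrite xU xV in h.
  move=> /or3P[] xA /or3P[] /andP[xnA xU].
  + by rewrite xA in xnA.
  + by apply: D d01 _ _ => //; apply: (subsetP sA0).
  + by apply: D d02 _ _ => //; apply: (subsetP sA0).
  + by apply: D d01 _ _ => //; apply: (subsetP sA1).
  + by rewrite xA in xnA.
  + by apply: D d12 _ _ => //; apply: (subsetP sA1).
  + by apply: D d02 _ _ => //; apply: (subsetP sA2).
  + by apply: D d12 _ _ => //; apply: (subsetP sA2).
  + by rewrite xA in xnA.
Qed.

Variable R : realType.

Definition cost (k : bool) (w : G -> R) (x : G * (G * G)) : R :=
  (a0 k)%:R * w x.1 + (a1 k)%:R * w x.2.1 + (a2 k)%:R * w x.2.2.

(* By linear-programming duality this says that tiles can be packed fractionally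
   with total weight [V1], even after any [xi]-fraction of the triples has been
   forbidden. *)
Definition cheap_tiles (xi V1 : R) : Prop :=
  forall (w : G -> R) (B : {set G * (G * G)}), (forall x, 0 <= w x) ->
    #|B|%:R <= xi * (nverts G)%:R ^+ 3 ->
    exists k x, [/\ tri k x, x \notin B & V1 * cost k w x <= \sum_x w x].

(** * Greedy packing controlled by a quadratic potential *)

Section Clusters.
Variable cl : G -> {set G}.
Hypothesis cl_in : forall x, x \in cl x.
Hypothesis cl_eq : forall x y, y \in cl x -> cl y = cl x.

Lemma cl_sym x y : (y \in cl x) = (x \in cl y).
Proof. by apply/idP/idP => h; [rewrite (cl_eq h)|rewrite (cl_eq h)]; apply: cl_in. Qed.

Lemma cl_card_gt0 x : 0 < #|cl x|%:R :> R.
Proof. by rewrite ltr0n; apply/card_gt0P; exists x; apply: cl_in. Qed.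

(** Every vertex of [S] spreads its weight evenly over its own cluster, on which [f] is constant. *)
Lemma cluster_sum (f : G -> R) (S : {set G}) :
  (forall x y, y \in cl x -> f y = f x) ->
  \sum_x f x * (#|S :&: cl x|%:R / #|cl x|%:R) = \sum_(y in S) f y.
Proof.
move=> fc.
transitivity (\sum_x \sum_(y in S) (if x \in cl y then f y / #|cl y|%:R else 0)).
  apply: eq_bigr => x _.
  have -> : #|S :&: cl x|%:R = \sum_(y in S) (y \in cl x)%:R :> R.
    rewrite -sum1_card natr_sum big_mkcond [RHS]big_mkcond /=; apply: eq_bigr => y _.
    by rewrite !inE; case: (y \in S); case: (y \in cl x).
  rewrite mulr_suml mulr_sumr; apply: eq_bigr => y yS; rewrite cl_sym.
  case: ifP => h; last by rewrite mul0r mulr0.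
  by rewrite (fc _ _ h) (cl_eq h) mul1r.
rewrite exchange_big /=; apply: eq_bigr => y _.
rewrite -big_mkcond /= sumr_const -[LHS]mulr_natr mulrVK //.
by rewrite unitfE lt0r_neq0 // cl_card_gt0.
Qed.

Variables (theta : R).

(* [cl] is a partition into clusters and [theta] the fraction of each cluster that
   we are allowed to use; a load of 1 means that this fraction is exhausted. *)
Definition load (U : {set G}) (x : G) : R := #|U :&: cl x|%:R / #|cl x|%:R / theta.

Lemma load_cl U x y : y \in cl x -> load U y = load U x.
Proof. by move=> h; rewrite /load (cl_eq h). Qed.

Hypothesis theta0 : 0 < theta.

Lemma load_ge0 U x : 0 <= load U x.
Proof. by rewrite /load !divr_ge0 // ltW. Qed.

Lemma loadU (U V : {set G}) x : [disjoint U & V] -> load (U :|: V) x = load U x + load V x.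
Proof.
move=> d; rewrite /load -!mulrDl -natrD setIUl cardsU.
have -> : U :&: cl x :&: (V :&: cl x) = set0; last by rewrite cards0 subn0.
apply/eqP; rewrite setI_eq0; apply: disjointWl (subsetIl _ _) _.
by apply: disjointWr (subsetIl _ _) _.
Qed.

Lemma load_sum (f : G -> R) (S : {set G}) :
  (forall x y, y \in cl x -> f y = f x) ->
  \sum_x f x * load S x = (\sum_(y in S) f y) / theta.
Proof.
by move=> fc; rewrite -cluster_sum // mulr_suml; apply: eq_bigr => x _; rewrite /load mulrA.
Qed.

(* The potential of the greedy packing: at time [z] in [0, 1] a cluster should not
   have used more than the fraction [z] of its share. *)
Definition overload (U : {set G}) (z : R) : R := \sum_x pos (load U x - z) ^+ 2.

(** Expand by [pos_sq_add]. The first-order term is at most 0 by the bound on the weight of [S],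
    which is how cheap tiles enter; what remains are the squares of the added load and of the time
    step. *)
Lemma overload_step (U S : {set G}) (z h g bet : R) :
  0 <= z -> 0 <= h -> [disjoint U & S] ->
  \sum_(y in S) pos (load U y - z) <= theta * h * \sum_x pos (load U x - z) ->
  (forall y, y \in S -> load S y <= bet) -> #|S|%:R <= g -> 0 <= bet ->
  overload (U :|: S) (z + h) <=
  overload U z + (g * bet / theta + (nverts G)%:R * h ^+ 2).
Proof.
move=> z0 h0 dUS hw hb hg b0; pose w x := pos (load U x - z).
have wc x y : y \in cl x -> w y = w x by move=> xy; rewrite /w (load_cl _ xy).
have step x : pos (load (U :|: S) x - (z + h)) ^+ 2 <=
   w x ^+ 2 + 2 * (w x * load S x - w x * h) + (load S x * load S x + h ^+ 2).
{ rewrite loadU //; have -> : load U x + load S x - (z + h) = (load U x - z) + (load S x - h) by ring.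
  apply: le_trans (pos_sq_add _ _) _; rewrite -/(w x).
  have := load_ge0 S x; move: (load S x) (w x) => d v d0.
  have -> : v * (d - h) = v * d - v * h by ring.
  rewrite lerD2l; nra. }
apply: le_trans (ler_sum _ (fun x _ => step x)) _.
rewrite !big_split /= -!mulr_sumr big_split /= sumrN sumr_const -mulr_suml.
rewrite (load_sum _ wc) (load_sum _ (fun x y h => load_cl S h)).
rewrite -[X in X <= _]addrA lerD2l -mulr_natl -/(nverts G).
have e1 : (\sum_(y in S) w y) / theta <= h * \sum_x w x.
  by rewrite ler_pdivrMr // mulrC mulrA.
have e2 : (\sum_(y in S) load S y) / theta <= g * bet / theta.
{ rewrite ler_pM2r ?invr_gt0 //.
  apply: le_trans (ler_sum _ (fun y yS => hb y yS)) _.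
  by rewrite sumr_const -mulr_natl ler_wpM2r. }
move: e1 e2; set s1 := _ / theta; set s2 := _ / theta; set s3 := \sum_x w x => e1 e2.
rewrite [X in s1 - X]mulrC; lra.
Qed.

Definition box (x : G * (G * G)) : {set G * (G * G)} :=
  setX (cl x.1) (setX (cl x.2.1) (cl x.2.2)).

Lemma card_touch (S : {set G}) :
  (#|[set x : G * (G * G) | [|| x.1 \in S, x.2.1 \in S | x.2.2 \in S]]| <=
   3 * #|S| * (nverts G * nverts G))%N.
Proof.
have sub : [set x : G * (G * G) | [|| x.1 \in S, x.2.1 \in S | x.2.2 \in S]] \subset
   setX S setT :|: (setX setT (setX S setT) :|: setX setT (setX setT S)).
  by apply/subsetP => -[x [y z]]; rewrite !inE /= ?andbT.
apply: leq_trans (subset_leq_card sub) _.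
have [h1 _] := leq_card_setU (setX S [set: G * G]) (setX [set: G] (setX S [set: G]) :|: setX [set: G] (setX [set: G] S)).
have [h2 _] := leq_card_setU (setX [set: G] (setX S [set: G])) (setX [set: G] (setX [set: G] S)).
apply: leq_trans h1 _; move: h2; rewrite !cardsX !cardsT card_prod /nverts.
move: #|S| #|G| #|_ :|: _| => u v z; nia.
Qed.

(* Triples of clusters with too few copies for the Kovari-Sos-Turan theorem. *)
Definition sparse (d : nat) (k : bool) : {set G * (G * G)} :=
  [set x | tri k x && (d * #|[set y in box x | tri k y]| < #|box x|)%N].

(** Among the triples with [tri k x], sparsity depends only on the three clusters, so a product of
    three clusters contains either no sparse triple or fewer than its [d]-th part. *)
Lemma card_sparse d k : (d * #|sparse d k| <= nverts G ^ 3)%N.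
Proof.
pose q (x : G * (G * G)) := (cl x.1, (cl x.2.1, cl x.2.2)).
have -> : (nverts G ^ 3 = #|[set: G * (G * G)]|)%N.
  by rewrite cardsT !card_prod /nverts !expnS expn0 muln1.
rewrite -!sum1_card (partition_big q predT) //= [leqRHS](partition_big q predT) //=.
rewrite big_distrr /=; apply: leq_sum => P _.
rewrite !sum1_card.
case: (pickP [pred x | (x \in sparse d k) && (q x == P)]) => [x0 /andP[x0s /eqP qx0]|none]; last first.
  by rewrite (eq_card none) card0 muln0.
move: x0s; rewrite inE => /andP[_ lt].
have bq x : q x = P -> x \in box x0.
  rewrite -qx0 => -[e1 e2 e3]; rewrite !inE /=.
  by rewrite -e1 -e2 -e3 !cl_in.
have bq2 x : x \in box x0 -> q x = P.
  by rewrite -qx0 !inE /q => /and3P[/cl_eq -> /cl_eq -> /cl_eq ->].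
have h1 : (#|[pred x | (x \in sparse d k) && (q x == P)]| <= #|[set y in box x0 | tri k y]|)%N.
  apply: subset_leq_card; apply/subsetP => x; rewrite inE => /andP[+ /eqP /bq xb].
  by rewrite !inE => /andP[tx _]; move: xb; rewrite !inE tx => ->.
have h2 : (#|box x0| <= #|[pred x | (x \in [set: G * (G * G)]) && (q x == P)]|)%N.
  by apply: subset_leq_card; apply/subsetP => x /bq2 e; rewrite !inE e eqxx.
apply: leq_trans _ h2; apply: leq_trans _ (ltnW lt).
by rewrite leq_mul2l h1 orbT.
Qed.

Section Greedy.
Variables (W J : {set G}) (s b d A N : nat) (zeta xi V1 : R).
Hypothesis hA : forall k, [/\ (a0 k <= A)%N, (a1 k <= A)%N & (a2 k <= A)%N].
Hypothesis A0 : (0 < A)%N.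
Hypothesis s0 : (0 < s)%N.
Hypothesis b0 : (0 < b)%N.
Hypothesis d0 : (0 < d)%N.
Hypothesis N0 : (0 < N)%N.
Hypothesis hb : forall x, x \notin J -> (b <= #|cl x|)%N.
Hypothesis hW : forall x, x \notin J -> [disjoint cl x & W].
Hypothesis cheap : cheap_tiles xi V1.
Hypothesis hbad : 2 / d%:R * (nverts G)%:R ^+ 3 +
  3 * (#|J|%:R + zeta * (nverts G)%:R) * (nverts G)%:R ^+ 2 <= xi * (nverts G)%:R ^+ 3.
Hypothesis htheta : 12 * d%:R * theta <= 1.
Hypothesis hkst : (kst_bound (2 * d) (A * s) <= b)%N.
Hypothesis hN : N%:R * s%:R <= theta * V1.

Local Notation m := (nverts G).
(** The error term of [overload_step] for at most [3 * A * s] new vertices, clusters of at least [b]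
    vertices and a time step of [N%:R^-1]. *)
Definition step_cost : R := (3 * A * s)%:R * ((3 * A * s)%:R / b%:R / theta) / theta +
   (nverts G)%:R * (N%:R^-1) ^+ 2.

(** [cheap] is applied with the derivative of the potential, up to a factor 2, as weight, and with
    [B] the triples to be avoided: those in sparse products and those touching [J] or an overloaded
    cluster. The triple obtained lies in a dense product of clusters that are largely free, and
    there [kst3] finds the tile. *)
Lemma greedy_step (l : seq tile_type) (z : R) : 0 <= z <= 1 -> packing s W l ->
  overload (cover_of l) z <= zeta * (nverts G)%:R ->
  exists t, packing s W (t :: l) /\
    overload (cover_of (t :: l)) (z + N%:R^-1) <= overload (cover_of l) z + step_cost.
Proof.
move=> /andP[z0 z1] pl ov; set U := cover_of l in ov *.
pose w x := pos (load U x - z).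
have w0 x : 0 <= w x by apply: pos_ge0.
have wc x y : y \in cl x -> w y = w x by move=> xy; rewrite /w (load_cl _ xy).
(* As [z <= 1], each vertex of [H] contributes at least 1 to the potential, so [H] is small. *)
pose H := [set x | 2 <= load U x].
have cH : #|H|%:R <= zeta * m%:R.
{ apply: le_trans ov; rewrite /overload -sum1_card natr_sum.
  apply: le_trans (_ : \sum_(x in H) pos (load U x - z) ^+ 2 <= _); last first.
    by rewrite [leRHS](bigID (mem H)) /= lerDl sumr_ge0 // => x _; apply: sqr_ge0.
  apply: ler_sum => x; rewrite inE => hx.
  have := pos_ge (load U x - z) => hp.
  have : 1 <= pos (load U x - z) by lra.
  move: (pos _) => u hu; nra. }
pose S := J :|: H.
pose B := sparse d false :|: (sparse d true :|: [set x : G * (G * G) | [|| x.1 \in S, x.2.1 \in S | x.2.2 \in S]]).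
have cB : #|B|%:R <= xi * m%:R ^+ 3.
{ apply: le_trans hbad.
  have [c1 _] := leq_card_setU (sparse d false) (sparse d true :|: [set x : G * (G * G) | [|| x.1 \in S, x.2.1 \in S | x.2.2 \in S]]).
  have [c2 _] := leq_card_setU (sparse d true) ([set x : G * (G * G) | [|| x.1 \in S, x.2.1 \in S | x.2.2 \in S]]).
  have [c3 _] := leq_card_setU J H.
  have c4 := card_touch S; have c5 := card_sparse d false; have c6 := card_sparse d true.
  have cS : #|S|%:R <= #|J|%:R + zeta * m%:R :> R.
    by apply: le_trans (_ : (#|J| + #|H|)%:R <= _); rewrite ?ler_nat // natrD lerD2l.
  have dR : 0 < d%:R :> R by rewrite ltr0n.
  have e5 : #|sparse d false|%:R <= m%:R ^+ 3 / d%:R :> R.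
    by rewrite ler_pdivlMr // -natrM -natrX ler_nat mulnC.
  have e6 : #|sparse d true|%:R <= m%:R ^+ 3 / d%:R :> R.
    by rewrite ler_pdivlMr // -natrM -natrX ler_nat mulnC.
  have e4 : (3 * #|S| * (m * m))%:R <= 3 * (#|J|%:R + zeta * m%:R) * m%:R ^+ 2 :> R.
    rewrite !natrM -expr2; apply: ler_wpM2r; first exact: exprn_ge0.
    by rewrite ler_wpM2l.
  have c7 : (#|B| <= #|sparse d false| + (#|sparse d true| + 3 * #|S| * (m * m)))%N.
    apply: leq_trans c1 _; rewrite leq_add2l; apply: leq_trans c2 _; by rewrite leq_add2l.
  have c8 : #|B|%:R <= #|sparse d false|%:R + (#|sparse d true|%:R + (3 * #|S| * (m * m))%:R) :> R.
    by rewrite -!natrD ler_nat.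
  apply: le_trans c8 _.
  have -> : 2 / d%:R * m%:R ^+ 3 = m%:R ^+ 3 / d%:R + m%:R ^+ 3 / d%:R :> R by field; rewrite lt0r_neq0.
  lra. }
have [k [x [tx xB hx]]] := cheap w0 cB.
have xS : [&& x.1 \notin S, x.2.1 \notin S & x.2.2 \notin S].
  by move: xB; rewrite !in_setU !negb_or !inE !negb_or => /and3P[_ _].
case/and3P: xS => xS0 xS1 xS2.
have dense : (#|box x| <= d * #|[set y in box x | tri k y]|)%N.
{ rewrite leqNgt; apply/negP => lt; move: xB; rewrite !in_setU !negb_or => /and3P[].
  by case: (k) tx lt => tx lt h1 h2 _; [move: h2|move: h1]; rewrite inE tx lt. }
have SJ u : u \notin S -> u \notin J by apply: contra; rewrite inE => ->.
(* A load below 2 means that at most a fraction [2 * theta <= 1 / (6 * d)] of the cluster is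
   occupied; over the three coordinates this spoils at most half of the dense triples. *)
have SU u : u \notin S -> (6 * d * #|U :&: cl u| <= #|cl u|)%N.
{ rewrite !inE negb_or => /andP[_]; rewrite -ltNge /load => lt.
  have c0 := cl_card_gt0 u.
  rewrite ltr_pdivrMr // ltr_pdivrMr // in lt.
  rewrite -(ler_nat R) !natrM; apply: le_trans (_ : 6 * d%:R * (2 * theta * #|cl u|%:R) <= _).
    by rewrite ler_wpM2l ?mulr_ge0 // ltW.
  have -> : 6 * d%:R * (2 * theta * #|cl u|%:R) = (12 * d%:R * theta) * #|cl u|%:R :> R by ring.
  by rewrite ler_piMl. }
pose T y := tri k y && ~~ [|| y.1 \in U, y.2.1 \in U | y.2.2 \in U].
have cT : (#|cl x.1| * (#|cl x.2.1| * #|cl x.2.2|) <= 2 * d * #|[set y in box x | T y]|)%N.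
{ have -> : (#|cl x.1| * (#|cl x.2.1| * #|cl x.2.2|) = #|box x|)%N by rewrite !cardsX.
  have sub : [set y in box x | tri k y] \subset [set y in box x | T y] :|:
     (setX (U :&: cl x.1) (setX (cl x.2.1) (cl x.2.2)) :|:
     (setX (cl x.1) (setX (U :&: cl x.2.1) (cl x.2.2)) :|:
      setX (cl x.1) (setX (cl x.2.1) (U :&: cl x.2.2)))).
    apply/subsetP => -[u [v y]]; rewrite !inE /T /=.
    case: (tri _ _); rewrite ?andbF // => /andP[/and3P[-> -> ->] _] /=.
    by case: (u \in U); case: (v \in U); case: (y \in U).
  have := subset_leq_card sub.
  set X0 := [set y in box x | tri k y] in sub dense *; set X1 := [set y in box x | T y] in sub *.
  set Y0 := setX _ _; set Y1 := setX _ _; set Y2 := setX _ _ => le.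
  have [c1 _] := leq_card_setU X1 (Y0 :|: (Y1 :|: Y2)).
  have [c2 _] := leq_card_setU Y0 (Y1 :|: Y2).
  have [c3 _] := leq_card_setU Y1 Y2.
  have y0 : (6 * d * #|Y0| <= #|box x|)%N.
    by rewrite /Y0 /box !cardsX mulnA leq_mul2r SU ?orbT.
  have y1 : (6 * d * #|Y1| <= #|box x|)%N.
    rewrite /Y1 /box !cardsX mulnCA leq_mul2l mulnA leq_mul2r SU ?orbT //.
  have y2 : (6 * d * #|Y2| <= #|box x|)%N.
    by rewrite /Y2 /box !cardsX mulnCA leq_mul2l mulnCA leq_mul2l SU ?orbT.
  have c4 : (#|X0| <= #|X1| + (#|Y0| + (#|Y1| + #|Y2|)))%N.
    apply: leq_trans le _; apply: leq_trans c1 _; rewrite leq_add2l.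
    by apply: leq_trans c2 _; rewrite leq_add2l.
  have := leq_mul (leqnn (6 * d)) c4.
  have ar (bx x0 x1 v0 v1 v2 e : nat) : (bx <= e * x0)%N -> (6 * e * v0 <= bx)%N ->
      (6 * e * v1 <= bx)%N -> (6 * e * v2 <= bx)%N ->
      (6 * e * x0 <= 6 * e * (x1 + (v0 + (v1 + v2))))%N -> (bx <= 2 * e * x1)%N.
    by clear; rewrite !mulnDr; lia.
  exact: ar dense y0 y1 y2. }
have As0 : (0 < A * s)%N by rewrite muln_gt0 A0.
have [||||| S0 [S1 [S2 [[sS0 cS0] [sS1 cS1] [sS2 cS2] hT]]]] :=
   @kst3 _ (cl x.1) (cl x.2.1) (cl x.2.2) T (2 * d) (A * s).
- by rewrite muln_gt0.
- by apply: leq_trans hkst _; apply: hb; apply: SJ.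
- by apply: leq_trans hkst _; apply: hb; apply: SJ.
- by apply: leq_trans hkst _; apply: hb; apply: SJ.
- exact: cT.
have [hA0 hA1 hA2] := hA k.
have [U0 [sU0 cU0]] := @subset_of_card _ S0 (a0 k * s) ltac:(rewrite cS0 leq_mul2r hA0 orbT //).
have [U1 [sU1 cU1]] := @subset_of_card _ S1 (a1 k * s) ltac:(rewrite cS1 leq_mul2r hA1 orbT //).
have [U2 [sU2 cU2]] := @subset_of_card _ S2 (a2 k * s) ltac:(rewrite cS2 leq_mul2r hA2 orbT //).
(* Parts of size 0 still need a representative, since [T] speaks of full triples; it is taken from
   the larger sets [S0], [S1], [S2]. *)
have /card_gt0P[u0 u0S] : (0 < #|S0|)%N by rewrite cS0.
have /card_gt0P[u1 u1S] : (0 < #|S1|)%N by rewrite cS1.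
have /card_gt0P[u2 u2S] : (0 < #|S2|)%N by rewrite cS2.
have TT u v y : u \in S0 -> v \in S1 -> y \in S2 -> T (u, (v, y)).
  by move=> uS vS yS; apply: hT; rewrite !inE /= uS vS yS.
have pos_a (c : nat) (X : {set G}) (u : G) : #|X| = (c * s)%N -> u \in X -> (0 < c)%N.
  move=> cX uX; have : (0 < #|X|)%N by apply/card_gt0P; exists u.
  by rewrite cX muln_gt0 => /andP[].
have T0 u : u \in S0 -> u \notin U by move=> uS; have /andP[_] := TT _ _ _ uS u1S u2S; rewrite /= !negb_or => /and3P[].
have T1 u : u \in S1 -> u \notin U by move=> uS; have /andP[_] := TT _ _ _ u0S uS u2S; rewrite /= !negb_or => /and3P[].
have T2 u : u \in S2 -> u \notin U by move=> uS; have /andP[_] := TT _ _ _ u0S u1S uS; rewrite /= !negb_or => /and3P[].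
pose t : tile_type := (k, (U0, (U1, U2))).
have in_t u : u \in supp t -> [|| u \in U0, u \in U1 | u \in U2] by rewrite /supp /= !inE.
have dU : [disjoint supp t & U].
{ apply/pred0P => u /=; apply/negP => /andP[/in_t /or3P[] uu uU].
  - by have := T0 _ (subsetP sU0 _ uu); rewrite uU.
  - by have := T1 _ (subsetP sU1 _ uu); rewrite uU.
  - by have := T2 _ (subsetP sU2 _ uu); rewrite uU. }
have dW : [disjoint supp t & W].
{ apply/pred0P => u /=; apply/negP => /andP[/in_t /or3P[] uu uW].
  - have /pred0P/(_ u) := hW (SJ _ xS0); rewrite /= uW (subsetP sS0) //; exact: (subsetP sU0).
  - have /pred0P/(_ u) := hW (SJ _ xS1); rewrite /= uW (subsetP sS1) //; exact: (subsetP sU1).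
  - have /pred0P/(_ u) := hW (SJ _ xS2); rewrite /= uW (subsetP sS2) //; exact: (subsetP sU2). }
have ct : (#|supp t| <= 3 * A * s)%N.
{ have [c1 _] := leq_card_setU U0 (U1 :|: U2); have [c2 _] := leq_card_setU U1 U2.
  rewrite /supp /=; apply: leq_trans c1 _; apply: leq_trans (_ : A * s + (A * s + A * s) <= _)%N.
    by apply: leq_add; [rewrite cU0 leq_mul2r hA0 orbT|apply: leq_trans c2 _; apply: leq_add;
      [rewrite cU1 leq_mul2r hA1 orbT|rewrite cU2 leq_mul2r hA2 orbT]].
  by rewrite -mulnA !mulSn mul0n addn0. }
exists t; split.
{ rewrite packing_cons pl dU dW !andbT /is_tile /= cU0 cU1 cU2 !eqxx /=.
  apply/and3P; split; apply/complete_toP => u v uU vU.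
  - have /andP[/and3P[/implyP h _ _] _] := TT _ _ _ (subsetP sU0 _ uU) (subsetP sU1 _ vU) u2S.
    by apply: h; rewrite (pos_a _ _ _ cU0 uU) (pos_a _ _ _ cU1 vU).
  - have /andP[/and3P[_ /implyP h _] _] := TT _ _ _ (subsetP sU0 _ uU) u1S (subsetP sU2 _ vU).
    by apply: h; rewrite (pos_a _ _ _ cU0 uU) (pos_a _ _ _ cU2 vU).
  - have /andP[/and3P[_ _ /implyP h] _] := TT _ _ _ u0S (subsetP sU1 _ uU) (subsetP sU2 _ vU).
    by apply: h; rewrite (pos_a _ _ _ cU1 uU) (pos_a _ _ _ cU2 vU). }
have NR : 0 < N%:R :> R by rewrite ltr0n.
have bR : 0 < b%:R :> R by rewrite ltr0n.
rewrite cover_cons setUC; apply: overload_step => //.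
- by rewrite invr_ge0 ltW.
- by rewrite disjoint_sym.
- have wcl (X : {set G}) (u : G) : X \subset cl u -> \sum_(y in X) w y = #|X|%:R * w u.
    move=> sX; rewrite mulr_natl -sumr_const; apply: eq_bigr => y yX.
    by apply: wc; apply: (subsetP sX).
  have e1 : \sum_(y in supp t) w y <= s%:R * cost k w x.
  { apply: le_trans (sum_setU_le _ _ w0) _; rewrite /=.
    apply: le_trans (lerD (lexx _) (sum_setU_le _ _ w0)) _.
    rewrite (wcl _ _ (subset_trans sU0 sS0)) (wcl _ _ (subset_trans sU1 sS1)) (wcl _ _ (subset_trans sU2 sS2)).
    rewrite cU0 cU1 cU2 /cost !natrM.
    by rewrite le_eqVlt; apply/orP; left; apply/eqP; ring. }
  apply: le_trans e1 _; rewrite -/(w _).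
  have c0 : 0 <= cost k w x by rewrite /cost !addr_ge0 // mulr_ge0.
  rewrite mulrAC -[leRHS]mulrC ler_pdivlMl //.
  apply: le_trans (_ : theta * (V1 * cost k w x) <= _); last by rewrite ler_wpM2l // ltW.
  rewrite mulrA mulrA; exact: ler_wpM2r.
- move=> y yt; rewrite /load ler_pM2r ?invr_gt0 //.
  have by_ : (b <= #|cl y|)%N.
  { case/or3P: (in_t _ yt) => yU.
    - by rewrite (cl_eq (subsetP sS0 _ (subsetP sU0 _ yU))) hb // SJ.
    - by rewrite (cl_eq (subsetP sS1 _ (subsetP sU1 _ yU))) hb // SJ.
    - by rewrite (cl_eq (subsetP sS2 _ (subsetP sU2 _ yU))) hb // SJ. }
  rewrite ler_pdivrMr ?cl_card_gt0 // mulrAC ler_pdivlMr //.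
  rewrite -!natrM ler_nat leq_mul //.
  by apply: leq_trans ct; apply: subset_leq_card; apply: subsetIl.
- by rewrite ler_nat.
- by rewrite !divr_ge0 // ltW.
Qed.

Hypothesis hpot : N%:R * step_cost <= zeta * (nverts G)%:R.

(** The potential starts at 0 and each of the [N] tiles raises it by at most [step_cost]; [hpot]
    keeps it below the threshold that [greedy_step] needs. *)
Lemma greedy_packing : exists l, [/\ packing s W l, size l = N &
  overload (cover_of l) 1 <= zeta * (nverts G)%:R].
Proof.
have NR : 0 < N%:R :> R by rewrite ltr0n.
have h00 : 0 <= step_cost.
  rewrite /step_cost addr_ge0 //; last by rewrite mulr_ge0 // sqr_ge0.
  by rewrite divr_ge0 ?(ltW theta0) // mulr_ge0 // divr_ge0 ?(ltW theta0) // divr_ge0.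
suff main : forall i, (i <= N)%N -> exists l, [/\ packing s W l, size l = i &
    overload (cover_of l) (i%:R / N%:R) <= i%:R * step_cost].
  by have [l [pl sl ol]] := main N (leqnn N); exists l; split=> //; rewrite divff ?lt0r_neq0 // in ol; apply: le_trans hpot.
elim=> [_|i IH lt].
  exists [::]; split=> //; rewrite mul0r mul0r /overload /cover_of big_nil big1 // => x _.
  by rewrite /load set0I cards0 !mul0r subr0 /pos maxxx expr0n.
have [l [pl sl ol]] := IH (ltnW lt).
have [|| t [pt ot]] := @greedy_step l (i%:R / N%:R) _ pl.
- by rewrite divr_ge0 //= ler_pdivrMr // mul1r ler_nat ltnW.
- apply: le_trans ol _; apply: le_trans hpot; apply: ler_wpM2r => //; by rewrite ler_nat ltnW.
exists (t :: l); split=> //=; first by rewrite sl.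
have -> : i.+1%:R / N%:R = i%:R / N%:R + N%:R^-1 :> R by rewrite -natr1 mulrDl mul1r.
apply: le_trans ot _; rewrite -natr1 mulrDl mul1r; by apply: lerD.
Qed.
End Greedy.
End Clusters.
End Tiles.

Lemma nat_ub (R : realType) (x : R) : exists n : nat, x <= n%:R.
Proof.
exists (Num.bound (Num.max x 0)); apply: le_trans (_ : Num.max x 0 <= _).
  by rewrite le_max lexx.
by apply: ltW; apply: archi_boundP; rewrite le_max lexx orbT.
Qed.

Lemma sum_setU_disj (R : realType) (T : finType) (A B : {set T}) (f : T -> R) :
  [disjoint A & B] ->
  \sum_(x in A :|: B) f x = \sum_(x in A) f x + \sum_(x in B) f x.
Proof.
move=> d; rewrite (big_setID A) /= setUK setDUl setDv set0U; congr (_ + _).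
by have /setDidPl -> : [disjoint B & A] by rewrite disjoint_sym.
Qed.

(** * Rounds of repacking *)

Section Improve.
Variables (G : sgraph) (a0 a1 a2 : bool -> nat) (R : realType).
Local Notation m := (nverts G).
Local Notation packing := (packing a0 a1 a2).
Local Notation tile_type := (tile_type G).

Definition parts (t : tile_type) : seq {set G} := [:: t.2.1; t.2.2.1; t.2.2.2].

Implicit Types (t u : tile_type) (l : seq tile_type).

Lemma parts_supp (t : tile_type) A : A \in parts t -> A \subset supp t.
Proof.
rewrite !inE /supp => /or3P[] /eqP ->; apply/subsetP => x; rewrite !inE => ->;
by rewrite ?orbT.
Qed.

Lemma tile_inv s t : is_tile a0 a1 a2 s t ->
  [/\ #|t.2.1| = a0 t.1 * s, #|t.2.2.1| = a1 t.1 * s & #|t.2.2.2| = a2 t.1 * s]%N /\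
  [/\ complete_to t.2.1 t.2.2.1, complete_to t.2.1 t.2.2.2 & complete_to t.2.2.1 t.2.2.2].
Proof.
by move=> /andP[/eqP h0 /andP[/eqP h1 /andP[/eqP h2 /and3P[c0 c1 c2]]]].
Qed.

Lemma packing_tile s W l t : packing s W l -> t \in l -> is_tile a0 a1 a2 s t.
Proof. by move=> /and3P[/allP h _ _] /h. Qed.

Lemma packing_avoid s W l t : packing s W l -> t \in l -> [disjoint supp t & W].
Proof. by move=> /and3P[_ /allP h _] /h. Qed.

Lemma packing_disj s W l t u : packing s W l -> t \in l -> u \in l -> t != u ->
  [disjoint supp t & supp u].
Proof.
elim: l => // v l IH; rewrite packing_cons => /and4P[_ _ d pl].
rewrite !inE => /orP[/eqP -> | tl] /orP[/eqP -> | ul].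
- by rewrite eqxx.
- by move=> _; apply: disjointWr d; apply: supp_cover.
- by move=> _; rewrite disjoint_sym; apply: disjointWr d; apply: supp_cover.
- exact: IH.
Qed.

Lemma tile_parts_eq s t A B x : is_tile a0 a1 a2 s t -> A \in parts t -> B \in parts t ->
  x \in A -> x \in B -> A = B.
Proof.
move=> /tile_inv[_ [/complete_to_disj d01 /complete_to_disj d02 /complete_to_disj d12]].
have D (U V : {set G}) : [disjoint U & V] -> x \in U -> x \in V -> False.
  by move=> /pred0P/(_ x) /= h xU xV; rewrite xU xV in h.
rewrite !inE => /or3P[]/eqP -> /or3P[]/eqP -> // h1 h2; exfalso.
- exact: D d01 h1 h2.
- exact: D d02 h1 h2.
- exact: D d01 h2 h1.
- exact: D d12 h1 h2.
- exact: D d02 h2 h1.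
- exact: D d12 h2 h1.
Qed.

Lemma packing_parts_eq s W l A B x : packing s W l ->
  A \in flatten (map parts l) -> B \in flatten (map parts l) ->
  x \in A -> x \in B -> A = B.
Proof.
move=> pl /flatten_mapP[t tl At] /flatten_mapP[u ul Bu] xA xB.
have [e|ne] := eqVneq t u.
  by rewrite -e in Bu; apply: tile_parts_eq (packing_tile pl tl) At Bu xA xB.
have /pred0P/(_ x) := packing_disj pl tl ul ne.
by rewrite /= (subsetP (parts_supp At)) // (subsetP (parts_supp Bu)).
Qed.

(** Each coarse tile, stripped of [Us], is cut into [n] fine tiles, with [n] such that all three of
    its parts have room; [F] is a guaranteed yield per coarse tile. *)
Lemma carve s b W (Us : {set G}) (F : tile_type -> R) l : packing b W l ->
  (forall t, t \in l -> exists n : nat, [/\ F t <= s%:R * n%:R,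
     (a0 t.1 * s * n <= #|t.2.1 :\: Us|)%N, (a1 t.1 * s * n <= #|t.2.2.1 :\: Us|)%N &
     (a2 t.1 * s * n <= #|t.2.2.2 :\: Us|)%N]) ->
  exists l', [/\ packing s W l', cover_of l' \subset cover_of l :\: Us &
    \sum_(t <- l) F t <= s%:R * (size l')%:R].
Proof.
elim: l => [_ _|t l IH].
  by exists [::]; rewrite big_nil mulr0 /cover_of big_nil sub0set.
rewrite packing_cons => /and4P[ht dW dl pl] h.
have [|l' [pl' cl' sl']] := IH pl; first by move=> u ul; apply: h; rewrite inE ul orbT.
have [|n [hF h0 h1 h2]] := h t; first by rewrite inE eqxx.
have [_ [c01 c02 c12]] := tile_inv ht.
have sD (X : {set G}) : X :\: Us \subset X by apply: subsetDl.
have [||||l2 [pl2 sl2 cl2]] := @split_tile _ a0 a1 a2 s n W t.1 _ _ _ _ _ _ h0 h1 h2.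
- exact: complete_toS c01.
- exact: complete_toS c02.
- exact: complete_toS c12.
- by apply: disjointWl dW; rewrite /supp !setUSS.
have e : t.2.1 :\: Us :|: (t.2.2.1 :\: Us :|: t.2.2.2 :\: Us) = supp t :\: Us.
  by rewrite /supp !setDUl.
rewrite e in cl2.
exists (l2 ++ l'); split.
- apply: packing_cat => //; apply: disjointWl cl2 _; apply: disjointWr cl' _.
  by apply: disjointWl (sD _) _; apply: disjointWr (sD _) dl.
- rewrite cover_cat cover_cons setDUl; exact: setUSS.
- by rewrite big_cons size_cat natrD mulrDr sl2 lerD.
Qed.

Lemma refine s q W l : packing (s * q) W l ->
  exists l', packing s W l' /\ (s * q)%:R * (size l)%:R <= s%:R * (size l')%:R :> R.
Proof.
move=> pl; have [|l' [pl' _ h]] := @carve s _ W set0 (fun _ => (s * q)%:R) l pl.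
  move=> t tl; exists q; have [[e0 e1 e2] _] := tile_inv (packing_tile pl tl).
  by rewrite !setD0 e0 e1 e2 natrM; split=> //; rewrite mulnA.
exists l'; split=> //; apply: le_trans h.
by rewrite big_const_seq count_predT iter_addr_0 mulr_natr.
Qed.

Lemma sum_cover s W l (f : G -> R) : packing s W l ->
  \sum_(t <- l) \sum_(x in supp t) f x = \sum_(x in cover_of l) f x.
Proof.
elim: l => [_|t l IH]; first by rewrite /cover_of !big_nil big_set0.
rewrite packing_cons big_cons cover_cons => /and4P[_ _ d pl].
by rewrite IH // sum_setU_disj.
Qed.

Variables (W : {set G}) (s b d A N : nat) (c xi V1 theta : R).
Hypothesis hA : forall k, [/\ (a0 k <= A)%N, (a1 k <= A)%N & (a2 k <= A)%N].
Hypothesis A0 : (0 < A)%N.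
Hypothesis s0 : (0 < s)%N.
Hypothesis b0 : (0 < b)%N.
Hypothesis d0 : (0 < d)%N.
Hypothesis N0 : (0 < N)%N.
Hypothesis c0 : 0 < c.
Hypothesis theta0 : 0 < theta.
Hypothesis cheap : cheap_tiles G a0 a1 a2 xi V1.
Hypothesis hbad : 2 / d%:R * m%:R ^+ 3 +
  3 * ((#|W| + b)%:R + c ^+ 2 * m%:R) * m%:R ^+ 2 <= xi * m%:R ^+ 3.
Hypothesis htheta : 12 * d%:R * theta <= 1.
Hypothesis hkst : (kst_bound (2 * d) (A * s) <= b)%N.
Hypothesis hN : N%:R * s%:R <= theta * V1.
Hypothesis hpot : N%:R * step_cost G theta s b A N <= c ^+ 2 * m%:R.

(* Parts of the tiles of a coarse packing, and blocks of the uncovered rest, serve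
   as clusters.  A small share of each is repacked greedily; the coarse tiles lose
   that share, but the uncovered rest is now used as well. *)
Lemma improve l : packing b W l -> exists l', packing s W l' /\
  N%:R * s%:R + (size l)%:R * (b%:R - theta * b%:R - s%:R) - theta * c * m%:R
    <= s%:R * (size l')%:R.
Proof.
move=> pl.
pose P := flatten (map parts l).
pose Rest := ~: (W :|: cover_of l).
(* The nonempty members of [Q] partition the vertices. [W] is listed only to complete the partition
   and is excluded again through [J]. *)
pose Q := P ++ [:: W; Rest].
pose cl x := nth set0 Q (find (fun X : {set G} => x \in X) Q).
have Pcov X : X \in P -> X \subset cover_of l.
  move=> /flatten_mapP[t tl Xt]; apply: subset_trans (parts_supp Xt) _.
  exact: supp_cover.
have covW : [disjoint cover_of l & W].
  apply/pred0P => x /=; apply/negP => /andP[]; rewrite /cover_of.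
  rewrite big_tnth => /bigcupP[i _ xt] xW.
  by have /pred0P/(_ x) := packing_avoid pl (mem_tnth i (in_tuple l)); rewrite /= xt xW.
have covP x : x \in cover_of l -> exists2 X, X \in P & x \in X.
  rewrite /cover_of big_tnth => /bigcupP[i _]; set t := tnth _ _.
  have tl : t \in l by apply: (mem_tnth i (in_tuple l)).
  rewrite /supp !inE => /or3P[] xt.
  - by exists t.2.1 => //; apply/flatten_mapP; exists t => //; rewrite !inE eqxx.
  - by exists t.2.2.1 => //; apply/flatten_mapP; exists t => //; rewrite !inE eqxx ?orbT.
  - by exists t.2.2.2 => //; apply/flatten_mapP; exists t => //; rewrite !inE eqxx ?orbT.
have Qhas x : has (fun X : {set G} => x \in X) Q.
{ apply/hasP; have [xc|xc] := boolP (x \in cover_of l).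
    by have [X XP xX] := covP _ xc; exists X => //; rewrite mem_cat XP.
  have [xW|xW] := boolP (x \in W); first by exists W; rewrite // mem_cat !inE eqxx !orbT.
  by exists Rest; rewrite /Rest ?mem_cat ?inE ?eqxx ?orbT // negb_or xc xW. }
have Qeq X Y x : X \in Q -> Y \in Q -> x \in X -> x \in Y -> X = Y.
{ have PW Z z : Z \in P -> z \in Z -> z \notin W /\ z \notin Rest.
    move=> ZP zZ; have zc := subsetP (Pcov _ ZP) _ zZ.
    rewrite /Rest !inE negbK zc orbT; split=> //.
    by apply/negP => zW; have /pred0P/(_ z) := covW; rewrite /= zc zW.
  rewrite !mem_cat !inE => /or3P[XP|/eqP ->|/eqP ->] /or3P[YP|/eqP ->|/eqP ->] // xX xY.
  - exact: packing_parts_eq pl XP YP xX xY.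
  - by have [/negP] := PW _ _ XP xX.
  - by have [_ /negP] := PW _ _ XP xX.
  - by have [/negP] := PW _ _ YP xY.
  - by move: xY; rewrite /Rest !inE xX.
  - by have [_ /negP] := PW _ _ YP xY.
  - by move: xX; rewrite /Rest !inE xY. }
have cl_in x : x \in cl x by apply: (@nth_find _ set0 (fun X : {set G} => x \in X)).
have cl_Q x : cl x \in Q by rewrite /cl mem_nth // -has_find.
have cl_blk x X : X \in Q -> x \in X -> cl x = X by move=> XQ xX; apply: (Qeq _ _ x).
have cl_eq x y : y \in cl x -> cl y = cl x by move=> h; apply: cl_blk.
(* The uncovered rest can serve as a cluster only if it has at least [b] vertices. *)
pose J := W :|: (if (b <= #|Rest|)%N then set0 else Rest).
have cJ : (#|J| <= #|W| + b)%N.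
  have [h _] := leq_card_setU W (if (b <= #|Rest|)%N then set0 else Rest).
  apply: leq_trans h _; rewrite leq_add2l; case: ifP => h; first by rewrite cards0.
  by rewrite ltnW // ltnNge h.
have partsize X x : X \in P -> x \in X -> (b <= #|X|)%N.
{ move=> /flatten_mapP[t tl Xt] xX.
  have X0 : (0 < #|X|)%N by apply/card_gt0P; exists x.
  have [[e0 e1 e2] _] := tile_inv (packing_tile pl tl).
  by move: Xt X0; rewrite !inE => /or3P[]/eqP ->; rewrite ?e0 ?e1 ?e2 muln_gt0 => /andP[h _]; apply: leq_pmull. }
have hb x : x \notin J -> (b <= #|cl x|)%N.
{ rewrite /J inE negb_or => /andP[xW xR]; have := cl_Q x; rewrite mem_cat !inE.
  move=> /or3P[h|/eqP h|/eqP h].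
  - exact: partsize h (cl_in x).
  - by have := cl_in x; rewrite h (negPf xW).
  - move: xR; case: ifP => [hb _|_]; first by rewrite h.
    by rewrite -h cl_in. }
have hW x : x \notin J -> [disjoint cl x & W].
{ rewrite /J inE negb_or => /andP[xW _]; apply/pred0P => z /=; apply/negP => /andP[zc zW].
  have e : cl x = W by apply: (Qeq _ _ z) => //; rewrite mem_cat !inE eqxx !orbT.
  by have := cl_in x; rewrite e (negPf xW). }
have bad : 2 / d%:R * m%:R ^+ 3 + 3 * (#|J|%:R + c ^+ 2 * m%:R) * m%:R ^+ 2 <= xi * m%:R ^+ 3.
{ apply: le_trans hbad; rewrite lerD2l ler_wpM2r ?exprn_ge0 // ler_wpM2l // lerD2r.
  by rewrite ler_nat. }
have [l1 [pl1 sl1 ol1]] := greedy_packing cl_in cl_eq theta0 hA A0 s0 b0 d0 N0 hb hW cheap bad htheta hkst hN hpot.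
set Us := cover_of l1 in ol1.
pose f x := pos (load cl theta Us x - 1).
have f0 x : 0 <= f x by apply: pos_ge0.
pose M (t : tile_type) := \sum_(x in supp t) f x.
have M0 t : 0 <= M t by apply: sumr_ge0.
(* Of its multiplicity [b] a tile loses the planned share [theta * b], the excess [theta * M t] of
   overloaded parts, and up to [s] by rounding. *)
pose F (t : tile_type) : R := b%:R - theta * b%:R - theta * M t - s%:R.
have sR : 0 < s%:R :> R by rewrite ltr0n.
have [|l2 [pl2 cl2 sl2]] := @carve s b W Us F l pl.
{ move=> t tl; pose C := b%:R - theta * b%:R - theta * M t.
  exists (Num.truncn (C / s%:R)).
  have [[e0 e1 e2] _] := tile_inv (packing_tile pl tl).
  have main (a : nat) (X : {set G}) : X \in parts t -> #|X| = (a * b)%N ->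
     (a * s * Num.truncn (C / s%:R) <= #|X :\: Us|)%N.
  { move=> Xt cX; have [C0|C0] := ltP C 0.
      have -> : Num.truncn (C / s%:R) = 0%N.
        by apply/truncn0Pn; rewrite -ltNge (lt_trans _ ltr01) // pmulr_llt0 ?invr_gt0.
      by rewrite muln0.
    case: (posnP a) => [->|a_gt0]; first by rewrite !mul0n.
    have /card_gt0P[x xX] : (0 < #|X|)%N by rewrite cX muln_gt0 a_gt0.
    have XQ : X \in Q by rewrite mem_cat; apply/orP; left; apply/flatten_mapP; exists t.
    have clx : cl x = X by apply: cl_blk.
    have XR : 0 < #|X|%:R :> R by rewrite ltr0n cX muln_gt0 a_gt0.
    have used : #|Us :&: X|%:R = theta * #|X|%:R * load cl theta Us x.
      by rewrite /load clx; field; rewrite !lt0r_neq0.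
    have hM : #|X|%:R * f x <= M t.
      rewrite mulr_natl -sumr_const; apply: le_trans (le_sum_subset f0 (parts_supp Xt)).
      apply: ler_sum => y yX; rewrite /f.
      have -> // : load cl theta Us y = load cl theta Us x.
      by apply: (load_cl cl_eq); rewrite clx.
    have hl : load cl theta Us x <= 1 + f x by have := pos_ge (load cl theta Us x - 1); rewrite -/(f x); lra.
    have hu : #|Us :&: X|%:R <= a%:R * (theta * b%:R + theta * M t).
    { rewrite used; apply: le_trans (_ : theta * #|X|%:R * (1 + f x) <= _).
        by rewrite ler_wpM2l // mulr_ge0 // ltW.
      rewrite mulrDr mulr1 mulrDr -[X in _ + X]mulrA.
      have -> : theta * #|X|%:R = a%:R * (theta * b%:R) by rewrite cX natrM; ring.
      rewrite lerD2l; apply: le_trans (_ : theta * M t <= _); first by rewrite ler_wpM2l // ltW.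
      by apply: ler_peMl; [rewrite mulr_ge0 // ltW|rewrite ler1n]. }
    have hn : (Num.truncn (C / s%:R))%:R * s%:R <= C.
      by rewrite -ler_pdivlMr // truncn_le // divr_ge0 // ltW.
    have hD : #|X :\: Us|%:R = a%:R * b%:R - #|Us :&: X|%:R :> R.
      by rewrite -natrM -cX -(cardsID Us X) natrD setIC; ring.
    rewrite -(ler_nat R) hD !natrM.
    apply: le_trans (_ : a%:R * C <= _); first by rewrite -mulrA [s%:R * _]mulrC ler_wpM2l.
    rewrite /C; move: hu; set u := #|_|%:R; lra. }
  split; [|by apply: main; rewrite ?inE ?eqxx ?orbT..].
  have := truncnS_gt (C / s%:R); rewrite ltr_pdivrMr // -natr1 mulrDl mul1r => h.
  rewrite /F -/C mulrC; lra. }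
exists (l1 ++ l2); split.
{ apply: packing_cat => //; apply/pred0P => x /=; apply/negP => /andP[x1 x2].
  by have := subsetP cl2 _ x2; rewrite inE x1. }
rewrite size_cat sl1 natrD [leRHS]mulrDr [s%:R * N%:R]mulrC -addrA lerD2l.
apply: le_trans sl2; rewrite /F.
have -> : \sum_(t <- l) (b%:R - theta * b%:R - theta * M t - s%:R) =
   (size l)%:R * (b%:R - theta * b%:R - s%:R) - theta * \sum_(t <- l) M t.
{ rewrite mulr_sumr -sumrN.
  have -> : (size l)%:R * (b%:R - theta * b%:R - s%:R) = \sum_(t <- l) (b%:R - theta * b%:R - s%:R) :> R.
    by rewrite big_const_seq count_predT iter_addr_0 mulr_natl.
  by rewrite -big_split /=; apply: eq_bigr => t _; ring. }
rewrite lerD2l lerN2 -mulrA; apply: ler_wpM2l; first exact: ltW.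
rewrite (sum_cover _ pl).
apply: le_trans (_ : \sum_x f x <= _).
  by apply: le_trans (le_sum_subset f0 (subsetT _)) _; rewrite le_eqVlt; apply/orP; left; apply/eqP; apply: eq_bigl => x; rewrite inE.
(* The inequality between arithmetic and geometric means turns the bound [c ^+ 2 * m] on the squared
   excess into the bound [c * m] on the excess. *)
apply: le_trans (_ : \sum_x (f x ^+ 2 / (2 * c) + c / 2) <= _).
{ apply: ler_sum => x _; have -> : f x ^+ 2 / (2 * c) + c / 2 = f x + (f x - c) ^+ 2 / (2 * c).
    by field; rewrite lt0r_neq0.
  by rewrite lerDl divr_ge0 ?sqr_ge0 // mulr_ge0 // ltW. }
rewrite big_split /= -mulr_suml sumr_const -[_ *+ #|_|]mulr_natr -/m.
have h : \sum_x f x ^+ 2 <= c ^+ 2 * m%:R by exact: ol1.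
apply: le_trans (_ : c ^+ 2 * m%:R / (2 * c) + c / 2 * m%:R <= _).
  by rewrite lerD2r ler_wpM2r // invr_ge0 mulr_ge0 // ltW.
by rewrite le_eqVlt; apply/orP; left; apply/eqP; field; rewrite lt0r_neq0.
Qed.
End Improve.

(** Induction on the number [k] of gains: a packing with [k] gains by tiles of a much larger size
    [b] is improved to one with [k + 1] gains by tiles of size [s], or merely refined if it is good
    enough already. Since [V1 <= nverts G], about [2 / g] gains reach [V1]. *)
Theorem tile_packing (R : realType) (a0 a1 a2 : bool -> nat) (xi eps v1 : R) :
  (forall k, 0 < a0 k)%N -> 0 < xi -> 0 < eps -> 0 < v1 ->
  exists omega : R, 0 < omega /\ forall s : nat, (0 < s)%N ->
    exists m0 : nat, forall (G : sgraph) (W : {set G}) (V1 : R),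
      (m0 <= nverts G)%N -> #|W|%:R <= omega * (nverts G)%:R ->
      v1 * (nverts G)%:R <= V1 -> V1 <= (nverts G)%:R ->
      cheap_tiles G a0 a1 a2 xi V1 ->
      exists l, packing a0 a1 a2 s W l /\ (1 - eps) * V1 <= s%:R * (size l)%:R.
Proof.
move=> ha xi0 eps0 v10.
exists (xi / 12); split; first by rewrite divr_gt0.
pose A := (a0 true + a1 true + a2 true + (a0 false + a1 false + a2 false))%N.
have hA k : [/\ (a0 k <= A)%N, (a1 k <= A)%N & (a2 k <= A)%N].
  by rewrite /A; case: k; split; lia.
have A0 : (0 < A)%N by have := ha true; rewrite /A; lia.
have [d hd] := nat_ub (8 / xi + 1).
have dR : 0 < d%:R :> R by apply: lt_le_trans hd; rewrite ltr_wpDl // ltW // divr_gt0.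
have d0 : (0 < d)%N by rewrite -(ltr0n R).
have hd2 : 2 / d%:R <= xi / 4.
{ rewrite ler_pdivrMr //; have : 8 / xi <= d%:R by lra.
  rewrite ler_pdivrMr //; lra. }
pose theta : R := (12 * d%:R)^-1.
have th0 : 0 < theta by rewrite invr_gt0 mulr_gt0.
have hth : 12 * d%:R * theta <= 1 by rewrite /theta divff // lt0r_neq0 // mulr_gt0.
pose c : R := Num.min (eps * v1 / 4) (Num.min 1 (xi / 12)).
have c0 : 0 < c by rewrite /c !lt_min ltr01 !divr_gt0 // mulr_gt0.
have [c1 c2 c3] : [/\ c <= eps * v1 / 4, c <= 1 & c <= xi / 12].
  by rewrite /c !ge_min !lexx ?orbT.
have csq : c ^+ 2 <= c by rewrite expr2 ler_piMl // ltW.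
have csq0 : 0 < c ^+ 2 by rewrite exprn_gt0.
(* While the packed weight [X] is below [(1 - eps) * V1], a round gains [theta * (V1 - X) >= g * m].
   Half of this covers the losses: [g / 4] for the overload, [g / 8] for cutting the coarse tiles
   and [g / 8] for rounding [N]. *)
pose g : R := theta * eps * v1.
have g0 : 0 < g by rewrite !mulr_gt0.
have key k : forall s : nat, (0 < s)%N ->
    exists m0 : nat, forall (G : sgraph) (W : {set G}) (V1 : R),
      (m0 <= nverts G)%N -> #|W|%:R <= xi / 12 * (nverts G)%:R ->
      v1 * (nverts G)%:R <= V1 -> V1 <= (nverts G)%:R ->
      cheap_tiles G a0 a1 a2 xi V1 ->
      exists l, packing a0 a1 a2 s W l /\
        ((1 - eps) * V1 <= s%:R * (size l)%:R \/ k%:R * (g / 2) * (nverts G)%:R <= s%:R * (size l)%:R).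
{ elim: k => [|k IH] s s0.
    exists 0%N => G W V1 _ _ _ _ _; exists [::]; split=> //.
    by right; rewrite !mul0r mulr0.
  have sR : 0 < s%:R :> R by rewrite ltr0n.
  have [q1 hq1] := nat_ub (18 * A%:R ^+ 2 * s%:R / (theta * c ^+ 2)).
  have [q2 hq2] := nat_ub (8 * s%:R / g).
  pose q := (kst_bound (2 * d) (A * s) + q1 + q2 + 1)%N.
  pose b := (s * q)%N.
  have qb : (q <= b)%N by rewrite leq_pmull.
  have b0 : (0 < b)%N by rewrite muln_gt0 s0 /q addn1.
  have bR : 0 < b%:R :> R by rewrite ltr0n.
  have hb0 : (kst_bound (2 * d) (A * s) <= b)%N by apply: leq_trans qb; rewrite /q; clear; lia.
  have hb1 : 18 * A%:R ^+ 2 * s%:R / (theta * c ^+ 2) <= b%:R.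
    apply: le_trans hq1 _; rewrite ler_nat; apply: leq_trans qb; rewrite /q; clear; lia.
  have hb2 : 8 * s%:R / g <= b%:R.
    apply: le_trans hq2 _; rewrite ler_nat; apply: leq_trans qb; rewrite /q; clear; lia.
  have [mb hmb] := IH b b0.
  have [m1 hm1] := nat_ub ((2 / c ^+ 2 + 1) * s%:R / (theta * v1)).
  have [m2 hm2] := nat_ub (12 * b%:R / xi).
  have [m3 hm3] := nat_ub (8 * s%:R / g).
  exists (mb + m1 + m2 + m3 + 1)%N => G W V1 mG hW hV1 hV2 cheap.
  set m := nverts G in mG hW hV1 hV2 *.
  have mR : 0 < m%:R :> R by rewrite ltr0n; move: mG; clear; lia.
  have [l [pl hl]] : exists l, packing a0 a1 a2 b W l /\
        ((1 - eps) * V1 <= b%:R * (size l)%:R \/ k%:R * (g / 2) * m%:R <= b%:R * (size l)%:R).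
    by apply: hmb => //; move: mG; clear; rewrite /m; lia.
  have [X_ge|X_lt] := leP ((1 - eps) * V1) (b%:R * (size l)%:R).
    have [l' [pl' hl']] := @refine G a0 a1 a2 R s q W l pl.
    by exists l'; split=> //; left; apply: le_trans hl'.
  have {}hl : k%:R * (g / 2) * m%:R <= b%:R * (size l)%:R by case: hl => // h; move: (le_lt_trans h X_lt); rewrite ltxx.
  pose N := Num.truncn (theta * V1 / s%:R).
  have V10 : 0 < V1 by apply: lt_le_trans hV1; rewrite mulr_gt0.
  have hN1 : N%:R * s%:R <= theta * V1.
    by rewrite -ler_pdivlMr // truncn_le // divr_ge0 ?ltW // mulr_gt0.
  have hN2 : theta * V1 < (N%:R + 1) * s%:R.
    by rewrite -ltr_pdivrMr // natr1 truncnS_gt.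
  have M1 : (2 / c ^+ 2 + 1) * s%:R <= theta * v1 * m%:R.
  { have : (2 / c ^+ 2 + 1) * s%:R / (theta * v1) <= m%:R.
      by apply: le_trans hm1 _; rewrite ler_nat; move: mG; clear; lia.
    by rewrite ler_pdivrMr ?mulr_gt0 // [m%:R * _]mulrC. }
  have M2 : 12 * b%:R <= xi * m%:R.
  { have : 12 * b%:R / xi <= m%:R.
      by apply: le_trans hm2 _; rewrite ler_nat; move: mG; clear; lia.
    by rewrite ler_pdivrMr // [m%:R * _]mulrC. }
  have M3 : 8 * s%:R <= g * m%:R.
  { have : 8 * s%:R / g <= m%:R.
      by apply: le_trans hm3 _; rewrite ler_nat; move: mG; clear; lia.
    by rewrite ler_pdivrMr // [m%:R * _]mulrC. }
  have hN3 : 2 / c ^+ 2 <= N%:R.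
  { have h : theta * v1 * m%:R <= theta * V1 by rewrite -mulrA ler_wpM2l // ltW.
    have : (2 / c ^+ 2 + 1) * s%:R < (N%:R + 1) * s%:R by apply: le_lt_trans M1 _; apply: le_lt_trans h _.
    by rewrite ltr_pM2r // => h2; apply: ltW; move: h2; rewrite ltrD2r. }
  have NR : 0 < N%:R :> R by apply: lt_le_trans hN3; rewrite divr_gt0.
  have N0 : (0 < N)%N by rewrite -(ltr0n R).
  have bad : 2 / d%:R * m%:R ^+ 3 + 3 * ((#|W| + b)%:R + c ^+ 2 * m%:R) * m%:R ^+ 2 <= xi * m%:R ^+ 3.
  { have -> : 2 / d%:R * m%:R ^+ 3 + 3 * ((#|W| + b)%:R + c ^+ 2 * m%:R) * m%:R ^+ 2 =
      (2 / d%:R * m%:R + 3 * ((#|W| + b)%:R + c ^+ 2 * m%:R)) * m%:R ^+ 2 by ring.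
    have -> : xi * m%:R ^+ 3 = (xi * m%:R) * m%:R ^+ 2 by ring.
    rewrite ler_wpM2r ?exprn_ge0 // natrD.
    have e1 : 2 / d%:R * m%:R <= xi / 4 * m%:R by rewrite ler_wpM2r.
    have e2 : c ^+ 2 * m%:R <= xi / 12 * m%:R by rewrite ler_wpM2r //; apply: le_trans csq c3.
    move: e1 e2 hW M2; set x1 := _ / d%:R * m%:R; set x2 := c ^+ 2 * m%:R.
    have -> : xi / 4 * m%:R = xi * m%:R / 4 by ring.
    have -> : xi / 12 * m%:R = xi * m%:R / 12 by ring.
    set x3 := xi * m%:R; clear; lra. }
  have pot : N%:R * step_cost G theta s b A N <= c ^+ 2 * m%:R.
  { rewrite /step_cost mulrDr.
    have -> : c ^+ 2 * m%:R = c ^+ 2 * m%:R / 2 + c ^+ 2 * m%:R / 2 by field.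
    apply: lerD.
    - have -> : N%:R * ((3 * A * s)%:R * ((3 * A * s)%:R / b%:R / theta) / theta) =
         (N%:R * s%:R) * (9 * A%:R ^+ 2 * s%:R / (b%:R * theta ^+ 2)).
        have -> : (3 * A * s)%:R = 3 * A%:R * s%:R :> R by rewrite !natrM.
        have e (n a s' b' th : R) : th != 0 -> b' != 0 ->
          n * (3 * a * s' * (3 * a * s' / b' / th) / th) = n * s' * (9 * a ^+ 2 * s' / (b' * th ^+ 2)).
          by move=> h1 h2; field; rewrite h1 h2.
        by apply: e; rewrite lt0r_neq0.
      apply: le_trans (_ : theta * m%:R * (9 * A%:R ^+ 2 * s%:R / (b%:R * theta ^+ 2)) <= _).
        rewrite ler_wpM2r //; last by apply: le_trans hN1 _; rewrite ler_wpM2l // ltW.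
        by rewrite divr_ge0 ?mulr_ge0 ?sqr_ge0 // ltW.
      have -> : theta * m%:R * (9 * A%:R ^+ 2 * s%:R / (b%:R * theta ^+ 2)) =
         (18 * A%:R ^+ 2 * s%:R / (theta * c ^+ 2)) / b%:R * (c ^+ 2 * m%:R / 2).
        by field; rewrite !lt0r_neq0.
      apply: ler_piMl; last by rewrite ler_pdivrMr // mul1r.
      by rewrite divr_ge0 // mulr_ge0 // ltW.
    - have -> : N%:R * (m%:R * N%:R^-1 ^+ 2) = m%:R / N%:R :> R by field; rewrite lt0r_neq0.
      rewrite ler_pdivrMr //.
      have -> : c ^+ 2 * m%:R / 2 * N%:R = m%:R * (N%:R * c ^+ 2 / 2) by ring.
      rewrite ler_peMr // ler_pdivlMr // mul1r.
      by move: hN3; rewrite ler_pdivrMr. }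
  have [l' [pl' hl']] := improve hA A0 s0 b0 d0 N0 c0 th0 cheap bad hth hb0 hN1 pot pl.
  exists l'; split=> //; right; apply: le_trans hl'.
  set X := b%:R * (size l)%:R in X_lt hl.
  have XV : X <= V1 by apply: ltW; apply: lt_trans X_lt _; rewrite gtr_pMl // ltrBlDr ltrDl.
  have szs : s%:R * (size l)%:R <= g / 8 * m%:R.
  { have e : 8 * s%:R <= b%:R * g by move: hb2; rewrite ler_pdivrMr.
    have e2 : 8 * s%:R * (size l)%:R <= b%:R * g * (size l)%:R by rewrite ler_wpM2r.
    have e3 : g * X <= g * m%:R by apply: ler_wpM2l; [exact: ltW|exact: le_trans XV hV2].
    move: e2 e3; rewrite /X => e2 e3.
    have -> : g / 8 * m%:R = (g * m%:R) / 8 by ring.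
    rewrite ler_pdivlMr //; lra. }
  have thX : theta * X <= theta * V1 - g * m%:R.
  { have e1 : theta * X <= theta * ((1 - eps) * V1) by rewrite ler_wpM2l // ltW.
    have e2 : theta * eps * (v1 * m%:R) <= theta * eps * V1 by rewrite ler_wpM2l // ltW // mulr_gt0.
    rewrite /g; lra. }
  have thc : theta * c * m%:R <= g / 4 * m%:R.
  { rewrite ler_wpM2r // /g; have -> : theta * eps * v1 / 4 = theta * (eps * v1 / 4) by ring.
    by rewrite ler_wpM2l // ltW. }
  rewrite -natr1.
  have -> : (size l)%:R * (b%:R - theta * b%:R - s%:R) = X - theta * X - s%:R * (size l)%:R by rewrite /X; ring.
  move: hl szs thX thc hN2 M3; rewrite !mulrDl !mul1r.
  have -> : g / 8 * m%:R = (g * m%:R) / 8 by ring.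
  have -> : g / 4 * m%:R = (g * m%:R) / 4 by ring.
  have -> : g / 2 * m%:R = (g * m%:R) / 2 by ring.
  clear; lra. }
move=> s s0; have [k hk] := nat_ub (2 / g).
have [m0 h0] := key k s s0.
exists m0 => G W V1 h1 h2 h3 h4 h5; have [l [pl hl]] := h0 G W V1 h1 h2 h3 h4 h5.
exists l; split=> //; case: hl => // hl.
have V10 : 0 <= V1 by apply: le_trans h3; rewrite mulr_ge0 // ltW.
apply: le_trans (_ : V1 <= _); first by rewrite ler_piMl // gerBl ltW.
apply: le_trans h4 _; apply: le_trans hl.
rewrite ler_peMl //; move: hk; rewrite ler_pdivrMr //; lra.
Qed.

(** * Cheap tiles in dense graphs *)

(* The first alternative produces triangles, the second only edges.  In the third,
   each region contributes half of the bound in [rich_weight]: through triangles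
   if it has at most [3 * D1 / 2] vertices, through edges otherwise. *)
Definition tile_rich (G : sgraph) (D1 : nat) : Prop :=
  [\/ [/\ forall x : G, (D1 <= #|nbr x|)%N,
          forall x y : G, adj x y -> (D1 <= #|nbr x :&: nbr y|)%N &
          (2 * D1 <= nverts G)%N],
      (forall x : G, (D1 <= #|nbr x|)%N) /\ (3 * D1 <= nverts G)%N |
      exists R1 R2 : {set G}, [/\ [disjoint R1 & R2], R1 != set0, R2 != set0,
        forall x, x \in R1 -> (D1 <= #|nbr x :&: R1|)%N &
        forall x, x \in R2 -> (D1 <= #|nbr x :&: R2|)%N]].

(** Here [X] dominates the weight of [s] vertices of weight at least [w0], of which [z] have weight
    at least [mu - p * w0]. If [mu <= (p + 1) * w0], the bound [s * w0] suffices. Otherwise the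
    first bound is linear in [w0], and its extreme cases are [w0 = 0] and [w0 = mu / (p + 1)]. *)
Lemma weight_bound (R : realType) (p mu X z s w0 D : R) :
  0 < p -> 0 <= w0 -> 0 <= mu -> 0 <= s ->
  z * (mu - p * w0) + (s - z) * w0 <= X -> s * w0 <= X ->
  D <= z -> (p + 1) * D <= s -> D * mu <= X.
Proof.
move=> p0 w00 mu0 s0 h1 h2 Dz Ds; have p1 : 0 < p + 1 by lra.
have [le|lt] := leP mu ((p + 1) * w0).
  have [D0|D0] := leP 0 D; last first.
    by apply: le_trans h2; apply: le_trans (mulr_ge0 s0 w00); rewrite mulr_le0_ge0 // ltW.
  apply: le_trans h2; apply: le_trans (_ : D * ((p + 1) * w0) <= _).
    by rewrite ler_wpM2l.
  by rewrite mulrA [D * _]mulrC ler_wpM2r.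
have h3 : z * mu + (s - (p + 1) * z) * w0 <= X.
  by have -> : z * mu + (s - (p + 1) * z) * w0 = z * (mu - p * w0) + (s - z) * w0 by ring.
have [ge|sl] := leP ((p + 1) * z) s.
  apply: le_trans h3; apply: le_trans (_ : z * mu <= _); first by rewrite ler_wpM2r.
  by rewrite lerDl mulr_ge0 // subr_ge0.
have h4 : (s - (p + 1) * z) * mu <= (p + 1) * ((s - (p + 1) * z) * w0).
  rewrite mulrCA; apply: ler_wnM2l; last exact: ltW.
  by rewrite subr_le0 ltW.
rewrite -(ler_pM2l p1); apply: le_trans (_ : s * mu <= _).
  by rewrite mulrA ler_wpM2r.
apply: le_trans (_ : (p + 1) * (z * mu + (s - (p + 1) * z) * w0) <= _); last by rewrite ler_pM2l.
rewrite mulrDr; apply: le_trans (_ : (p + 1) * (z * mu) + (s - (p + 1) * z) * mu <= _).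
  by rewrite le_eqVlt; apply/orP; left; apply/eqP; ring.
by rewrite lerD2l.
Qed.

Section Cheap.
Variables (R : realType) (G : sgraph) (e1 e2 t1 t2 t3 : nat).
Let rho := (t2 + t3)%N.
Definition size0 (k : bool) := if k then t1 else e1.
Definition size1 (k : bool) := if k then t2 else 0%N.
Definition size2 (k : bool) := if k then t3 else e2.
Hypothesis rho0 : (0 < rho)%N.
Hypothesis t1rho : (t1 <= rho)%N.
Hypothesis e2rho : (e2 <= rho)%N.
Hypothesis e1rho : (e1 <= 2 * rho)%N.

Local Notation m := ((nverts G)%:R : R).
Variables (delta : R) (w : G -> R) (B : {set G * (G * G)}) (mu : R).
Hypothesis delta0 : 0 < delta.
Hypothesis delta1 : delta <= 1.
Hypothesis w0 : forall x, 0 <= w x.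
Hypothesis mu0 : 0 <= mu.
Hypothesis cB : #|B|%:R <= delta ^+ 4 * m ^+ 3.
Hypothesis costly : forall k x, tri size0 size1 size2 k x -> x \notin B ->
  rho%:R * mu <= cost size0 size1 size2 k w x.
Hypothesis m0 : 0 < m.

Let rhoR : 0 < rho%:R :> R. Proof. by rewrite ltr0n. Qed.

Definition slice (v : G) : {set G * G} := [set p | (v, p) \in B].
Definition slice2 (v u : G) : {set G} := [set z | (v, (u, z)) \in B].
(** The exponent 4 of [delta] in the bound on [B] allows two uses of Markov's inequality: few
    vertices start more than [delta ^+ 2 * m ^+ 2] triples of [B], and from a good vertex few second
    entries continue to more than [delta * m] of them. *)
Definition good : {set G} := [set v | #|slice v|%:R <= delta ^+ 2 * m ^+ 2].

Lemma sum_slice : (#|B| = \sum_v #|slice v|)%N.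
Proof.
rewrite -sum1_card (eq_bigl (fun p => predT p.1 && ((p.1, p.2) \in B))); last by move=> [x y].
rewrite -(pair_big_dep predT (fun x y => (x, y) \in B) (fun _ _ => 1%N)) /=.
by apply: eq_bigr => v _; rewrite -sum1_card; apply: eq_bigl => y; rewrite inE.
Qed.

Lemma sum_slice2 v : (#|slice v| = \sum_u #|slice2 v u|)%N.
Proof.
rewrite -sum1_card (eq_bigl (fun p => predT p.1 && ((v, (p.1, p.2)) \in B))); last first.
  by move=> [x y]; rewrite inE.
rewrite -(pair_big_dep predT (fun x y => (v, (x, y)) \in B) (fun _ _ => 1%N)) /=.
by apply: eq_bigr => u _; rewrite -sum1_card; apply: eq_bigl => y; rewrite inE.
Qed.

Lemma markov_card (f : G -> nat) (T : {set G}) (a b : R) : 0 < a ->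
  (\sum_v f v)%:R <= a * b -> (forall v, v \in T -> a <= (f v)%:R) -> #|T|%:R <= b.
Proof.
move=> a0 h hT; rewrite -(ler_pM2l a0); apply: le_trans h.
rewrite mulr_natr -sumr_const natr_sum [leRHS](bigID (mem T)) /=.
apply: le_trans (_ : \sum_(i in T) (f i)%:R <= _); first exact: ler_sum.
by rewrite lerDl sumr_ge0.
Qed.

Lemma deltasq : delta ^+ 2 <= delta.
Proof. by rewrite expr2 ler_piMl // ltW. Qed.

Lemma card_good : #|~: good|%:R <= delta * m.
Proof.
apply: le_trans (_ : delta ^+ 2 * m <= _); last by rewrite ler_wpM2r ?deltasq // ltW.
apply: (@markov_card (fun v => #|slice v|) _ (delta ^+ 2 * m ^+ 2)).
- by rewrite mulr_gt0 // exprn_gt0.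
- by rewrite -sum_slice; apply: le_trans cB _; rewrite le_eqVlt; apply/orP; left; apply/eqP; ring.
- by move=> v; rewrite !inE -ltNge => /ltW.
Qed.

Lemma good_le (S : {set G}) : #|S|%:R - delta * m <= #|S :&: good|%:R :> R.
Proof.
have : #|S|%:R <= #|S :&: good|%:R + #|~: good|%:R :> R.
  rewrite -natrD ler_nat -(cardsID good S) leq_add2l subset_leq_card //.
  by apply/subsetP => x; rewrite !inE => /andP[].
have := card_good; lra.
Qed.

(** The middle entry of a triple of kind [false] is unconstrained, so a neighbour forming too cheap
    an edge with [v] puts [m] triples starting with [v] into [B]; a good [v] has few such
    neighbours. Division by [rho] uses [e1 <= 2 * rho] and [e2 <= rho]. *)
Lemma edge_count (v : G) (S : {set G}) : v \in good -> S \subset nbr v ->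
  exists Z : {set G}, [/\ Z \subset S, #|S|%:R - delta * m <= #|Z|%:R :> R &
    forall z, z \in Z -> mu - 2 * w v <= w z].
Proof.
rewrite inE => gv sS.
pose T := [set z in S | (e1%:R * w v + e2%:R * w z < rho%:R * mu)].
exists (S :\: T); split; first exact: subsetDl.
{ have : #|T|%:R <= delta * m.
  { apply: le_trans (_ : delta ^+ 2 * m <= _); last by rewrite ler_wpM2r ?deltasq // ltW.
    have sub : setX [set: G] T \subset slice v.
      apply/subsetP => -[u z]; rewrite !inE /= => /andP[zS lt].
      apply/negPn/negP => nB.
      have tf : tri size0 size1 size2 false (v, (u, z)).
        by rewrite /tri /= andbF /= -in_nbr (subsetP sS) ?implybT.
      have := costly tf nB; rewrite /cost /= mul0r addr0 => le.
      by have := lt_le_trans lt le; rewrite ltxx.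
    have := subset_leq_card sub; rewrite cardsX cardsT -(ler_nat R) natrM => h.
    have : m * #|T|%:R <= m * (delta ^+ 2 * m).
      apply: le_trans h _; apply: le_trans gv _.
      by rewrite le_eqVlt; apply/orP; left; apply/eqP; ring.
    by rewrite ler_pM2l. }
  have sT : T \subset S by apply/subsetP => x; rewrite inE => /andP[].
  rewrite cardsD (setIidPr sT) natrB ?subset_leq_card // => h; lra. }
move=> z; rewrite !inE => /andP[+ zS]; rewrite zS -leNgt /= => h.
rewrite -(ler_pM2l rhoR) mulrBr lerBlDr; apply: le_trans h _.
rewrite addrC; apply: lerD.
  by rewrite ler_wpM2r // ler_nat.
by rewrite mulrA ler_wpM2r // [_ * 2]mulrC -natrM ler_nat.
Qed.

(** Take [u] of least weight among the vertices of [S] in few bad triples with [v]. In a triangle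
    [v], [u], [z] the weight of [u] is at most that of [z], so the cost is at most
    [rho * (w v + w z)]. *)
Lemma triangle_count (v : G) (S : {set G}) (c : nat) : v \in good -> S \subset nbr v ->
  delta * m < #|S|%:R -> (forall u, u \in S -> (c <= #|nbr u :&: S|)%N) ->
  exists Z : {set G}, [/\ Z \subset S, c%:R - 2 * (delta * m) <= #|Z|%:R :> R &
    forall z, z \in Z -> mu - w v <= w z].
Proof.
rewrite inE => gv sS cS hc.
pose Sg := [set u in S | #|slice2 v u|%:R <= delta * m].
have sSg : Sg \subset S by apply/subsetP => x; rewrite inE => /andP[].
have cSg : #|S :\: Sg|%:R <= delta * m.
{ apply: (@markov_card (fun u => #|slice2 v u|) _ (delta * m)).
  - by rewrite mulr_gt0.
  - by rewrite -sum_slice2; apply: le_trans gv _; rewrite le_eqVlt; apply/orP; left; apply/eqP; ring.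
  - by move=> u; rewrite !inE => /andP[+ uS]; rewrite uS -ltNge => /ltW. }
have /card_gt0P[u0 u0S] : (0 < #|Sg|)%N.
{ rewrite lt0n; apply/eqP => z0; move: cSg; rewrite cardsD (setIidPr sSg) z0 subn0 => h.
  by have := lt_le_trans cS h; rewrite ltxx. }
case: (Order.TotalTheory.arg_minP w (u0S : [pred u | u \in Sg] u0)) => u /= uS umin.
have uS' := subsetP sSg _ uS.
pose Z := (nbr u :&: Sg) :\: slice2 v u.
exists Z; split.
- apply/subsetP => z; rewrite !inE => /andP[_ /andP[_ /andP[]]] //.
- have h1 : (c <= #|Z| + (#|S :\: Sg| + #|slice2 v u|))%N.
  { apply: leq_trans (hc _ uS') _.
    have sub : nbr u :&: S \subset Z :|: (S :\: Sg :|: slice2 v u).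
      apply/subsetP => z; rewrite /Z !inE; case: (adj u z) => //=; case: (z \in S) => //=.
      by case: (_ \in B); rewrite /= ?orbT // andbT; case: (_ <= _).
    apply: leq_trans (subset_leq_card sub) _.
    have [k1 _] := leq_card_setU Z (S :\: Sg :|: slice2 v u).
    have [k2 _] := leq_card_setU (S :\: Sg) (slice2 v u).
    by apply: leq_trans k1 _; rewrite leq_add2l. }
  have h2 : #|slice2 v u|%:R <= delta * m by move: uS; rewrite inE => /andP[].
  move: h1; rewrite -(ler_nat R) !natrD; move: cSg h2; set x1 := _%:R; set x2 := #|slice2 v u|%:R; set x3 := #|Z|%:R => *; lra.
- move=> z; rewrite !inE => /andP[nB /andP[uz /andP[zS zg]]].
  have zSg : z \in Sg by rewrite inE zS zg.
  have := costly (k := true) _ nB; rewrite /tri /cost /=.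
  rewrite uz -!in_nbr (subsetP sS _ uS') (subsetP sS _ zS) !implybT => /(_ isT) le.
  have wuz : t2%:R * w u <= t2%:R * w z by rewrite ler_wpM2l // umin.
  have : rho%:R * mu <= rho%:R * w v + rho%:R * w z.
  { apply: le_trans le _; rewrite -addrA; apply: lerD; first by rewrite ler_wpM2r // ler_nat.
    by rewrite /rho natrD mulrDl lerD2r. }
  by rewrite -mulrDr ler_pM2l // lerBlDl.
Qed.

(** [p] is 2 when [Z] comes from edges and 1 when it comes from triangles. *)
Lemma region_weight (p D : R) (v : G) (S Z T : {set G}) : 0 < p ->
  S \subset T -> Z \subset T -> (forall x, x \in S -> w v <= w x) ->
  (forall z, z \in Z -> mu - p * w v <= w z) ->
  D <= #|Z|%:R -> (p + 1) * D <= #|S|%:R -> D * mu <= \sum_(x in T) w x.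
Proof.
move=> p0 sS sZ hS hZ dZ dS.
apply: (@weight_bound R p mu _ #|Z|%:R #|S|%:R (w v) D) => //.
- apply: le_trans (_ : \sum_(x in Z) w x + \sum_(x in S :\: Z) w x <= _).
    apply: lerD.
      by rewrite mulr_natl -sumr_const; apply: ler_sum.
    apply: le_trans (_ : #|S :\: Z|%:R * w v <= _).
      rewrite ler_wpM2r // -(cardsID Z S) natrD lerBlDl lerD2r ler_nat.
      by rewrite subset_leq_card // subsetIr.
    rewrite mulr_natl -sumr_const; apply: ler_sum => x; rewrite inE => /andP[_]; exact: hS.
  rewrite [leRHS](big_setID Z) /= (setIidPr sZ) lerD2l.
  by apply: le_sum_subset => //; apply: setSD.
- apply: le_trans (le_sum_subset w0 sS).
  by rewrite mulr_natl -sumr_const; apply: ler_sum.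
Qed.

Lemma rich_weight (D1 : nat) : tile_rich G D1 -> 0 < D1%:R - 4 * (delta * m) ->
  (D1%:R - 4 * (delta * m)) * mu <= \sum_x w x.
Proof.
set D := _ - _ => rich D0.
have dm : 0 < delta * m by rewrite mulr_gt0.
have sT : \sum_x w x = \sum_(x in [set: G]) w x by apply: eq_bigl => x; rewrite inE.
have argmin (S : {set G}) : 0 < #|S|%:R :> R -> exists2 v, v \in S & forall x, x \in S -> w v <= w x.
  rewrite ltr0n => /card_gt0P[v0 v0S].
  case: (Order.TotalTheory.arg_minP w (v0S : [pred u | u \in S] v0)) => v /= vS vm.
  by exists v.
have region (T : {set G}) : (forall x, x \in T -> (D1 <= #|nbr x :&: T|)%N) -> T != set0 ->
    D / 2 * mu <= \sum_(x in T) w x.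
{ move=> hT T0.
  have cT : (D1 <= #|T|)%N.
    have /set0Pn[x xT] := T0; apply: leq_trans (hT _ xT) _; apply: subset_leq_card; exact: subsetIr.
  have cTR : D1%:R <= #|T|%:R :> R by rewrite ler_nat.
  have gT := good_le T.
  have [|v vS vmin] := argmin (T :&: good); first by apply: lt_le_trans gT; rewrite /D in D0; lra.
  have := vS; rewrite inE => /andP[vT vg].
  have sN : nbr v :&: T \subset nbr v by apply: subsetIl.
  have cN : D1%:R <= #|nbr v :&: T|%:R :> R by rewrite ler_nat hT.
  have [small|big] := leqP (2 * #|T|) (3 * D1).
  (* Two neighbourhoods of size at least [D1] inside [T] share at least [2 * D1 - #|T|] vertices,
     which is at least [D1 / 2] here. *)
  - have [||Z [sZ cZ hZ]] := @triangle_count v (nbr v :&: T) (2 * D1 - #|T|) vg sN.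
    + by rewrite /D in D0; lra.
    + move=> u; rewrite inE => /andP[_ uT].
      have := cardsUI (nbr u :&: T) (nbr v :&: T).
      have -> : nbr u :&: T :&: (nbr v :&: T) = nbr u :&: (nbr v :&: T).
        by apply/setP => x; rewrite !inE; case: (adj u x); case: (adj v x); case: (x \in T).
      have h3 : (#|nbr u :&: T :|: nbr v :&: T| <= #|T|)%N.
        by apply: subset_leq_card; rewrite subUset !subsetIr.
      by have := hT _ uT; have := hT _ vT; move: h3; clear; lia.
    + have hc : D1%:R / 2 <= (2 * D1 - #|T|)%:R :> R.
        rewrite ler_pdivrMr // -natrM ler_nat; move: small; clear; lia.
      apply: (@region_weight 1 _ v (T :&: good) Z T) => //.
      * exact: subsetIl.
      * by apply: subset_trans sZ (subsetIr _ _).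
      * by move=> z zZ; rewrite mul1r; apply: hZ.
      * by rewrite /D; move: cZ hc; lra.
      * by rewrite /D; move: gT cTR; lra.
  - have [Z [sZ cZ hZ]] := edge_count vg sN.
    apply: (@region_weight 2 _ v (T :&: good) Z T) => //.
    * exact: subsetIl.
    * by apply: subset_trans sZ (subsetIr _ _).
    * by move: D0; rewrite /D; lra.
    * have : 3 * D1%:R <= 2 * #|T|%:R :> R by rewrite -!natrM ler_nat ltnW.
      by rewrite /D; move: gT; lra. }
case: rich => [[deg codeg nv]|[deg nv]|[R1 [R2 [dR n1 n2 h1 h2]]]].
- have gT := good_le [set: G]; rewrite cardsT setTI -/(nverts G) in gT.
  have nvR : 2 * D1%:R <= m by rewrite -natrM ler_nat.
  have [|v vS vmin] := argmin good; first by apply: lt_le_trans gT; rewrite /D in D0; lra.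
  have cN : D1%:R <= #|nbr v|%:R :> R by rewrite ler_nat deg.
  have [||Z [sZ cZ hZ]] := @triangle_count v (nbr v) D1 vS (subxx _).
  + by rewrite /D in D0; lra.
  + by move=> u; rewrite in_nbr setIC => /codeg.
  rewrite sT; apply: (@region_weight 1 _ v good Z setT) => //; rewrite ?subsetT //.
  + by move=> z zZ; rewrite mul1r; apply: hZ.
  + by rewrite /D; lra.
  + by rewrite /D; lra.
- have gT := good_le [set: G]; rewrite cardsT setTI -/(nverts G) in gT.
  have nvR : 3 * D1%:R <= m by rewrite -natrM ler_nat.
  have [|v vS vmin] := argmin good; first by apply: lt_le_trans gT; rewrite /D in D0; lra.
  have cN : D1%:R <= #|nbr v|%:R :> R by rewrite ler_nat deg.
  have [Z [sZ cZ hZ]] := edge_count vS (subxx _).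
  rewrite sT; apply: (@region_weight 2 _ v good Z setT) => //; rewrite ?subsetT //.
  + by rewrite /D; lra.
  + by rewrite /D; lra.
- have r1 := region _ h1 n1; have r2 := region _ h2 n2.
  apply: le_trans (_ : \sum_(x in R1) w x + \sum_(x in R2) w x <= _).
    by move: r1 r2; lra.
  rewrite sT [leRHS](big_setID R1) /= setTI lerD2l; apply: le_sum_subset => //.
  by apply/subsetP => x xR; rewrite !inE andbT; apply/negP => x1; have /pred0P/(_ x) := dR; rewrite /= x1 xR.
Qed.
End Cheap.

(** If every triple outside [B] were too expensive for a weight of total [F > 0], then [rich_weight]
    with [mu = F / D2] would give a total above [F]. *)
Theorem rich_cheap (R : realType) (G : sgraph) (e1 e2 t1 t2 t3 D1 : nat) (delta D2 : R) :
  let rho := (t2 + t3)%N in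
  (0 < rho)%N -> (t1 <= rho)%N -> (e2 <= rho)%N -> (e1 <= 2 * rho)%N ->
  0 < delta -> delta <= 1 -> tile_rich G D1 -> 0 < D2 ->
  D2 < D1%:R - 4 * (delta * (nverts G)%:R) ->
  cheap_tiles G (size0 e1 t1) (size1 t2) (size2 e2 t3) (delta ^+ 4) (D2 / rho%:R).
Proof.
move=> rho rho0 h1 h2 h3 d0 d1 rich D20 hD w B w0 cB.
have rhoR : 0 < rho%:R :> R by rewrite ltr0n.
have m0 : 0 < (nverts G)%:R :> R.
{ rewrite ltr0n lt0n; apply/eqP => n0; move: hD; rewrite n0 mulr0 mulr0 subr0 => hD.
  have D10 : (0 < D1)%N by rewrite -(ltr0n R); apply: lt_trans hD.
  have empty (x : G) : False by have : (0 < nverts G)%N; [apply/card_gt0P; exists x|rewrite n0].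
  case: rich => [[_ _]|[_]|[R1 [_ [_ /set0Pn[x _] _ _ _]]]]; rewrite ?n0; last exact: empty x.
  - by rewrite leqn0 muln_eq0 /= => /eqP z; rewrite z in D10.
  - by rewrite leqn0 muln_eq0 /= => /eqP z; rewrite z in D10. }
have main (f : G -> R) : (forall x, 0 <= f x) -> 0 < \sum_x f x ->
  exists k x, [/\ tri (size0 e1 t1) (size1 t2) (size2 e2 t3) k x, x \notin B &
    D2 / rho%:R * cost (size0 e1 t1) (size1 t2) (size2 e2 t3) k f x <= \sum_x f x].
{ move=> f0 F0; set F := \sum_x f x in F0 *.
  case: (pickP [pred y : bool * (G * (G * G)) |
     [&& tri (size0 e1 t1) (size1 t2) (size2 e2 t3) y.1 y.2, y.2 \notin B &
      D2 / rho%:R * cost (size0 e1 t1) (size1 t2) (size2 e2 t3) y.1 f y.2 <= F]]).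
    by move=> [k x] /and3P[a b c]; exists k, x.
  move=> none; exfalso.
  have cst k x : tri (size0 e1 t1) (size1 t2) (size2 e2 t3) k x -> x \notin B ->
     rho%:R * (F / D2) <= cost (size0 e1 t1) (size1 t2) (size2 e2 t3) k f x.
  { move=> tx xB; have := none (k, x); rewrite /= tx xB /= => /negbT; rewrite -ltNge => lt.
    rewrite mulrA ler_pdivrMr //; move: lt; rewrite mulrAC ltr_pdivlMr // => lt.
    by rewrite [leLHS]mulrC [leRHS]mulrC ltW. }
  have := @rich_weight R G e1 e2 t1 t2 t3 rho0 h1 h2 h3 delta f B (F / D2) d0 d1 f0 _ cB cst m0 D1 rich.
  rewrite divr_ge0 ?(ltW F0) ?(ltW D20) // => /(_ isT (lt_trans D20 hD)).
  rewrite -/F [leLHS]mulrA ler_pdivrMr // [leLHS]mulrC ler_pM2l // => le.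
  by have := lt_le_trans hD le; rewrite ltxx. }
have [F0|F0] := leP (\sum_x w x) 0; last exact: main.
have wz x : w x = 0.
{ apply/eqP; rewrite eq_le w0 andbT; apply: le_trans F0.
  by rewrite (bigD1 x) //= lerDl sumr_ge0. }
(* For the zero weight any admissible triple outside [B] will do; the constant weight 1 supplies
   one. *)
have [||k [x [tx xB _]]] := main (fun _ => 1).
- by [].
- by rewrite sumr_const.
exists k, x; split=> //; rewrite /cost !wz !mulr0 !addr0 mulr0.
exact: sumr_ge0.
Qed.

(** * Dense host graphs *)

Local Close Scope ring_scope.

Definition robust (G : sgraph) (B : {set G}) (k : nat) : Prop :=
  forall Z : {set G}, #|Z| < k -> connected_in (B :\: Z).

Definition host (G : sgraph) (D1 k K : nat) : Prop :=
  [/\ forall x : G, D1 <= #|nbr x|, nverts G <= K * D1, robust [set: G] k &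
      tile_rich G D1].

Definition inner_deg (G : sgraph) (B : {set G}) (d : nat) : Prop :=
  forall x, x \in B -> d <= #|nbr x :&: B|.

Lemma card_setD_ge (T : finType) (A Z : {set T}) : #|A| <= #|A :\: Z| + #|Z|.
Proof. by rewrite -(cardsID Z A) addnC leq_add2l subset_leq_card // subsetIr. Qed.

(** Even after the deletion, any two remaining vertices of [B] have a common neighbour. *)
Lemma dense_robust (G : sgraph) (B : {set G}) d k :
  B != set0 -> inner_deg B d -> #|B| + 2 * k <= 2 * d -> robust B k.
Proof.
move=> /set0Pn[x0 x0B] hd le Z Zk.
have sub x : #|nbr x :&: B| <= #|B| by apply: subset_leq_card; apply: subsetIr.
have kd : k <= d by have := hd _ x0B; have := sub x0; move: le; clear; lia.
have nZ x : x \in B -> d - #|Z| <= #|(nbr x :&: B) :\: Z|.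
  by move=> xB; have := hd _ xB; have := card_setD_ge (nbr x :&: B) Z; clear; lia.
split.
  rewrite -card_gt0; have := card_setD_ge B Z; have := hd _ x0B; have := sub x0.
  by move: Zk kd; clear; lia.
move=> x y; rewrite !inE => /andP[xZ xB] /andP[yZ yB].
have : (nbr x :&: B :\: Z) :&: (nbr y :&: B :\: Z) != set0.
{ rewrite -card_gt0; have := cardsUI (nbr x :&: B :\: Z) (nbr y :&: B :\: Z).
  have : #|(nbr x :&: B :\: Z) :|: (nbr y :&: B :\: Z)| <= #|B|.
    by apply: subset_leq_card; apply/subsetP => z; rewrite !inE => /orP[] /and3P[_ _ ->].
  by have := nZ _ xB; have := nZ _ yB; move: le Zk kd; clear; lia. }
move=> /set0Pn[z]; rewrite !inE => /andP[/and3P[zZ xz zB] /and3P[_ yz _]].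
apply: (@connect_trans _ (radj (B :\: Z)) z); apply: connect1.
  by rewrite radjE !inE xZ xB zZ zB xz.
by rewrite radjE !inE zZ zB yZ yB adjC yz.
Qed.

(** [R1] is a component of [B :\: Z] for a small set [Z] that disconnects [B], and [R2] is the rest;
    a vertex loses only its neighbours in [Z]. *)
Lemma region_split (G : sgraph) (B : {set G}) d k :
  B != set0 -> inner_deg B d -> k <= d -> ~ robust B k ->
  exists R1 R2 : {set G}, [/\ [disjoint R1 & R2], R1 != set0, R2 != set0,
    R1 \subset B /\ R2 \subset B & inner_deg R1 (d - k) /\ inner_deg R2 (d - k)].
Proof.
move=> B0 hd kd nr.
have [Z [Zk nc]] : exists Z : {set G}, #|Z| < k /\ ~ connected_in (B :\: Z).
  apply: NNPP => no; apply: nr => Z Zk; apply: NNPP => nc; apply: no; by exists Z.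
have BZ0 : B :\: Z != set0.
{ have /set0Pn[x0 x0B] := B0; rewrite -card_gt0; have := card_setD_ge B Z; have := hd _ x0B.
  have : #|nbr x0 :&: B| <= #|B| by apply: subset_leq_card; apply: subsetIr.
  by move: Zk kd; clear; lia. }
have [x [y [xB yB nxy]]] := not_connected BZ0 nc.
pose R1 := [set z in B :\: Z | connect (radj (B :\: Z)) x z].
pose R2 := (B :\: Z) :\: R1.
have cl u v : u \in B :\: Z -> v \in B :\: Z -> adj u v -> (u \in R1) = (v \in R1).
{ move=> uB vB uv; rewrite !inE -!in_setD uB vB /=; apply/idP/idP => h; apply: connect_trans h _; apply: connect1.
    by rewrite radjE uB vB uv.
  by rewrite radjE uB vB adjC uv. }
have hN u (R : {set G}) : u \in B -> (nbr u :&: B) :\: Z \subset R -> d - k <= #|nbr u :&: R|.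
{ move=> uB sR; have := hd _ uB; have := card_setD_ge (nbr u :&: B) Z.
  have : #|(nbr u :&: B) :\: Z| <= #|nbr u :&: R|.
    apply: subset_leq_card; rewrite subsetI sR andbT.
    by apply/subsetP => z; rewrite !inE => /and3P[].
  by move: Zk; clear; lia. }
exists R1, R2; split.
- by apply/pred0P => z; rewrite /= [z \in R2]inE; case: (z \in R1).
- by apply/set0Pn; exists x; rewrite inE xB connect0.
- by apply/set0Pn; exists y; rewrite /R2 in_setD yB andbT /R1 inE yB.
- split; apply/subsetP => z.
    by rewrite inE => /andP[]; rewrite inE => /andP[].
  by rewrite in_setD => /andP[_]; rewrite inE => /andP[].
- split=> u uR.
  + have uB : u \in B :\: Z by move: uR; rewrite inE => /andP[].
    apply: hN; first by move: uB; rewrite inE => /andP[].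
    apply/subsetP => z; rewrite in_setD in_setI in_nbr => /andP[zZ /andP[uz zB]].
    by rewrite -(cl u z) // inE zZ.
  + have uB : u \in B :\: Z by move: uR; rewrite inE => /andP[].
    apply: hN; first by move: uB; rewrite inE => /andP[].
    apply/subsetP => z; rewrite in_setD in_setI in_nbr => /andP[zZ /andP[uz zB]].
    have zBZ : z \in B :\: Z by rewrite inE zZ.
    by rewrite in_setD zBZ andbT -(cl u z) //; move: uR; rewrite in_setD => /andP[].
Qed.

Lemma conn_transfer (H G : sgraph) (f : H -> G) (T : {set H}) :
  {in T &, forall x y, adj (f x) (f y) -> adj x y} ->
  injective f -> connected_in (f @: T) -> connected_in T.
Proof.
move=> hT fi [/set0Pn[y /imsetP[r rT yE]] h]; apply: (conn_rooted rT) => x xT.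
have /connectP[p pp lp] := h (f r) (f x) (imset_f f rT) (imset_f f xT).
elim: p r rT pp lp {y yE} => [|z p IH] r rT /=.
  by move=> _ /fi ->; apply: connect0.
move=> /andP[/and3P[_ /imsetP[z' z'T ->] rz] pp] lp.
apply: connect_trans (IH _ z'T pp lp); apply: connect1.
by rewrite radjE rT z'T hT.
Qed.

Lemma robustU (G : sgraph) (A B : {set G}) k :
  robust A k -> robust B k -> k <= #|A :&: B| -> robust (A :|: B) k.
Proof.
move=> rA rB kAB Z Zk; rewrite setDUl.
have /card_gt0P[z] : 0 < #|(A :&: B) :\: Z|.
  by have := card_setD_ge (A :&: B) Z; move: Zk kAB; clear; lia.
rewrite !inE => /and3P[zZ zA zB].
apply: (connU (a := z) (b := z)); [exact: rA|exact: rB| | |by rewrite eqxx].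
  by rewrite inE zZ zA.
by rewrite inE zZ zB.
Qed.

Lemma robust_attach (G : sgraph) (A L : {set G}) k :
  robust A k -> (forall x, x \in L -> k <= #|nbr x :&: A|) -> robust (A :|: L) k.
Proof.
move=> rA hL Z Zk; have cA := rA Z Zk; have [/set0Pn[r rAZ] _] := cA.
have sub : A :\: Z \subset (A :|: L) :\: Z by apply: setSD; apply: subsetUl.
apply: (conn_rooted (subsetP sub _ rAZ)) => x; rewrite in_setD in_setU => /andP[xZ].
have [xA _|xA /= xL] := boolP (x \in A).
  by apply: radj_sub sub _; apply: conn_connect cA rAZ _; rewrite inE xZ xA.
have /card_gt0P[z] : 0 < #|(nbr x :&: A) :\: Z|.
  by have := card_setD_ge (nbr x :&: A) Z; have := hL _ xL; move: Zk; clear; lia.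
rewrite in_setD in_setI in_nbr => /and3P[zZ xz zA].
apply: (@connect_trans _ _ z).
  by apply: radj_sub sub _; apply: conn_connect cA rAZ _; rewrite inE zZ zA.
by apply: connect1; rewrite radjE !inE zZ zA xZ xL orbT /= adjC.
Qed.

Lemma val_setD (T : finType) (S : {set T}) (Z : {set {x : T | x \in S}}) :
  val @: ([set: {x : T | x \in S}] :\: Z) = S :\: (val @: Z).
Proof.
apply/setP => x; rewrite in_setD; apply/imsetP/andP => [[y]|[xZ xS]].
  rewrite !inE andbT => yZ ->; split; last exact: valP.
  by rewrite (mem_imset _ _ val_inj).
exists (Sub x xS); last by rewrite SubK.
by rewrite !inE andbT; apply: contra xZ => h; apply/imsetP; exists (Sub x xS).
Qed.

Lemma robust_induced (G : sgraph) (S : {set G}) k :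
  robust S k -> robust [set: induced S] k.
Proof.
move=> rS Z Zk; apply: (@conn_transfer (induced S) G val).
- by move=> x y _ _.
- exact: val_inj.
- by rewrite val_setD; apply: rS; rewrite card_imset //; apply: val_inj.
Qed.

Lemma nbr_induced (G : sgraph) (S : {set G}) (x : induced S) :
  #|nbr x| = #|nbr (val x) :&: S|.
Proof.
rewrite -(card_imset _ val_inj); apply: eq_card => y; rewrite !inE.
apply/imsetP/idP => [[z]|/andP[xy yS]].
  by rewrite inE => xz ->; rewrite (valP z) andbT.
by exists (Sub y yS); rewrite ?inE // SubK.
Qed.

Definition two_regions (G : sgraph) (d k N : nat) : Prop :=
  exists R1 R2 : {set G}, [/\ [disjoint R1 & R2],
    [/\ R1 != set0, inner_deg R1 d, robust R1 k & #|R1| <= N] &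
    [/\ R2 != set0, inner_deg R2 d, robust R2 k & #|R2| <= N]].

(** * Contracting the connectors between two regions *)

Section Linked.
Variables (G : sgraph) (R1 R2 I : {set G}) (a b : G -> G) (C : G -> {set G}).
Hypothesis dR : [disjoint R1 & R2].
Hypothesis hC : forall i, i \in I -> connector R1 R2 (a i) (b i) (C i).
Hypothesis dC : forall i j z, i \in I -> j \in I -> z \in C i -> z \in C j -> i = j.
Hypothesis bI : forall i j, i \in I -> j \in I -> b i = b j -> i = j.

Let nb x : x \in R1 -> x \in R2 -> False := @not_both G R1 R2 dR x.

Lemma a_in i : i \in I -> a i \in C i /\ a i \in R1.
Proof.
by move=> /hC[_ h _ _ _]; have : a i \in C i :&: R1; [rewrite h inE|rewrite inE => /andP].
Qed.

Lemma b_in i : i \in I -> b i \in R2.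
Proof. by move=> /hC[]. Qed.

(* The two regions, joined by contracting each connector to an edge. *)
Definition ladj0 (x y : G) : bool :=
  [|| [&& x \in R1, y \in R1 & adj x y], [&& x \in R2, y \in R2 & adj x y],
      [exists i in I, (x == a i) && (y == b i)] | [exists i in I, (y == a i) && (x == b i)]].

Definition ladj : rel {x : G | x \in R1 :|: R2} := fun x y => ladj0 (val x) (val y).

Lemma ladj_sym : symmetric ladj.
Proof.
have aux (p q p' q' r u v : bool) : [|| [&& p, q & r], [&& p', q' & r], u | v] =
    [|| [&& q, p & r], [&& q', p' & r], v | u].
  by case: p; case: q; case: p'; case: q'; case: r; case: u; case: v.
by move=> x y; rewrite /ladj /ladj0 adjC; apply: aux.
Qed.

Lemma ladj_irrefl : irreflexive ladj.
Proof.
move=> x; rewrite /ladj /ladj0 adjxx !andbF !orFb orbb; apply/existsP => -[i /and3P[iI /eqP e1 /eqP e2]].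
by apply: (nb (x := val x)); [rewrite e1; have [] := a_in iI|rewrite e2 b_in].
Qed.

Definition lgraph : sgraph := SGraph ladj_sym ladj_irrefl.

(** The connector of [i] becomes the bag of [a i]; all other bags are single vertices. *)
Lemma lgraph_minor : minor lgraph G.
Proof.
pose bag (x : lgraph) : {set G} :=
  if [pick i in I | a i == val x] is Some i then C i else [set val x].
have bagP x : (exists2 i, i \in I & a i = val x /\ bag x = C i) \/ bag x = [set val x].
  rewrite /bag; case: pickP => [i /andP[iI /eqP e]|_]; last by right.
  by left; exists i.
have x_in x : val x \in bag x.
{ case: (bagP x) => [[i iI [e ->]]|->]; last by rewrite inE.
  by rewrite -e; have [] := a_in iI. }
have bag_R x z : z \in bag x -> z \in R1 :|: R2 -> z = val x.
{ case: (bagP x) => [[i iI [e ->]]|->]; last by rewrite inE => /eqP.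
  have [_ h1 h2 _ _] := hC iI; rewrite inE => zC /orP[zR|zR].
    by have : z \in C i :&: R1; [rewrite inE zC|rewrite h1 inE e => /eqP].
  by have : z \in C i :&: R2; [rewrite inE zC|rewrite h2 inE]. }
have bag_a i x : i \in I -> val x = a i -> bag x = C i.
{ move=> iI e; rewrite /bag; case: pickP => [j /andP[jI /eqP ej]|/(_ i)]; last by rewrite iI e eqxx.
  congr C; apply: (dC (z := a i)) => //; last by have [] := a_in iI.
  by rewrite -e -ej; have [] := a_in jI. }
exists bag; split.
- move=> x; case: (bagP x) => [[i iI [_ ->]]|->]; last exact: conn1.
  by have [] := hC iI.
- move=> x y xy; apply/pred0P => z /=; apply/negP => /andP[zx zy]; move/eqP: xy; apply.
  case: (bagP x) => [[i iI [ex Ex]]|Ex]; last first.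
    move: zx; rewrite Ex inE => /eqP ez; apply: val_inj; rewrite -ez; apply: (bag_R y z zy).
    by rewrite ez; apply: valP.
  case: (bagP y) => [[j jI [ey Ey]]|Ey]; last first.
    move: zy; rewrite Ey inE => /eqP ez; apply: val_inj; rewrite -ez; apply/esym; apply: (bag_R x z zx).
    by rewrite ez; apply: valP.
  by apply: val_inj; rewrite -ex -ey (dC (i := i) (j := j) (z := z)) // -?Ex -?Ey.
- have key x y i : i \in I -> val x = a i -> val y = b i ->
    exists u v : G, [/\ u \in bag x, v \in bag y & adj u v].
  { move=> iI ex ey; have [_ _ _ _ [c cC cb]] := hC iI.
    by exists c, (b i); rewrite (bag_a i) // -{1}ey; split. }
  move=> x y /or4P[/and3P[_ _ h]|/and3P[_ _ h]|/existsP[i /and3P[iI /eqP ex /eqP ey]]|/existsP[i /and3P[iI /eqP ey /eqP ex]]].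
  + by exists (val x), (val y).
  + by exists (val x), (val y).
  + exact: key iI ex ey.
  + by have [u [v [h1 h2 h3]]] := key y x i iI ey ex; exists v, u; rewrite adjC.
Qed.

Lemma lgraph_nbr (R : {set G}) (x : lgraph) : R = R1 \/ R = R2 -> val x \in R ->
  #|nbr (val x) :&: R| <= #|nbr x :&: [set y : lgraph | val y \in R]|.
Proof.
move=> hR xR; rewrite -(card_imset (nbr x :&: _) val_inj); apply: subset_leq_card.
apply/subsetP => y; rewrite inE in_nbr => /andP[xy yR].
have yU : y \in R1 :|: R2 by rewrite inE; case: hR => hR; rewrite -hR yR ?orbT.
apply/imsetP; exists (Sub y yU); last by rewrite SubK.
rewrite !inE SubK yR andbT /= /ladj /ladj0 SubK.
by case: hR xR yR => -> xR yR; rewrite xR yR xy ?orbT.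
Qed.

(** The connectors have distinct ends, so fewer than [k] deleted vertices leave some connector with
    both ends, and it joins what remains of the two robust regions. *)
Lemma lgraph_robust k : #|I| = k -> robust R1 k -> robust R2 k -> robust [set: lgraph] k.
Proof.
move=> cI r1 r2 Z Zk.
pose T (R : {set G}) := [set y : lgraph | (val y \in R) && (y \notin Z)].
have conT (R : {set G}) : R = R1 \/ R = R2 -> robust R k -> connected_in (T R).
{ move=> hR rR; apply: (@conn_transfer lgraph G val).
  - move=> x y; rewrite !inE => /andP[xR _] /andP[yR _] xy.
    by rewrite /= /ladj /ladj0 xy; case: hR xR yR => -> xR yR; rewrite xR yR ?orbT.
  - exact: val_inj.
  - have -> : val @: T R = R :\: (val @: Z); last by apply: rR; rewrite card_imset //; apply: val_inj.
    apply/setP => y; rewrite in_setD; apply/imsetP/andP => [[x]|[yZ yR]].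
      by rewrite inE => /andP[xR xZ] ->; rewrite (mem_imset _ _ val_inj).
    have yU : y \in R1 :|: R2 by rewrite inE; case: hR => hR; rewrite -hR yR ?orbT.
    exists (Sub y yU); last by rewrite SubK.
    by rewrite inE SubK yR /=; apply: contra yZ => h; apply/imsetP; exists (Sub y yU). }
have [i iI [aZ bZ]] : exists2 i, i \in I & a i \notin val @: Z /\ b i \notin val @: Z.
{ apply: NNPP => no.
  pose f i := if a i \in val @: Z then a i else b i.
  have fZ : f @: I \subset val @: Z.
    apply/subsetP => z /imsetP[i iI ->]; rewrite /f; case: ifP => // /negbT h.
    by apply/negPn/negP => h2; apply: no; exists i.
  have fi : {in I &, injective f}.
  { move=> i j iI jI; have [a1 a2] := a_in iI; have [a3 a4] := a_in jI.
    have b1 := b_in iI; have b2 := b_in jI.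
    rewrite /f; case: ifP => _; case: ifP => _ e.
    - by apply: (dC (z := a i)) => //; rewrite e.
    - by exfalso; apply: (nb (x := a i)) => //; rewrite e.
    - by exfalso; apply: (nb (x := a j)) => //; rewrite -e.
    - exact: bI. }
  have := subset_leq_card fZ; rewrite card_in_imset // card_imset; last exact: val_inj.
  by rewrite cI leqNgt Zk. }
have [a1 a2] := a_in iI; have b1 := b_in iI.
have aU : a i \in R1 :|: R2 by rewrite inE a2.
have bU : b i \in R1 :|: R2 by rewrite inE b1 orbT.
have -> : [set: lgraph] :\: Z = T R1 :|: T R2.
  by apply/setP => x; rewrite !inE andbT -andb_orl; have := valP x; rewrite !inE => ->.
have nZ y (yU : y \in R1 :|: R2) : y \notin val @: Z -> (Sub y yU : lgraph) \notin Z.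
  by apply: contra => h; apply/imsetP; exists (Sub y yU).
pose ai : lgraph := Sub (a i) aU; pose bi : lgraph := Sub (b i) bU.
apply: (@connU lgraph _ _ ai bi).
- by apply: conT => //; left.
- by apply: conT => //; right.
- by rewrite inE SubK a2 nZ.
- by rewrite inE SubK b1 nZ.
- apply/orP; right; rewrite /= /ladj /ladj0 !SubK; apply/or4P; constructor 3.
  by apply/existsP; exists i; rewrite iI !eqxx.
Qed.
End Linked.

Lemma two_regions_host (G : sgraph) (d k N K : nat) :
  (forall Z : {set G}, #|Z| < k -> connected_in (~: Z)) -> k <= d ->
  two_regions G d k N -> 2 * N <= K * d ->
  exists H : sgraph, minor H G /\ host H d k K.
Proof.
move=> hG kd [R1 [R2 [dR [n1 d1 r1 c1] [n2 d2 r2 c2]]]] NK.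
have big (R : {set G}) : R != set0 -> inner_deg R d -> k <= #|R|.
  move=> /set0Pn[x xR] hR; apply: leq_trans kd _; apply: leq_trans (hR _ xR) _.
  by apply: subset_leq_card; apply: subsetIr.
have [I [a [b [C [cI hC dC bI]]]]] := connectors_exist dR (big _ n1 d1) (big _ n2 d2) hG.
pose H := lgraph dR hC.
have inn (R : {set G}) : R = R1 \/ R = R2 -> inner_deg R d ->
   forall x : H, x \in [set y : H | val y \in R] -> d <= #|nbr x :&: [set y : H | val y \in R]|.
  by move=> hR dd x; rewrite inE => xR; apply: leq_trans (dd _ xR) _; apply: lgraph_nbr.
have i1 := inn _ (or_introl erefl) d1; have i2 := inn _ (or_intror erefl) d2.
exists H; split; first exact: lgraph_minor.
split.
- move=> x; have := valP x; rewrite inE => /orP[xR|xR].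
    by apply: leq_trans (i1 x _) _; rewrite ?inE // subset_leq_card // subsetIl.
  by apply: leq_trans (i2 x _) _; rewrite ?inE // subset_leq_card // subsetIl.
- apply: leq_trans NK; have -> : nverts H = #|R1 :|: R2|.
    by rewrite /nverts /= card_sig; apply: eq_card => x; rewrite inE.
  by have [h _] := leq_card_setU R1 R2; move: h c1 c2; clear; lia.
- exact: lgraph_robust.
- apply: Or33; exists [set y : H | val y \in R1], [set y : H | val y \in R2]; split=> //.
  + apply/pred0P => x /=; rewrite !inE; apply/negP => /andP[h1 h2].
    exact: (not_both dR h1 h2).
  + have /set0Pn[x xR] := n1; have xU : x \in R1 :|: R2 by rewrite inE xR.
    by apply/set0Pn; exists (Sub x xU); rewrite inE SubK.
  + have /set0Pn[x xR] := n2; have xU : x \in R1 :|: R2 by rewrite inE xR orbT.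
    by apply/set0Pn; exists (Sub x xU); rewrite inE SubK.
Qed.

(** * Hosts inside minor-minimal graphs *)

Section Large.
Variables (G : sgraph) (D p q : nat).
Hypothesis p0 : 0 < p.
Hypothesis pD : 9 * p <= D.
Hypothesis Dq : D <= q * p.
Hypothesis deg : forall x : G, D < #|nbr x|.
Hypothesis codeg : forall x y : G, adj x y -> D <= #|nbr x :&: nbr y|.
Hypothesis conn : forall Z : {set G}, #|Z| < p -> connected_in (~: Z).

(* Since [arcs G] is about [2 D v(G)], not all degrees exceed [2 D + p]. *)
Definition lows : {set G} := [set x | #|nbr x| <= 2 * D + p].

(** Otherwise almost every vertex would exceed the degree [2 * D] by more than [p]; for large order
    this surplus outweighs what fewer than [3 * D] other vertices can lack. *)
Lemma card_lows : arcs G <= 2 * D * nverts G + 2 -> 20 * q * D < nverts G -> 3 * D <= #|lows|.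
Proof.
move=> aG big; rewrite leqNgt; apply/negP => lt.
have h1 : #|~: lows| * (2 * D + p + 1) <= arcs G.
{ rewrite -sum_nat_const /arcs [leqRHS](bigID (mem (~: lows))) /=.
  apply: leq_trans (leq_addr _ _); apply: leq_sum => x.
  by rewrite !inE -ltnNge addn1. }
have h2 : #|lows| + #|~: lows| = nverts G by rewrite cardsC.
have h3 : (nverts G - 3 * D) * (2 * D + p + 1) <= 2 * D * nverts G + 2.
  by apply: leq_trans aG; apply: leq_trans h1; rewrite leq_mul2r; move: lt h2; clear; lia.
move: h3 big pD Dq p0; move: (nverts G) => v; clear => h3 big pD Dq p0.
have h4 : v * p <= 3 * D * (2 * D + p + 1) + 2 by nia.
have h5 : 3 * D * (2 * D + p + 1) + 2 <= 10 * D * D by nia.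
have h6 : 20 * q * D * p <= v * p by rewrite leq_mul2r (ltnW big) orbT.
have h7 : 20 * D * D <= 20 * q * D * p by nia.
nia.
Qed.

Lemma nbr_inner (v : G) : inner_deg (nbr v) D.
Proof. by move=> x; rewrite in_nbr setIC => /codeg. Qed.

Lemma nbr_neq0 (v : G) : nbr v != set0.
Proof. by rewrite -card_gt0; apply: leq_ltn_trans (deg v). Qed.

Lemma inner_le (B : {set G}) d : B != set0 -> inner_deg B d -> d <= #|B|.
Proof.
by move=> /set0Pn[x xB] h; apply: leq_trans (h x xB) _; apply: subset_leq_card; apply: subsetIr.
Qed.

Lemma inner_mono (B : {set G}) d d' : d' <= d -> inner_deg B d -> inner_deg B d'.
Proof. by move=> le h x xB; apply: leq_trans le (h x xB). Qed.

(** Each of the two regions has at least [D - 2 * p] vertices, hence the other at most [D + 3 * p].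
    So [dense_robust] applies to both, by [9 * p <= D]. *)
Lemma split_two (B : {set G}) : B != set0 -> inner_deg B (D - p) -> #|B| <= 2 * D + p ->
  ~ robust B p -> two_regions G (D - 2 * p) p (2 * D + p).
Proof.
move=> B0 hB cB nr.
have [|R1 [R2 [dR n1 n2 [s1 s2] [d1 d2]]]] := region_split B0 hB _ nr.
  by move: pD p0; clear; lia.
have e : D - p - p = D - 2 * p by clear; lia.
rewrite e in d1 d2.
have c1 := inner_le n1 d1; have c2 := inner_le n2 d2.
have sum : #|R1| + #|R2| <= #|B|.
  by rewrite -cardsUI (_ : R1 :&: R2 = set0) ?cards0 ?addn0 ?subset_leq_card ?subUset ?s1 //; apply/eqP; rewrite setI_eq0.
exists R1, R2; split=> //; split=> //.
- by apply: dense_robust n1 d1 _; move: sum cB c2 pD; clear; lia.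
- by move: sum cB c2 pD; clear; lia.
- by apply: dense_robust n2 d2 _; move: sum cB c1 pD; clear; lia.
- by move: sum cB c1 pD; clear; lia.
Qed.

(** If two low neighbourhoods overlap in fewer than [p] vertices, then [nbr v] and [nbr u :\: nbr v]
    are the two regions, unless the latter is not robust and splits into two regions itself. *)
Lemma regions_or_overlap : two_regions G (D - 2 * p) p (2 * D + p) \/
  (forall v, v \in lows -> robust (nbr v) p) /\
  (forall v u, v \in lows -> u \in lows -> p <= #|nbr v :&: nbr u|).
Proof.
case: (classic (forall v, v \in lows -> robust (nbr v) p)) => [rob|nr]; last first.
{ left; have [v [vL nv]] : exists v, v \in lows /\ ~ robust (nbr v) p.
    apply: NNPP => no; apply: nr => v vL; apply: NNPP => nv; by apply: no; exists v.
  apply: split_two nv; first exact: nbr_neq0.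
    by apply: (inner_mono (leq_subr _ _)); apply: nbr_inner.
  by move: vL; rewrite inE. }
case: (classic (forall v u, v \in lows -> u \in lows -> p <= #|nbr v :&: nbr u|)) => [ov|nov]; first by right.
left; have [v [u [vL uL lt]]] : exists v u, [/\ v \in lows, u \in lows & #|nbr v :&: nbr u| < p].
{ apply: NNPP => no; apply: nov => v u vL uL; rewrite leqNgt; apply/negP => lt.
  by apply: no; exists v, u. }
pose R2 := nbr u :\: nbr v.
have cv : #|nbr v| <= 2 * D + p by move: vL; rewrite inE.
have cu : #|nbr u| <= 2 * D + p by move: uL; rewrite inE.
have cR2 : #|R2| <= 2 * D + p by apply: leq_trans cu; apply: subset_leq_card; apply: subsetDl.
have R20 : R2 != set0.
{ rewrite -card_gt0 /R2 cardsD setIC; have := deg u; move: lt pD p0; clear; lia. }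
have i2 : inner_deg R2 (D - p).
{ move=> x; rewrite inE => /andP[_ xu]; have := nbr_inner xu.
  have := card_setD_ge (nbr x :&: nbr u) (nbr v :&: nbr u).
  have : #|(nbr x :&: nbr u) :\: (nbr v :&: nbr u)| <= #|nbr x :&: R2|.
    apply: subset_leq_card; apply/subsetP => z; rewrite !inE.
    by case: (adj v z); case: (adj u z); case: (adj x z).
  by move: lt; clear; lia. }
case: (classic (robust R2 p)) => [r2|]; last exact: split_two.
exists (nbr v), R2; split.
- by apply/pred0P => z; rewrite /= /R2 [z \in _ :\: _]inE; case: (z \in nbr v).
- split=> //; [exact: nbr_neq0| |exact: rob].
  by apply: (inner_mono (leq_subr _ _)); apply: nbr_inner.
- split=> //; apply: inner_mono i2; clear; lia.
Qed.

(* Greedy choice: either the neighbourhoods grow by [p] at every step, or they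
   soon cover almost all of every neighbourhood of a low-degree vertex. *)
Lemma cover_or_spread j :
  (exists s : seq G, [/\ all (mem lows) s, size s <= j &
     forall v, v \in lows -> #|nbr v :\: \bigcup_(u <- s) nbr u| < p]) \/
  (exists s : seq G, [/\ all (mem lows) s, size s <= j & j * p <= #|\bigcup_(u <- s) nbr u|]).
Proof.
elim: j => [|j [[s [sL sj hs]]|[s [sL sj hs]]]].
- by right; exists [::].
- by left; exists s; split=> //; apply: leq_trans sj (leqnSn _).
case: (classic (exists2 v, v \in lows & p <= #|nbr v :\: \bigcup_(u <- s) nbr u|)) => [[v vL hv]|no].
- right; exists (v :: s); split=> //=; first by rewrite vL.
  set Y := \bigcup_(u <- s) nbr u in hs hv *; rewrite big_cons -/Y.
  have : #|nbr v :|: Y| = #|nbr v :\: Y| + #|Y|.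
    by rewrite -(cardsID Y (nbr v :|: Y)) setDUl setDv setU0 addnC setIC setKU.
  by move=> ->; rewrite mulSn leq_add.
- left; exists s; split=> //; first by apply: leq_trans sj (leqnSn _).
  by move=> v vL; rewrite ltnNge; apply/negP => h; apply: no; exists v.
Qed.

Lemma robust_union (s : seq G) :
  (forall v, v \in lows -> robust (nbr v) p) ->
  (forall v u, v \in lows -> u \in lows -> p <= #|nbr v :&: nbr u|) ->
  all (mem lows) s -> s != [::] -> robust (\bigcup_(u <- s) nbr u) p.
Proof.
move=> rob ov; elim: s => // v [|u s] IH /= /andP[vL sL] _.
  by rewrite big_seq1; apply: rob.
rewrite big_cons; apply: robustU; [exact: rob|exact: IH|].
have uL : u \in lows by case/andP: sL.
apply: leq_trans (ov v u vL uL) _; apply: subset_leq_card; apply: setIS.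
by rewrite big_cons subsetUl.
Qed.

Lemma card_union (s : seq G) : all (mem lows) s ->
  #|\bigcup_(u <- s) nbr u| <= size s * (2 * D + p).
Proof.
elim: s => [_|v s IH /= /andP[vL sL]]; first by rewrite big_nil cards0.
rewrite big_cons mulSn; have [h _] := leq_card_setU (nbr v) (\bigcup_(u <- s) nbr u).
apply: leq_trans h _; apply: leq_add (IH sL).
by move: vL; rewrite inE.
Qed.

Lemma union_inner (s : seq G) x : x \in \bigcup_(u <- s) nbr u ->
  D <= #|nbr x :&: \bigcup_(u <- s) nbr u|.
Proof.
move=> xs; have [v vs xv] : exists2 v, v \in s & x \in nbr v.
  elim: s xs => [|v s IH]; first by rewrite big_nil inE.
  rewrite big_cons in_setU => /orP[h|/IH[w ws xw]]; first by exists v => //; rewrite inE eqxx.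
  by exists w => //; rewrite inE ws orbT.
apply: leq_trans (nbr_inner xv) _; apply: subset_leq_card; apply: setIS.
elim: s vs {xs} => // w s IH; rewrite inE big_cons => /orP[/eqP <-|/IH h].
  exact: subsetUl.
exact: subset_trans h (subsetUr _ _).
Qed.

Lemma large_host : arcs G <= 2 * D * nverts G + 2 -> 20 * q * D < nverts G ->
  exists H : sgraph, minor H G /\ host H (D - 2 * p) p (20 * q + 20).
Proof.
move=> aG big; have cL := card_lows aG big.
have D0 : 0 < D by move: pD p0; clear; lia.
have q0 : 0 < q by rewrite lt0n; apply/eqP => e; move: Dq D0; rewrite e; clear; lia.
case: regions_or_overlap => [two|[rob ov]].
{ apply: two_regions_host conn _ two _; first by move: pD p0; clear; lia.
  have h1 : 2 * (2 * D + p) <= 20 * (D - 2 * p) by move: pD p0; clear; lia.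
  by apply: leq_trans h1 _; rewrite leq_mul2r; apply/orP; right; rewrite leq_addl. }
have [v0 v0L] : exists v0, v0 \in lows by apply/card_gt0P; move: cL D0; clear; lia.
have fin (S : {set G}) : robust S p -> (forall x, x \in S -> D - p <= #|nbr x :&: S|) ->
    3 * D <= #|S| -> #|S| <= 3 * q * (2 * D + p) + 3 * D ->
    exists H : sgraph, minor H G /\ host H (D - 2 * p) p (20 * q + 20).
{ move=> rS dS lo hi; exists (induced S); split; first exact: induced_minor.
  have dd (x : induced S) : D - 2 * p <= #|nbr x|.
    rewrite nbr_induced; apply: leq_trans (dS _ (valP x)); clear; lia.
  split=> //; last 1 first.
  - apply: Or32; split=> //; rewrite nverts_induced; apply: leq_trans lo; clear; lia.
  - rewrite nverts_induced; apply: leq_trans hi _.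
    have h1 : 2 * D + p <= 6 * (D - 2 * p) by move: pD; clear; lia.
    have h2 : 3 * D <= 20 * (D - 2 * p) by move: pD; clear; lia.
    rewrite mulnDl; apply: leq_add h2.
    apply: leq_trans (_ : 3 * q * (6 * (D - 2 * p)) <= _); first by rewrite leq_mul2l h1 orbT.
    rewrite mulnA leq_mul2r; apply/orP; right; clear; lia.
  - exact: robust_induced. }
have q3 : 3 * D <= 3 * q * p by rewrite -mulnA leq_mul2l Dq orbT.
case: (cover_or_spread (3 * q)) => [[s [sL ss hs]]|[s [sL ss hs]]].
- set Y := \bigcup_(u <- s) nbr u in hs.
  have s0 : s != [::].
    apply/eqP => e; have := hs v0 v0L; rewrite /Y e big_nil setD0 => lt.
    by have := deg v0; move: lt pD; clear; lia.
  have [L' [sL' cL']] := subset_of_card cL.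
  have hY x : x \in L' -> D - p <= #|nbr x :&: Y|.
  { move=> xL; have := hs x (subsetP sL' _ xL); have := deg x.
    by have := cardsID Y (nbr x); clear; lia. }
  have [cYL _] := leq_card_setU Y L'.
  have cY : #|Y| <= 3 * q * (2 * D + p).
    by apply: leq_trans (card_union sL) _; rewrite leq_mul2r ss orbT.
  apply: (fin (Y :|: L')).
  + apply: robust_attach; first exact: robust_union.
    move=> x /hY h; apply: leq_trans h; move: pD; clear; lia.
  + move=> x; rewrite inE => /orP[xY|xL].
      apply: leq_trans (leq_subr _ _) _; apply: leq_trans (union_inner xY) _.
      by apply: subset_leq_card; apply: setIS; apply: subsetUl.
    by apply: leq_trans (hY _ xL) _; apply: subset_leq_card; apply: setIS; apply: subsetUl.
  + by rewrite -cL'; apply: subset_leq_card; apply: subsetUr.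
  + by apply: leq_trans cYL _; rewrite cL' leq_add2r.
- set Y := \bigcup_(u <- s) nbr u in hs.
  have s0 : s != [::].
    apply/eqP => e; move: hs; rewrite /Y e big_nil cards0 => h.
    by move: h q3 D0; clear; lia.
  apply: (fin Y).
  + exact: robust_union.
  + by move=> x xY; apply: leq_trans (leq_subr _ _) (union_inner xY).
  + exact: leq_trans q3 hs.
  + apply: leq_trans (card_union sL) _; apply: leq_trans (leq_addr _ _).
    by rewrite leq_mul2r ss orbT.
Qed.

(** A graph that is not large is its own host, by the first alternative of [tile_rich]. *)
Theorem host_exists : arcs G <= 2 * D * nverts G + 2 -> 2 * D <= nverts G + 2 * p ->
  exists H : sgraph, minor H G /\ host H (D - 2 * p) p (40 * q + 20).
Proof.
move=> aG vG; have [big|small] := ltnP (20 * q * D) (nverts G).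
  have [H [mH [h1 h2 h3 h4]]] := large_host aG big.
  exists H; split=> //; split=> //; apply: leq_trans h2 _.
  by rewrite leq_mul2r; apply/orP; right; rewrite leq_add2r leq_mul2r orbT.
exists G; split; first by apply: subgraph_minor; exists id; split=> // x y.
split.
- by move=> x; apply: leq_trans (leq_subr _ _) (ltnW (deg x)).
- apply: leq_trans small _; rewrite mulnDl; apply: leq_trans (leq_addr _ _).
  have h : D <= 2 * (D - 2 * p) by move: pD; clear; lia.
  apply: leq_trans (_ : 20 * q * (2 * (D - 2 * p)) <= _); first by rewrite leq_mul2l h orbT.
  by rewrite mulnA leq_mul2r; apply/orP; right; clear; lia.
- by move=> Z Zp; rewrite setTD; apply: conn.
- apply: Or31; split.
  + by move=> x; apply: leq_trans (leq_subr _ _) (ltnW (deg x)).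
  + by move=> x y xy; apply: leq_trans (leq_subr _ _) (codeg xy).
  + by move: vG; clear; lia.
Qed.
End Large.

(** * Embedding grouped graphs into a host *)

Lemma path_connected (G : sgraph) (B : {set G}) (a : G) (p : seq G) :
  path (radj B) a p -> connected_in [set x in a :: p].
Proof.
elim/last_ind: p => [_|p z IH].
  have -> : [set x in [:: a]] = [set a] by apply/setP => x; rewrite !inE.
  exact: conn1.
rewrite rcons_path => /andP[pp /and3P[_ _ az]].
have -> : [set x in a :: rcons p z] = z |: [set x in a :: p].
  by apply/setP => x; rewrite !inE mem_rcons inE orbCA.
by apply: conn_add (IH pp) _ az; rewrite inE mem_last.
Qed.

Lemma disjoint_family_card (T : finType) (A : {set T}) (n c : nat) (S : nat -> {set T}) :
  (forall i j, i < n -> j < n -> i != j -> [disjoint S i & S j]) ->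
  (forall i, i < n -> S i \subset A) -> (forall i, i < n -> c <= #|S i|) -> n * c <= #|A|.
Proof.
elim: n A => // n IH A dS sS cS.
have h : n * c <= #|A :\: S n|.
{ apply: IH.
  - by move=> i j lti ltj; apply: dS; apply: ltnW.
  - move=> i lti; rewrite subsetD (sS i (leqW lti)) /=.
    by apply: dS => //; [exact: leqW|rewrite neq_ltn lti].
  - by move=> i lti; apply: cS; apply: ltnW. }
rewrite mulSn -(cardsID (S n) A); apply: leq_add => //.
by have /setIidPr -> := sS n (ltnSn n); apply: cS.
Qed.

Section Connect.
Variables (G : sgraph) (D1 k K : nat).
Hypothesis hG : host G D1 k K.
Hypothesis D10 : 0 < D1.

Definition plen := 6 * K.

(** On a shortest path outside [Z], vertices at distance 3 or more have no common neighbour outside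
    [Z]. Every third vertex thus contributes a disjoint set of at least [D1 / 2] vertices among at
    most [K * D1], which leaves room for [2 * K] such sets and [6 * K] vertices on the path. *)
Lemma short_path (Z : {set G}) (a b : G) : #|Z| < k -> 2 * #|Z| <= D1 ->
  a \notin Z -> b \notin Z ->
  exists C : {set G}, [/\ connected_in C, a \in C, b \in C, [disjoint C & Z] & #|C| <= plen].
Proof.
move=> Zk ZD aZ bZ; have [deg size_G rob _] := hG.
pose r := radj ([set: G] :\: Z).
have cab : connect r a b by apply: conn_connect (rob Z Zk) _ _; rewrite !inE ?aZ ?bZ.
pose P n := [exists p : n.-tuple G, path r a p && (last a p == b)].
have exP : exists n, P n.
  have /connectP[p pp lp] := cab; exists (size p); apply/existsP.
  by exists (in_tuple p); rewrite /= pp -lp eqxx.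
case: (ex_minnP exP) => n /existsP[[p /= /eqP sp] /andP[/= pp /eqP lp]] minn.
have xZ i : i <= n -> nth a (a :: p) i \notin Z.
{ have : all (fun x => x \notin Z) (a :: p).
    rewrite /= aZ /=; clear -pp; elim: p a pp => //= y p IH a /andP[/and3P[_ yZ _] pp].
    by move: yZ; rewrite !inE andbT => ->; rewrite /= (IH y).
  by move=> /(all_nthP a) h lei; apply: h; rewrite /= sp ltnS. }
have apart i j z : i + 3 <= j -> j <= n -> z \notin Z -> adj (nth a (a :: p) i) z ->
    adj (nth a (a :: p) j) z -> False.
{ move=> ij jn zZ iz jz.
  have j0 : 0 < j by move: ij; clear; lia.
  have ei : last a (take i p) = nth a (a :: p) i.
    rewrite (last_nth a) size_takel; last by rewrite sp; move: ij jn; clear; lia.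
    by rewrite -[a :: take i p]/(take i.+1 (a :: p)) nth_take.
  have dj : drop j.-1 p = nth a (a :: p) j :: drop j p.
    by rewrite (drop_nth a) ?prednK ?sp // -{2}(prednK j0) /= ; case: (j) j0.
  (* The detour through [z] replaces at least three edges by two. *)
  have pth : path r a (take i p ++ z :: nth a (a :: p) j :: drop j p).
  { move: (pp); rewrite -{1}(cat_take_drop i p) cat_path => /andP[p1 _].
    move: (pp); rewrite -{1}(cat_take_drop j.-1 p) cat_path dj /= => /andP[_ /andP[_ p2]].
    rewrite cat_path p1 /= ei p2 andbT /r !radjE !inE zZ !xZ //; last by move: ij jn; clear; lia.
    by rewrite iz adjC jz. }
  have lst : last a (take i p ++ z :: nth a (a :: p) j :: drop j p) = b.
    by rewrite last_cat /= -lp -{3}(cat_take_drop j.-1 p) last_cat dj.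
  have szz : size (take i p ++ z :: nth a (a :: p) j :: drop j p) = i + (n - j).+2.
    by rewrite size_cat /= size_drop sp size_takel // sp; move: ij jn; clear; lia.
  have : n <= i + (n - j).+2.
    apply: minn; apply/existsP.
    have sz2 : size (take i p ++ z :: nth a (a :: p) j :: drop j p) == i + (n - j).+2 by rewrite szz.
    by exists (Tuple sz2); rewrite /= pth lst eqxx.
  by move: ij jn; clear; lia. }
have cnt : (n %/ 3).+1 * (D1 - #|Z|) <= #|[set: G]|.
{ apply: (@disjoint_family_card _ _ _ _ (fun t => nbr (nth a (a :: p) (3 * t)) :\: Z)).
  - move=> i j lti ltj ne; apply/pred0P => z /=; rewrite !inE; apply/negP => /andP[/andP[zZ iz] /andP[_ jz]].
    have hi : 3 * i <= n by rewrite ltnS leq_divRL // mulnC in lti.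
    have hj : 3 * j <= n by rewrite ltnS leq_divRL // mulnC in ltj.
    move: ne; rewrite neq_ltn => /orP[lt|lt].
      by apply: (apart (3 * i) (3 * j) z) => //; move: lt; clear; lia.
    by apply: (apart (3 * j) (3 * i) z) => //; move: lt; clear; lia.
  - by move=> i _; apply: subsetT.
  - move=> i _; have := deg (nth a (a :: p) (3 * i)); have := card_setD_ge (nbr (nth a (a :: p) (3 * i))) Z.
    by clear; lia. }
exists [set x in a :: p]; split.
- exact: path_connected pp.
- by rewrite inE mem_head.
- by rewrite inE -lp mem_last.
- apply/pred0P => x /=; rewrite inE; apply/negP => /andP[xp xZ'].
  have /(nthP a)[i lti ei] := xp; have := xZ i; rewrite ei xZ' => /(_ _) h.
  by move: lti; rewrite /= sp ltnS => /h.
- rewrite cardsE; apply: leq_trans (card_size _) _; rewrite /= sp /plen.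
  move: cnt; rewrite cardsT -/(nverts G) => cnt.
  have h1 : (n %/ 3).+1 * D1 <= 2 * K * D1.
    have : (n %/ 3).+1 * D1 <= 2 * ((n %/ 3).+1 * (D1 - #|Z|)).
      rewrite mulnCA leq_mul2l; apply/orP; right; move: ZD; clear; lia.
    move=> h; apply: leq_trans h _; rewrite -mulnA leq_mul2l /=.
    exact: leq_trans cnt size_G.
  rewrite leq_pmul2r // in h1; move: h1; clear; lia.
Qed.

Definition undom (C : {set G}) : {set G} := [set v | [disjoint nbr v & C]].

Lemma undomS (C C' : {set G}) : C \subset C' -> undom C' \subset undom C.
Proof. by move=> s; apply/subsetP => v; rewrite !inE; apply: disjointWr. Qed.

(* Averaging over degrees, some vertex dominates a fraction [1 / (2 K)] of what is
   not yet dominated; it is attached by a path of bounded length. *)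
Lemma dominating_bag (Z : {set G}) n : #|Z| < k -> 2 * #|Z| <= D1 ->
  exists C : {set G}, [/\ connected_in C, [disjoint C & Z], #|C| <= n * plen + 1 &
    (2 * K) ^ n * #|undom C| <= (2 * K - 1) ^ n * nverts G].
Proof.
move=> Zk ZD; have [deg size_G rob _] := hG.
elim: n => [|n [C [cC dC sC uC]]].
{ have [/set0Pn[a aZ] _] := rob Z Zk.
  exists [set a]; split=> //; [exact: conn1| |by rewrite cards1|].
    by rewrite disjoints1; move: aZ; rewrite !inE andbT.
  rewrite !expn0 !mul1n /nverts; apply: max_card. }
pose T := undom C.
have K0 : 0 < K.
{ case: (posnP K) => // e; have [/set0Pn[a _] _] := cC.
  have : 0 < nverts G by apply/card_gt0P; exists a.
  by move: size_G; rewrite e mul0n leqn0 => /eqP ->. }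
have [z zZ hz] : exists2 z, z \notin Z & #|T| <= 2 * K * #|nbr z :&: T|.
{ case: (pickP [pred z | (z \notin Z) && (#|T| <= 2 * K * #|nbr z :&: T|)]) => [z /andP[u v]|no0].
    by exists z.
  have no z : z \notin Z -> 2 * K * #|nbr z :&: T| < #|T|.
    by move=> zZ; have := no0 z; rewrite /= zZ /= ltnNge => ->.
  exfalso.
  have h1 : #|T| * (D1 - #|Z|) <= \sum_(z in ~: Z) #|nbr z :&: T|.
  { rewrite -sum_nat_const; apply: leq_trans (_ : \sum_(v in T) \sum_(z in ~: Z) adj v z <= _).
      apply: leq_sum => v _; rewrite -card_nbrI.
      have -> : nbr v :&: ~: Z = nbr v :\: Z by rewrite setDE.
      by have := deg v; have := card_setD_ge (nbr v) Z; clear; lia.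
    rewrite exchange_big /=; apply: leq_sum => z _; rewrite card_nbrI.
    by apply: leq_sum => v _; rewrite adjC. }
  have T0 : 0 < #|T|.
  { have [/set0Pn[a aZ] _] := rob Z Zk.
    have aZ' : a \notin Z by move: aZ; rewrite !inE andbT.
    have := no a aZ'; exact: leq_ltn_trans. }
  have h2 : \sum_(z in ~: Z) (2 * K * #|nbr z :&: T| + 1) <= \sum_(z in ~: Z) #|T|.
  { apply: leq_sum => z; rewrite inE => zZ; rewrite addn1; exact: no. }
  rewrite big_split /= -big_distrr /= !sum_nat_const muln1 in h2.
  have h3 : #|~: Z| <= K * D1 by apply: leq_trans size_G; apply: max_card.
  have h4 : 0 < #|~: Z|.
  { have [/set0Pn[a aZ] _] := rob Z Zk; apply/card_gt0P; exists a.
    by move: aZ; rewrite !inE andbT. }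
  have h5 : D1 <= 2 * (D1 - #|Z|) by move: ZD; clear; lia.
  move: h1 h2; set s := \sum_(z in ~: Z) _ => h1 h2.
  have h6 : K * (#|T| * D1) <= #|~: Z| * #|T| - #|~: Z|.
  { apply: leq_trans (_ : 2 * K * s <= _); last by move: h2; clear; lia.
    apply: leq_trans (_ : 2 * K * (#|T| * (D1 - #|Z|)) <= _); last by rewrite leq_mul2l h1 orbT.
    rewrite [2 * K]mulnC -mulnA leq_mul2l; apply/orP; right.
    by rewrite mulnCA leq_mul2l h5 orbT. }
  have h7 : #|~: Z| * #|T| <= K * D1 * #|T| by rewrite leq_mul2r h3 orbT.
  have e : K * (#|T| * D1) = K * D1 * #|T| by rewrite [#|T| * D1]mulnC mulnA.
  have : 0 < #|~: Z| * #|T| by rewrite muln_gt0 h4 T0.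
  rewrite e in h6; move: h6 h7 h4 T0 K0 D10.
  by clear; lia. }
have [/set0Pn[c cin] _] := cC.
have cZ : c \notin Z by have /pred0P/(_ c) := dC; rewrite /= cin /= => ->.
have [C' [cC' cC'1 zC' dC' sC']] := short_path Zk ZD cZ zZ.
exists (C :|: C'); split.
- by apply: (connU (a := c) (b := c)) => //; rewrite eqxx.
- by rewrite -setI_eq0 setIUl setU_eq0 !setI_eq0 dC.
- by have [h _] := leq_card_setU C C'; rewrite mulSn; move: h sC sC'; clear; lia.
have sub : undom (C :|: C') \subset T :\: nbr z.
{ apply/subsetP => v vu; rewrite inE (subsetP (undomS (subsetUl C C')) _ vu) andbT.
  rewrite in_nbr; apply/negP => zv; move: vu; rewrite inE => /pred0P/(_ z).
  by rewrite /= !inE adjC zv zC' orbT. }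
have h1 : 2 * K * #|undom (C :|: C')| <= (2 * K - 1) * #|T|.
{ apply: leq_trans (_ : 2 * K * #|T :\: nbr z| <= _).
    by rewrite leq_mul2l subset_leq_card ?orbT.
  rewrite cardsD setIC mulnBr mulnBl mul1n; apply: leq_sub2l; exact: hz. }
rewrite !expnS.
have ar (x y u v : nat) : x * u <= v -> x * y * u <= y * v.
  by move=> h; rewrite [x * y]mulnC -mulnA leq_mul2l h orbT.
apply: leq_trans (ar _ ((2 * K) ^ n) _ _ h1) _.
by rewrite mulnCA -[leqRHS]mulnA leq_mul2l uC orbT.
Qed.

Variable H : finType.

Definition bag_family (s : seq H) (f : H -> {set G}) : Prop :=
  (forall x, x \in s -> connected_in (f x)) /\
  (forall x y, x \in s -> y \in s -> x != y -> [disjoint f x & f y]).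

(** The bags are built one after another, with [Z] the union of the earlier ones; [n] rounds of
    [dominating_bag] leave at most a [d]-th part of the host undominated. *)
Lemma bags_exist (d n : nat) (s : seq H) : uniq s ->
  (2 * K - 1) ^ n * d <= (2 * K) ^ n -> 0 < K ->
  size s * (n * plen + 1) < k -> 2 * (size s * (n * plen + 1)) <= D1 ->
  exists f : H -> {set G}, [/\ bag_family s f,
    #|\bigcup_(x <- s) f x| <= size s * (n * plen + 1) &
    forall x, x \in s -> d * #|undom (f x)| <= nverts G].
Proof.
move=> us hd K0; set Lc := n * plen + 1.
elim: s us => [_|x s IH /= /andP[xs us]] h1 h2.
  by exists (fun _ => set0); split=> //; rewrite big_nil cards0.
rewrite mulSn in h1 h2.
have [||f [[cf df] sf uf]] := IH us; [by move: h1; clear; lia|by move: h2; clear; lia|].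
set Z := \bigcup_(x <- s) f x in sf.
have [||C [cC dC sC uC]] := @dominating_bag Z n; [by move: sf h1; clear; lia|by move: sf h2; clear; lia|].
have fZ y : y \in s -> f y \subset Z.
{ rewrite /Z; clear; elim: s => // z s IH; rewrite inE big_cons => /orP[/eqP ->|/IH h].
    exact: subsetUl.
  exact: subset_trans h (subsetUr _ _). }
pose f' y := if y == x then C else f y.
have f's y : y \in s -> f' y = f y by rewrite /f'; case: eqP => // -> h; rewrite h in xs.
have f'x : f' x = C by rewrite /f' eqxx.
have dCy y : y \in s -> [disjoint C & f y] by move=> /fZ h; apply: disjointWr dC.
exists f'; split; [split| |].
- by move=> y; rewrite inE => /orP[/eqP ->|ys]; rewrite ?f'x // f's //; apply: cf.
- move=> y z; rewrite !inE => /orP[/eqP ->|ys] /orP[/eqP ->|zs]; rewrite ?eqxx //.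
  + by move=> _; rewrite f'x f's //; apply: dCy.
  + by move=> _; rewrite f'x f's // disjoint_sym; apply: dCy.
  + by move=> yz; rewrite !f's //; apply: df.
- rewrite big_cons f'x mulSn.
  have -> : \bigcup_(j <- s) f' j = Z by apply: eq_big_seq => y ys; rewrite f's.
  by have [h _] := leq_card_setU C Z; apply: leq_trans h _; apply: leq_add.
- move=> y; rewrite inE => /orP[/eqP ->|ys]; last by rewrite f's //; apply: uf.
  rewrite f'x -(leq_pmul2l (m := (2 * K) ^ n)); last by rewrite expn_gt0 muln_gt0 K0.
  rewrite mulnCA; apply: leq_trans (_ : d * ((2 * K - 1) ^ n * nverts G) <= _).
    by rewrite leq_mul2l uC orbT.
  by rewrite mulnA [d * _]mulnC leq_mul2r hd orbT.
Qed.

(** For each pair in [es] a short path outside all bags is added to the bag of one end only. The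
    bags merely grow, so domination is preserved. *)
Lemma link_bags (s : seq H) (es : seq (H * H)) (f : H -> {set G}) (w : nat) :
  (forall e, e \in es -> [/\ e.1 \in s, e.2 \in s & e.1 != e.2]) ->
  bag_family s f -> #|\bigcup_(x <- s) f x| <= w ->
  w + size es * plen < k -> 2 * (w + size es * plen) <= D1 ->
  exists f' : H -> {set G}, [/\ bag_family s f', forall x, f x \subset f' x,
    #|\bigcup_(x <- s) f' x| <= w + size es * plen &
    forall e, e \in es -> exists a b : G, [/\ a \in f' e.1, b \in f' e.2 & adj a b]].
Proof.
elim: es f w => [|[x y] es IH] f w hes ff sf h1 h2.
  by exists f; split=> //; rewrite mul0n addn0.
have [/= xs ys xy] := hes (x, y) (mem_head _ _).
have [deg size_G rob _] := hG; have [cf df] := ff.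
rewrite /= mulSn in h1 h2 *.
pose W := \bigcup_(x <- s) f x.
have fW z : z \in s -> f z \subset W.
{ rewrite /W; clear; elim: s => // u s IH; rewrite inE big_cons => /orP[/eqP ->|/IH h].
    exact: subsetUl.
  exact: subset_trans h (subsetUr _ _). }
have WD : #|W| < D1 by move: sf h2 D10; rewrite -/W; clear; lia.
have out z : z \in s -> exists a b : G, [/\ a \in f z, b \notin W & adj a b].
{ move=> zs; have [/set0Pn[a az] _] := cf z zs.
  have /card_gt0P[b] : 0 < #|nbr a :\: W|.
    by have := card_setD_ge (nbr a) W; have := deg a; move: WD; clear; lia.
  by rewrite inE in_nbr => /andP[bW ab]; exists a, b. }
have [a [a' [ax a'W aa']]] := out x xs; have [b [b' [by_ b'W bb']]] := out y ys.
have [||C [cC aC bC dC sC]] := @short_path W a' b' _ _ a'W b'W.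
- by move: sf h1; rewrite -/W; clear; lia.
- by move: sf h2; rewrite -/W; clear; lia.
pose g z := if z == x then f x :|: C else f z.
have gx : g x = f x :|: C by rewrite /g eqxx.
have gz z : z != x -> g z = f z by rewrite /g => /negPf ->.
have fg z : f z \subset g z by rewrite /g; case: eqP => // ->; apply: subsetUl.
have dCf z : z \in s -> [disjoint C & f z] by move=> /fW h; apply: disjointWr dC.
have gg : bag_family s g.
{ split.
  - move=> z zs; case: (eqVneq z x) => [->|zx]; last by rewrite gz //; apply: cf.
    by rewrite gx; apply: (connU (a := a) (b := a')) => //; [exact: cf|rewrite aa' orbT].
  - move=> u v us vs uv; case: (eqVneq u x) => [ux|ux]; case: (eqVneq v x) => [vx|vx].
    + by rewrite ux vx eqxx in uv.
    + rewrite ux gx gz // -setI_eq0 setIUl setU_eq0 !setI_eq0 dCf // andbT.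
      by apply: df => //; rewrite -ux.
    + rewrite vx gx gz // -setI_eq0 setIUr setU_eq0 !setI_eq0 [X in _ && X]disjoint_sym dCf // andbT.
      by apply: df => //; rewrite -vx.
    + by rewrite !gz //; apply: df. }
have sg : #|\bigcup_(z <- s) g z| <= w + plen.
{ have sub : \bigcup_(z <- s) g z \subset W :|: C.
    apply/subsetP => v; rewrite big_tnth => /bigcupP[i _]; set z := tnth _ _.
    have zs : z \in s by apply: (mem_tnth i (in_tuple s)).
    rewrite /g inE; case: eqP => _; first rewrite inE => /orP[h|->]; rewrite ?orbT //.
      by rewrite (subsetP (fW x xs)).
    by move=> h; rewrite (subsetP (fW z zs)).
  apply: leq_trans (subset_leq_card sub) _; have [h _] := leq_card_setU W C.
  by apply: leq_trans h _; apply: leq_add. }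
have [|||f' [ff' sf' wf' ef']] := IH g (w + plen) _ gg sg.
- by move=> e he; apply: hes; rewrite inE he orbT.
- by move: h1; clear; lia.
- by move: h2; clear; lia.
exists f'; split=> //.
- by move=> z; apply: subset_trans (fg z) (sf' z).
- by rewrite addnA.
- move=> e; rewrite inE => /orP[/eqP ->|]; last exact: ef'.
  exists b', b; split; rewrite /=.
  + by apply: (subsetP (sf' x)); rewrite gx inE bC orbT.
  + by apply: (subsetP (sf' y)); apply: (subsetP (fg y)).
  + by rewrite adjC.
Qed.
End Connect.

Lemma pairwise_meet_card (T : finType) (l : seq {set T}) (N : {set T}) :
  pairwise (fun A B : {set T} => [disjoint A & B]) l ->
  (forall A, A \in l -> ~~ [disjoint A & N]) -> size l <= #|N|.
Proof.
elim: l N => //= A l IH N /andP[/allP dA dl] mN.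
have /pred0Pn[a /andP[/= aA aN]] := mN A (mem_head _ _).
apply: leq_ltn_trans (_ : #|N :\: A| < _); last first.
  apply/proper_card/properP; split; first exact: subsetDl.
  by exists a; rewrite // inE aA.
apply: IH => // B Bl; have := mN B; rewrite inE Bl orbT => /(_ isT) /pred0Pn[b /andP[/= bB bN]].
apply/pred0Pn; exists b; rewrite /= bB inE bN andbT /=.
by apply/negP => bA; have /pred0P/(_ b) := dA B Bl; rewrite /= bA bB.
Qed.

(** Greedy choice: at most [u] of the disjoint sets can meet a given bad set, and more than [u] sets
    are left at every step. *)
Lemma disjoint_representatives (T : finType) (l : seq {set T}) (g u : nat) (bad : nat -> {set T}) :
  pairwise (fun A B : {set T} => [disjoint A & B]) l -> g + u <= size l ->
  (forall i, i < g -> #|bad i| <= u) ->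
  exists f : nat -> {set T}, (forall i, i < g -> f i \in l /\ [disjoint f i & bad i]) /\
    (forall i j, i < j -> j < g -> [disjoint f i & f j]).
Proof.
elim: g l => [|g IH] l dl sl hb; first by exists (fun _ => set0); split.
have [A Al Ab] : exists2 A, A \in l & [disjoint A & bad g].
{ apply/hasP; apply/negPn/negP => /hasPn no.
  have := pairwise_meet_card dl no; have := hb g (ltnSn g); move: sl; clear; lia. }
case/splitPr: Al dl sl => l1 l2.
rewrite pairwise_cat /= => /and4P[/allrelP a12 p1 /allP pA p2].
rewrite size_cat /= => sl.
have dA B : B \in l1 ++ l2 -> [disjoint B & A].
  rewrite mem_cat => /orP[h|h]; first by apply: a12 => //; rewrite mem_head.
  by rewrite disjoint_sym; apply: pA.
have [|||f [fl df]] := IH (l1 ++ l2).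
- rewrite pairwise_cat p1 p2 !andbT; apply/allrelP => x y xl yl; apply: a12 => //.
  by rewrite inE yl orbT.
- by rewrite size_cat; move: sl; clear; lia.
- by move=> i lti; apply: hb; apply: ltnW.
exists (fun i => if i < g then f i else A); split=> [i|i j ij].
- rewrite ltnS leq_eqVlt => /orP[/eqP ->|lti]; first by rewrite ltnn mem_cat mem_head orbT.
  rewrite lti; have [fi di] := fl i lti; split=> //.
  by move: fi; rewrite !mem_cat inE => /orP[->|->]; rewrite ?orbT.
- rewrite ltnS leq_eqVlt => /orP[/eqP ej|ltj]; last by rewrite ltj (ltn_trans ij ltj); apply: df.
  by rewrite ej ltnn -ej ij; rewrite ej in ij *; apply: dA; have [] := fl i ij.
Qed.

Definition model_at (H G : sgraph) (Q : {set H}) (U : {set G}) : Prop :=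
  exists b : H -> {set G},
    [/\ forall x, x \in Q -> connected_in (b x) /\ b x \subset U,
        forall x y, x \in Q -> y \in Q -> x != y -> [disjoint b x & b y] &
        forall x y, x \in Q -> y \in Q -> adj x y ->
          exists a c : G, [/\ a \in b x, c \in b y & adj a c]].

Definition group (H : sgraph) (X : {set H}) (lab : H -> nat) (i : nat) : {set H} :=
  [set x | (x \notin X) && (lab x == i)].

Definition group_nbr (H : sgraph) (X : {set H}) (lab : H -> nat) (i : nat) : {set H} :=
  [set y in X | [exists x, (x \in group X lab i) && adj x y]].

(* [X] is modelled by connected dominating sets, its edges by short paths; the
   group [i] is then placed in a tile avoiding all vertices that fail to be
   dominated by the [X]-neighbours of the group. *)
Lemma assemble (G : sgraph) (D1 k K : nat) (H : sgraph) (X : {set H}) (lab : H -> nat)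
    (g Delta CX d n u : nat) :
  let w := #|X| * (n * plen K + 1) + CX * plen K in
  host G D1 k K -> 0 < D1 -> 0 < K -> 0 < d ->
  (forall x y, x \notin X -> y \notin X -> adj x y -> lab x = lab y) ->
  (forall x, x \notin X -> lab x < g) ->
  (forall i, i < g -> #|group_nbr X lab i| <= Delta) ->
  #|arcset X| <= CX -> (2 * K - 1) ^ n * d <= (2 * K) ^ n ->
  w < k -> 2 * w <= D1 -> Delta * nverts G <= d * u ->
  (forall W : {set G}, #|W| <= w -> exists l : seq {set G},
     [/\ pairwise (fun A B : {set G} => [disjoint A & B]) l, g + u <= size l &
         forall U, U \in l -> [disjoint U & W] /\
           forall i, i < g -> model_at (group X lab i) U]) ->
  minor H G.
Proof.
move=> w hG D10 K0 d0 labE labg nbrD arcX hd wk wD hu tiles.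
pose Lc := n * plen K + 1; rewrite -/Lc in w wk wD tiles.
have sX : size (enum X) = #|X| by rewrite -cardE.
have mX x : (x \in enum X) = (x \in X) by rewrite mem_enum.
have h1 : #|X| * Lc <= w by rewrite /w leq_addr.
have [||f [ff sf uf]] := @bags_exist G D1 k K hG D10 H d n (enum X) (enum_uniq _) hd K0.
- by rewrite sX; apply: leq_ltn_trans wk.
- by rewrite sX; apply: leq_trans wD; rewrite leq_mul2l /=.
have sE : #|X| * Lc + size (enum (arcset X)) * plen K <= w.
  by rewrite /w leq_add2l leq_mul2r -cardE arcX orbT.
rewrite sX in sf.
have hes (e : H * H) : e \in enum (arcset X) -> [/\ e.1 \in enum X, e.2 \in enum X & e.1 != e.2].
  case: e => x y; rewrite mem_enum inE /= => /and3P[xX yX xy].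
  by rewrite !mX; split=> //; apply: adj_neq xy.
have [||f' [[cf df] ff' sf' ef]] := @link_bags G D1 k K hG D10 H (enum X) (enum (arcset X)) f (#|X| * Lc) hes ff sf.
- exact: leq_ltn_trans sE wk.
- by apply: leq_trans wD; rewrite leq_mul2l.
set W := \bigcup_(x <- enum X) f' x in sf'.
have fW x : x \in X -> f' x \subset W.
  by move=> xX; rewrite /W big_enum /=; apply: bigcup_sup.
have [l [dl sl hl]] := tiles W (leq_trans sf' sE).
(* The tile for group [i] must consist of vertices dominated by the bag of every neighbour of the
   group in [X]; the enlargement of the bags by [link_bags] only shrinks [bad i]. *)
pose bad i := \bigcup_(x in group_nbr X lab i) undom (f' x).
have hbad i : i < g -> #|bad i| <= u.
{ move=> lti; rewrite -(leq_pmul2l d0); apply: leq_trans hu.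
  apply: leq_trans (_ : \sum_(x in group_nbr X lab i) nverts G <= _); last first.
    by rewrite sum_nat_const leq_mul2r nbrD ?orbT.
  apply: leq_trans (_ : \sum_(x in group_nbr X lab i) d * #|undom (f' x)| <= _).
    rewrite -big_distrr leq_mul2l /=; apply/orP; right; exact: card_bigcup_le.
  apply: leq_sum => x; rewrite inE => /andP[xX _].
  apply: leq_trans (uf x _); last by rewrite mX.
  by rewrite leq_mul2l subset_leq_card ?orbT // undomS. }
have [t [tl dt]] := disjoint_representatives dl sl hbad.
have ex i : exists b : H -> {set G}, i < g ->
    [/\ forall x, x \in group X lab i -> connected_in (b x) /\ b x \subset t i,
        forall x y, x \in group X lab i -> y \in group X lab i -> x != y -> [disjoint b x & b y] &
        forall x y, x \in group X lab i -> y \in group X lab i -> adj x y ->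
          exists a c : G, [/\ a \in b x, c \in b y & adj a c]].
{ case: (ltnP i g) => lti; last by exists (fun _ => set0).
  have [ti _] := tl i lti; have [_ m] := hl _ ti; have [b hb] := m i lti.
  by exists b. }
have [b hb] := boolp.choice ex.
pose B x := if x \in X then f' x else b (lab x) x.
have inG x : x \notin X -> x \in group X lab (lab x) by move=> h; rewrite inE h eqxx.
have BX x : x \in X -> B x = f' x by rewrite /B => ->.
have BN x : x \notin X -> B x = b (lab x) x by rewrite /B => /negPf ->.
have Bt x : x \notin X -> B x \subset t (lab x).
  by move=> xX; rewrite BN //; have [h _ _] := hb _ (labg x xX); have [] := h x (inG x xX).
have cB x : connected_in (B x).
{ case: (boolP (x \in X)) => xX; first by rewrite BX //; apply: cf; rewrite mX.
  by rewrite BN //; have [h _ _] := hb _ (labg x xX); have [] := h x (inG x xX). }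
have dXN x y : x \in X -> y \notin X -> [disjoint B x & B y].
{ move=> xX yX; rewrite BX //; apply: disjointWl (fW x xX) _.
  rewrite disjoint_sym; apply: disjointWl (Bt y yX) _.
  by have [ti _] := tl _ (labg y yX); have [] := hl _ ti. }
have eXN x y : x \in X -> y \notin X -> adj y x -> exists a c : G, [/\ a \in B x, c \in B y & adj a c].
{ move=> xX yX yx; have [/set0Pn[v vB] _] := cB y.
  have vt := subsetP (Bt y yX) _ vB; have [_ /pred0P/(_ v)] := tl _ (labg y yX).
  rewrite /= vt /= => /negbT vb.
  have : v \notin undom (f' x).
    apply: contra vb => vu; apply/bigcupP; exists x => //.
    by rewrite inE xX /=; apply/existsP; exists y; rewrite inG.
  rewrite inE => /pred0Pn[c /andP[/= vc cf']]; exists c, v; rewrite BX //; split=> //.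
  by rewrite adjC -in_nbr. }
exists B; split=> // x y.
- move=> xy; case: (boolP (x \in X)) => xX; case: (boolP (y \in X)) => yX.
  + by rewrite !BX //; apply: df; rewrite ?mX.
  + exact: dXN.
  + by rewrite disjoint_sym; apply: dXN.
  + case: (ltngtP (lab x) (lab y)) => hl'.
    * apply: disjointWl (Bt x xX) _; apply: disjointWr (Bt y yX) _; apply: dt => //; exact: labg.
    * rewrite disjoint_sym; apply: disjointWl (Bt y yX) _; apply: disjointWr (Bt x xX) _.
      by apply: dt => //; apply: labg.
    * rewrite !BN // -hl'; have [_ h _] := hb _ (labg x xX); apply: h => //; first exact: inG.
      by rewrite hl'; apply: inG.
- move=> xy; case: (boolP (x \in X)) => xX; case: (boolP (y \in X)) => yX.
  + by rewrite !BX //; apply: (ef (x, y)); rewrite mem_enum inE /= xX yX.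
  + by apply: eXN; rewrite // adjC.
  + by have [a [c [ha hc ac]]] := eXN y x yX xX xy; exists c, a; rewrite adjC.
  + have e := labE x y xX yX xy; rewrite !BN // -e; have [_ _ h] := hb _ (labg x xX).
    by apply: h => //; [exact: inG|rewrite e; exact: inG].
Qed.

(** * Sparse groups inside a tile *)

Local Open Scope ring_scope.

Definition independent (H : sgraph) (I : {set H}) : Prop :=
  forall x y, x \in I -> y \in I -> ~~ adj x y.

Definition thin (R : realType) (r : R) (H : sgraph) (Q : {set H}) : Prop :=
  forall S : {set H}, S \subset Q -> exists I : {set H},
    [/\ I \subset S, independent I & (1 - r) * #|S|%:R <= #|I|%:R].

Lemma inj_into (S T : finType) (v0 : T) (A : {set S}) (B : {set T}) : (#|A| <= #|B|)%N ->
  exists f : S -> T, {in A &, injective f} /\ forall x, x \in A -> f x \in B.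
Proof.
rewrite !cardE => le; pose f x := nth v0 (enum B) (index x (enum A)); exists f.
have ix x : x \in A -> (index x (enum A) < size (enum B))%N.
  by move=> xA; apply: leq_trans le; rewrite index_mem mem_enum.
split=> [x y xA yA /eqP|x xA]; last by rewrite -mem_enum mem_nth ?ix.
rewrite /f nth_uniq ?enum_uniq ?ix // => /eqP e.
by rewrite -(nth_index x (s := enum A) (x := x)) ?mem_enum // e nth_index ?mem_enum.
Qed.

(** A vertex [x] takes one place in each part [U i] with [x \in A i]. Its places are pairwise
    adjacent, so they form a connected set. *)
Lemma clique_model (I : finType) (H G : sgraph) (Q : {set H}) (A : I -> {set H})
    (U : I -> {set G}) :
  (forall i j x y, i != j -> x \in U i -> y \in U j -> adj x y) ->
  (forall i, #|A i| <= #|U i|)%N ->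
  (forall x, x \in Q -> exists i, x \in A i) ->
  (forall x y, x \in Q -> y \in Q -> adj x y -> exists i j, [/\ i != j, x \in A i & y \in A j]) ->
  model_at Q (\bigcup_i U i).
Proof.
move=> cU sA cA aA.
case: (set_0Vmem Q) => [->|[q qQ]].
  by exists (fun _ => set0); split=> x; rewrite inE.
have [v0 _] : exists v0 : G, true.
{ have [i qi] := cA q qQ; have : (0 < #|U i|)%N.
    by apply: leq_trans (sA i); apply/card_gt0P; exists q.
  by move=> /card_gt0P[v _]; exists v. }
have [f hf] := boolp.choice (fun i => @inj_into _ _ v0 (A i) (U i) (sA i)).
have fU i x : x \in A i -> f i x \in U i by have [_ h] := hf i; apply: h.
pose b x := \bigcup_(i | x \in A i) [set f i x].
have inb x v : reflect (exists2 i, x \in A i & v = f i x) (v \in b x).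
  apply: (iffP bigcupP) => [[i xi /set1P ->]|[i xi ->]]; exists i => //; exact/set1P.
exists b; split.
- move=> x xQ; split; last first.
    apply/subsetP => v /inb[i xi ->]; apply/bigcupP; exists i => //; exact: fU.
  have [i xi] := cA x xQ; apply: (conn_rooted (r := f i x)); first by apply/inb; exists i.
  move=> v /inb[j xj ->]; case: (eqVneq i j) => [->|ij]; first exact: connect0.
  apply: connect1; rewrite radjE; apply/and3P; split; try by apply/inb; [exists i|exists j].
  - by apply/inb; exists i.
  - by apply/inb; exists j.
  - by apply: (cU i j) => //; apply: fU.
- move=> x y xQ yQ xy; apply/pred0P => v /=; apply/negP => /andP[/inb[i xi ei] /inb[j yj ej]].
  case: (eqVneq i j) => [e|ij].
    move: ej; rewrite ei -e => h; have [inj _] := hf i.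
    by rewrite (inj x y xi _ h) ?eqxx // in xy; rewrite e.
  have := cU i j v v ij; rewrite {1}ei {1}ej fU // fU // adjxx => h.
  by have := h isT isT.
- move=> x y xQ yQ xy; have [i [j [ij xi yj]]] := aA x y xQ yQ xy.
  exists (f i x), (f j y); split; [by apply/inb; exists i|by apply/inb; exists j|].
  by apply: (cU i j) => //; apply: fU.
Qed.

Lemma setDUK (T : finType) (A B : {set T}) : B \subset A -> (A :\: B) :|: B = A.
Proof. by move=> /setIidPr {2}<-; rewrite setUC setID. Qed.

Section Universal.
Variables (R : realType) (r : R).
Hypotheses (r0 : 0 <= r) (r1 : r <= 1).

Lemma thinS (H : sgraph) (Q Q' : {set H}) : Q' \subset Q -> thin r Q -> thin r Q'.
Proof. by move=> s t S sS; apply: t; apply: subset_trans s. Qed.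

(** The independent set is trimmed because the part of the tile that receives it has limited room;
    after trimming it still has at least [(1 - r) * sigma] vertices, which bounds the remainder. *)
Lemma trimmed_independent (H : sgraph) (Q : {set H}) (sigma : R) : thin r Q ->
  #|Q|%:R <= sigma -> exists I : {set H},
    [/\ I \subset Q, independent I, #|I|%:R <= (1 - r) * sigma + 1 &
        #|Q :\: I|%:R <= r * sigma].
Proof.
move=> tQ sQ; have [I [IQ iI cI]] := tQ Q (subxx _).
have s0 : 0 <= sigma by apply: le_trans sQ; rewrite ler0n.
have cD (J : {set H}) : J \subset Q -> #|Q :\: J|%:R = #|Q|%:R - #|J|%:R :> R.
  move=> JQ; rewrite cardsD (setIidPr JQ) natrB //; exact: subset_leq_card.
case: (leP (#|I|%:R) ((1 - r) * sigma + 1)) => h.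
  exists I; split=> //; rewrite cD //.
  have : (r * #|Q|%:R <= r * sigma) by apply: ler_wpM2l.
  by move: cI; clear; lra.
have [J [JI cJ]] : exists J : {set H}, J \subset I /\ #|J| = (Num.truncn ((1 - r) * sigma)).+1.
{ apply: subset_of_card; rewrite -(ler_nat R); apply: le_trans (ltW h).
  by rewrite -natr1 lerD2r truncn_le; apply: mulr_ge0 => //; rewrite subr_ge0. }
have a0 : 0 <= (1 - r) * sigma by apply: mulr_ge0 => //; rewrite subr_ge0.
exists J; split.
- exact: subset_trans IQ.
- by move=> x y xJ yJ; apply: iI; apply: (subsetP JI).
- by rewrite cJ -natr1 lerD2r truncn_le.
- rewrite cD; last exact: subset_trans IQ.
  have : (1 - r) * sigma <= #|J|%:R by rewrite cJ; apply/ltW/truncnS_gt.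
  by move: sQ; clear; lra.
Qed.

(* Three successive independent sets [I0], [I1], [I2] (two for a tile of kind
   [false]) go to the parts of the tile; what remains has at most [r ^+ 3 * sigma]
   (resp. [r ^+ 2 * sigma]) vertices and uses edges between the outer parts. *)
Lemma tile_universal (H G : sgraph) (Q : {set H}) (t : tile_type G) (a0 a1 a2 : bool -> nat)
    (s : nat) (sigma : R) :
  thin r Q -> #|Q|%:R <= sigma -> is_tile a0 a1 a2 s t ->
  (1 - r + r ^+ 3) * sigma + 1 <= (a0 true * s)%:R ->
  r * (1 - r) * sigma + 1 <= (a1 true * s)%:R ->
  r ^+ 2 * sigma <= (a2 true * s)%:R ->
  (1 - r + r ^+ 2) * sigma + 1 <= (a0 false * s)%:R ->
  r * sigma <= (a2 false * s)%:R ->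
  model_at Q (supp t).
Proof.
case: t => k [U0 [U1 U2]] tQ sQ /and5P[/= /eqP c0 /eqP c1 /eqP c2 k01 /andP[k02 k12]] h1 h2 h3 h4 h5.
have s0 : 0 <= sigma by apply: le_trans sQ; rewrite ler0n.
pose U (i : option bool) := match i with Some true => U0 | None => U1 | Some false => U2 end.
have -> : supp (k, (U0, (U1, U2))) = \bigcup_i U i.
{ apply/setP => v; rewrite !inE; apply/idP/bigcupP.
    by move=> /or3P[h|h|h]; [exists (Some true)|exists None|exists (Some false)].
  by case=> [[[]|]] _ /= ->; rewrite ?orbT. }
have cU i j x y : i != j -> x \in U i -> y \in U j -> adj x y.
{ move/complete_toP: k01 => k01; move/complete_toP: k02 => k02; move/complete_toP: k12 => k12.
  case: i => [[]|]; case: j => [[]|] //= _ hx hy; try (by auto); rewrite adjC; by auto. }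
have [I0 [I0Q i0 b0 d0]] := trimmed_independent tQ sQ.
case: k c0 c1 c2 => c0 c1 c2.
- have [I1 [I1Q i1 b1 d1]] := trimmed_independent (thinS (subsetDl Q I0) tQ) d0.
  have [I2 [I2Q i2 b2 d2]] := trimmed_independent
    (thinS (subset_trans (subsetDl _ I1) (subsetDl Q I0)) tQ) d1.
  pose rest := Q :\: I0 :\: I1 :\: I2.
  (* Whatever part a neighbour of a vertex of [rest] occupies, one of the two outer parts differs
     from it. *)
  pose A (i : option bool) := match i with Some true => I0 :|: rest | None => I1
                              | Some false => I2 :|: rest end.
  apply: (@clique_model _ _ _ Q A U) => //.
  + case=> [[]|] /=.
    * rewrite c0 -(ler_nat R); apply: le_trans h1.
      have [h _] := leq_card_setU I0 rest; apply: le_trans (_ : #|I0|%:R + #|rest|%:R <= _).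
        by rewrite -natrD ler_nat.
      by move: b0 d2; rewrite /rest; clear; nra.
    * rewrite c2 -(ler_nat R); apply: le_trans h3.
      have -> : I2 :|: rest = Q :\: I0 :\: I1.
        by rewrite setUC; apply: setDUK.
      by move: d1; clear; nra.
    * by rewrite c1 -(ler_nat R); move: h2 b1; clear; nra.
  + move=> x xQ; case: (boolP (x \in I0)) => x0; first by exists (Some true); rewrite inE x0.
    case: (boolP (x \in I1)) => x1; first by exists None.
    case: (boolP (x \in I2)) => x2; first by exists (Some false); rewrite inE x2.
    by exists (Some true); rewrite !inE xQ x0 x1 x2 orbT.
  + move=> x y xQ yQ xy.
    have := i0 x y; have := i1 x y; have := i2 x y; rewrite xy.
    case x0 : (x \in I0); case x1 : (x \in I1); case x2 : (x \in I2);
    case y0 : (y \in I0); case y1 : (y \in I1); case y2 : (y \in I2) => n2 n1 n0;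
    try (by have := n0 isT isT); try (by have := n1 isT isT); try (by have := n2 isT isT);
    solve [ by exists (Some true), None; rewrite !inE ?x0 ?x1 ?x2 ?y0 ?y1 ?y2 ?xQ ?yQ
          | by exists (Some true), (Some false); rewrite !inE ?x0 ?x1 ?x2 ?y0 ?y1 ?y2 ?xQ ?yQ
          | by exists None, (Some true); rewrite !inE ?x0 ?x1 ?x2 ?y0 ?y1 ?y2 ?xQ ?yQ
          | by exists None, (Some false); rewrite !inE ?x0 ?x1 ?x2 ?y0 ?y1 ?y2 ?xQ ?yQ
          | by exists (Some false), None; rewrite !inE ?x0 ?x1 ?x2 ?y0 ?y1 ?y2 ?xQ ?yQ
          | by exists (Some false), (Some true); rewrite !inE ?x0 ?x1 ?x2 ?y0 ?y1 ?y2 ?xQ ?yQ ].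
- have [I2 [I2Q i2 b2 d2]] := trimmed_independent (thinS (subsetDl Q I0) tQ) d0.
  pose rest := Q :\: I0 :\: I2.
  pose A (i : option bool) := match i with Some true => I0 :|: rest | None => set0
                              | Some false => I2 :|: rest end.
  apply: (@clique_model _ _ _ Q A U) => //.
  + case=> [[]|] /=; last by rewrite cards0.
    * rewrite c0 -(ler_nat R); apply: le_trans h4.
      have [h _] := leq_card_setU I0 rest; apply: le_trans (_ : #|I0|%:R + #|rest|%:R <= _).
        by rewrite -natrD ler_nat.
      by move: b0 d2; rewrite /rest; clear; nra.
    * rewrite c2 -(ler_nat R); apply: le_trans h5.
      have -> : I2 :|: rest = Q :\: I0.
        by rewrite setUC; apply: setDUK.
      exact: d0.
  + move=> x xQ; case: (boolP (x \in I0)) => x0; first by exists (Some true); rewrite inE x0.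
    case: (boolP (x \in I2)) => x2; first by exists (Some false); rewrite inE x2.
    by exists (Some true); rewrite !inE xQ x0 x2 orbT.
  + move=> x y xQ yQ xy.
    have := i0 x y; have := i2 x y; rewrite xy.
    case x0 : (x \in I0); case x2 : (x \in I2);
    case y0 : (y \in I0); case y2 : (y \in I2) => n2 n0;
    try (by have := n0 isT isT); try (by have := n2 isT isT);
    solve [ by exists (Some true), (Some false); rewrite !inE ?x0 ?x2 ?y0 ?y2 ?xQ ?yQ
          | by exists (Some false), (Some true); rewrite !inE ?x0 ?x2 ?y0 ?y2 ?xQ ?yQ ].
Qed.
End Universal.

(** * Recursive use of separators *)

Lemma bernoulli (R : realType) (h : R) (n : nat) : 0 <= h -> 1 + n%:R * h <= (1 + h) ^+ n.
Proof.
move=> h0; elim: n => [|n IH]; first by rewrite mul0r addr0 expr0.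
rewrite exprS -natr1; have n0 : 0 <= n%:R :> R by rewrite ler0n.
apply: le_trans (_ : (1 + h) * (1 + n%:R * h) <= _); first by nra.
by apply: ler_wpM2l => //; rewrite addr_ge0.
Qed.

Lemma pow_large (R : realType) (b x : R) : 1 < b -> exists n : nat, x <= b ^+ n.
Proof.
move=> b1; have [n hn] := nat_ub (x / (b - 1)); exists n.
have h0 : 0 < b - 1 by rewrite subr_gt0.
have := bernoulli n (ltW h0); rewrite addrCA subrr addr0; apply: le_trans.
by rewrite ler_pdivrMr // in hn; apply: le_trans hn _; rewrite lerDr ler01.
Qed.

Lemma pow_small (R : realType) (b x : R) : 0 < b -> b < 1 -> 0 < x -> exists n : nat, b ^+ n <= x.
Proof.
move=> b0 b1 x0; have [|n hn] := @pow_large R b^-1 x^-1; first by rewrite invf_gt1.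
by exists n; rewrite -lef_pV2 ?posrE ?exprn_gt0 // -exprVn.
Qed.

Section Separators.
Variables (R : realType) (F : sgraph -> Prop) (C1 lam : R) (n0 : nat).
Hypotheses (lam0 : 0 < lam) (lam1 : lam < 1) (C10 : 0 < C1).
Hypothesis sepS : forall (H : sgraph), F H -> forall S : {set H}, (n0 <= #|S|)%N ->
  forall j, (4 / 3) ^+ j <= #|S|%:R :> R -> exists S1 S2 : {set H},
    [/\ S1 :|: S2 = S, #|S|%:R <= 3 * #|S1|%:R :> R /\ #|S|%:R <= 3 * #|S2|%:R :> R,
        #|S1 :&: S2|%:R <= C1 * lam ^+ j * #|S|%:R &
        forall x y, x \in S -> y \in S -> adj x y ->
          ((x \in S1) && (y \in S1)) || ((x \in S2) && (y \in S2))].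

(* The geometric series bounding the separators used at scales [(4 / 3) ^+ i],
   [i >= j]. *)
Definition tail j := C1 * lam ^+ j / (1 - lam).

Lemma tailS j : tail j.+1 = tail j - C1 * lam ^+ j.
Proof.
have h : 1 - lam != 0 by rewrite subr_eq0 eq_sym lt_eqF.
by rewrite /tail exprSr; field.
Qed.

Lemma tail_gt0 j : 0 < tail j.
Proof. by rewrite /tail divr_gt0 ?mulr_gt0 ?exprn_gt0 ?subr_gt0. Qed.

Lemma tail_le j i : tail (j + i) <= tail j.
Proof.
elim: i => [|i IH]; first by rewrite addn0.
rewrite addnS tailS; apply: le_trans IH; rewrite gerBl.
by rewrite mulr_ge0 ?exprn_ge0 // ltW.
Qed.

Lemma gap_tail j : C1 * lam ^+ j <= tail j.
Proof. by have := tail_gt0 j.+1; rewrite tailS subr_gt0 => /ltW. Qed.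

Lemma tail_small (x : R) : 0 < x -> exists j, tail j <= x.
Proof.
move=> x0; have h0 : 0 < 1 - lam by rewrite subr_gt0.
have [|j hj] := @pow_small R lam (x * (1 - lam) / C1) lam0 lam1; first by rewrite divr_gt0 ?mulr_gt0.
by exists j; rewrite /tail ler_pdivrMr // mulrC -ler_pdivlMr.
Qed.

(** Each side has at least a third of [S], so the other has at most [2 / 3 + 1 / 12 = 3 / 4] of it.
    This explains the ratio [4 / 3] of consecutive scales and the threshold [1 / 12]. *)
Lemma split_sizes (H : sgraph) (S S1 S2 : {set H}) (g : R) : S1 :|: S2 = S ->
  #|S|%:R <= 3 * #|S1|%:R :> R -> #|S|%:R <= 3 * #|S2|%:R :> R ->
  #|S1 :&: S2|%:R <= g * #|S|%:R -> g <= 1 / 12 ->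
  #|S1|%:R <= 3 / 4 * #|S|%:R :> R /\ #|S2|%:R <= 3 / 4 * #|S|%:R :> R.
Proof.
move=> <- h1 h2 h3 h4.
have e : #|S1 :|: S2|%:R + #|S1 :&: S2|%:R = #|S1|%:R + #|S2|%:R :> R by rewrite -!natrD cardsUI.
have h5 : #|S1 :&: S2|%:R <= 1 / 12 * #|S1 :|: S2|%:R :> R.
  by apply: le_trans h3 _; apply: ler_wpM2r.
by move: h1 h2 h5 e; lra.
Qed.

Section Scale.
Variables (M j0 : nat).
Hypotheses (M0 : (0 < M)%N) (Mn : (n0 <= M)%N) (tj0 : tail j0 <= 1 / 12).

Lemma scaled_split (H : sgraph) (S : {set H}) i : F H ->
  M%:R * (4 / 3) ^+ (j0 + i) < #|S|%:R :> R ->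
  #|S|%:R <= M%:R * (4 / 3) ^+ (j0 + i.+1) :> R ->
  exists S1 S2 : {set H},
    [/\ S1 :|: S2 = S, #|S1|%:R <= M%:R * (4 / 3) ^+ (j0 + i) :> R /\
        #|S2|%:R <= M%:R * (4 / 3) ^+ (j0 + i) :> R,
        #|S1 :&: S2|%:R <= (tail (j0 + i) - tail (j0 + i.+1)) * #|S|%:R &
        forall x y, x \in S -> y \in S -> adj x y ->
          ((x \in S1) && (y \in S1)) || ((x \in S2) && (y \in S2))].
Proof.
move=> FH lo hi; have M1 : 1 <= M%:R :> R by rewrite ler1n.
have p1 : 1 <= (4 / 3 : R) ^+ (j0 + i) by apply: exprn_ege1; lra.
have a1 : (n0 <= #|S|)%N.
  rewrite -(ler_nat R); apply: ltW; apply: le_lt_trans lo.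
  by apply: le_trans (_ : M%:R <= _); rewrite ?ler_nat // ler_peMr.
have a2 : (4 / 3) ^+ (j0 + i) <= #|S|%:R :> R.
  by apply: ltW; apply: le_lt_trans lo; rewrite ler_peMl // (le_trans ler01).
have [S1 [S2 [eS [b1 b2] c e]]] := sepS FH a1 a2.
have g12 : C1 * lam ^+ (j0 + i) <= 1 / 12.
  by apply: le_trans (gap_tail _) _; apply: le_trans (tail_le _ _) _.
have [s1 s2] := split_sizes eS b1 b2 c g12.
rewrite addnS exprSr mulrA in hi.
exists S1, S2; split=> //; last by rewrite addnS tailS subKr.
by split; move: s1 s2 hi; lra.
Qed.

(** Splitting duplicates the separator, so the linear bound deteriorates by a factor [1 + (t - t')]
    per scale; the correction [1 - tail] absorbs this, as [(1 - t) * (1 + (t - t')) <= 1 - t']. *)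
Lemma sparse_scale i (H : sgraph) (S : {set H}) : F H ->
  #|S|%:R <= M%:R * (4 / 3) ^+ (j0 + i) :> R ->
  (arcs_in S)%:R <= 2 * (M%:R * (4 / 3) ^+ j0) * (1 - tail (j0 + i)) * #|S|%:R.
Proof.
move=> FH; set B := M%:R * (4 / 3) ^+ j0.
have B0 : 0 <= B by rewrite mulr_ge0 ?ler0n // exprn_ge0 //; lra.
elim: i S => [|i IH] S hS.
{ rewrite addn0 in hS *; have a1 : (arcs_in S)%:R <= #|S|%:R * #|S|%:R :> R.
    rewrite -natrM ler_nat /arcs_in -sum_nat_const; apply: leq_sum => x _.
    by apply: subset_leq_card; apply: subsetIr.
  apply: le_trans a1 _; apply: ler_wpM2r => //; apply: le_trans hS _.
  by move: tj0 B0; rewrite -/B; nra. }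
case: (leP (#|S|%:R : R) (M%:R * (4 / 3) ^+ (j0 + i))) => h.
{ apply: le_trans (IH S h) _; apply: ler_wpM2r => //; apply: ler_wpM2l; first by rewrite mulr_ge0.
  by rewrite lerB // addnS -addn1 tail_le. }
have [S1 [S2 [eS [s1 s2] c e]]] := scaled_split FH h hS.
have i1 := IH S1 s1; have i2 := IH S2 s2.
have ac : (arcs_in S)%:R <= (arcs_in S1)%:R + (arcs_in S2)%:R :> R.
  by rewrite -natrD ler_nat; apply: arcs_cover.
have u : #|S1|%:R + #|S2|%:R <= (1 + (tail (j0 + i) - tail (j0 + i.+1))) * #|S|%:R :> R.
  by rewrite mulrDl mul1r -eS -natrD -cardsUI natrD eS lerD2l.
set t := tail (j0 + i) in i1 i2 u *; set t' := tail (j0 + i.+1) in u *.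
have t0 : 0 < t' by apply: tail_gt0.
have tt : t' <= t by rewrite /t' /t addnS -addn1 tail_le.
have t1 : t <= 1 / 12 by apply: le_trans (tail_le _ _) tj0.
apply: le_trans ac _; apply: le_trans (lerD i1 i2) _.
rewrite -mulrDr; apply: le_trans (_ : 2 * B * (1 - t) * ((1 + (t - t')) * #|S|%:R) <= _).
  have pos : 0 <= 2 * B * (1 - t) by apply: mulr_ge0; [exact: mulr_ge0|move: t1; lra].
  exact: ler_wpM2l u.
rewrite mulrA; apply: ler_wpM2r => //; rewrite -mulrA; apply: ler_wpM2l; first by rewrite mulr_ge0.
by move: t0 tt; nra.
Qed.

(** [X] collects the separators of all scales. The recursion continues on the disjoint sets
    [S1 :\: S2] and [S2 :\: S1], so the fraction removed on each scale is at most the gap between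
    consecutive values of [tail]. *)
Lemma break_scale i (H : sgraph) (S : {set H}) : F H ->
  #|S|%:R <= M%:R * (4 / 3) ^+ (j0 + i) :> R ->
  exists (X : {set H}) (f : H -> nat),
    [/\ X \subset S, #|X|%:R <= (tail j0 - tail (j0 + i)) * #|S|%:R,
        forall x y, x \in S :\: X -> y \in S :\: X -> adj x y -> f x = f y &
        forall c, #|[set x in S :\: X | f x == c]|%:R <= M%:R * (4 / 3) ^+ j0 :> R].
Proof.
move=> FH; elim: i S => [|i IH] S hS.
{ exists set0, (fun _ => 0%N); split=> //; first exact: sub0set.
    by rewrite cards0 addn0 subrr mul0r.
  move=> c; rewrite addn0 in hS; apply: le_trans hS; rewrite ler_nat.
  by apply: subset_leq_card; apply/subsetP => x; rewrite !inE => /andP[/andP[]]. }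
case: (leP (#|S|%:R : R) (M%:R * (4 / 3) ^+ (j0 + i))) => h.
{ have [X [f [XS cX eX fX]]] := IH S h; exists X, f; split=> //.
  apply: le_trans cX _; apply: ler_wpM2r => //; rewrite lerB // addnS -addn1; exact: tail_le. }
have [S1 [S2 [eS [s1 s2] c e]]] := scaled_split FH h hS.
have mono (A B : {set H}) (x : R) : A \subset B -> #|B|%:R <= x -> #|A|%:R <= x.
  by move=> AB; apply: le_trans; rewrite ler_nat subset_leq_card.
have [X1 [f1 [XS1 cX1 eX1 fX1]]] := IH _ (mono _ _ _ (subsetDl S1 S2) s1).
have [X2 [f2 [XS2 cX2 eX2 fX2]]] := IH _ (mono _ _ _ (subsetDl S2 S1) s2).
have in1 x : x \in S :\: (S1 :&: S2 :|: (X1 :|: X2)) -> x \in S1 -> x \in (S1 :\: S2) :\: X1.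
  rewrite !inE !negb_or negb_and => /andP[/and3P[n12 -> _] _] x1.
  by move: n12; rewrite x1 andbT.
have in2 x : x \in S :\: (S1 :&: S2 :|: (X1 :|: X2)) -> x \in S2 -> x \in (S2 :\: S1) :\: X2.
  rewrite !inE !negb_or negb_and => /andP[/and3P[n12 _ ->] _] x2.
  by move: n12; rewrite x2 orbF => ->.
have in12 x : x \in S :\: (S1 :&: S2 :|: (X1 :|: X2)) -> x \notin S1 -> x \in S2.
  by rewrite inE -eS => /andP[_]; rewrite inE => /orP[->|].
(* Even labels name pieces of the first side, odd labels pieces of the second. *)
exists (S1 :&: S2 :|: (X1 :|: X2)), (fun x => if x \in S1 then (f1 x).*2 else (f2 x).*2.+1).
split.
- rewrite !subUset -eS (subset_trans (subsetIl _ _) (subsetUl _ _)) /=.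
  rewrite (subset_trans XS1 (subset_trans (subsetDl _ _) (subsetUl _ _))).
  by rewrite (subset_trans XS2 (subset_trans (subsetDl _ _) (subsetUr _ _))).
- have l1 : #|S1 :&: S2 :|: (X1 :|: X2)|%:R <= #|S1 :&: S2|%:R + (#|X1|%:R + #|X2|%:R) :> R.
    rewrite -!natrD ler_nat; have [h1 _] := leq_card_setU (S1 :&: S2) (X1 :|: X2).
    have [h2 _] := leq_card_setU X1 X2; apply: leq_trans h1 _; by rewrite leq_add2l.
  have l2 : #|S1 :\: S2|%:R + #|S2 :\: S1|%:R <= #|S|%:R :> R.
    rewrite -natrD ler_nat -eS -(cardsID S2 (S1 :|: S2)) addnC leq_add //.
      by rewrite setIUl setIid; apply: subset_leq_card; rewrite subsetU // subsetDl orbT.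
    by rewrite setDUl setDv setU0.
  have tt : 0 <= tail j0 - tail (j0 + i) by rewrite subr_ge0 tail_le.
  apply: le_trans l1 _; apply: le_trans (lerD c (lerD cX1 cX2)) _.
  rewrite -mulrDr; move: l2 tt; nra.
- move=> x y xS yS xy; have xS' : x \in S by move: xS; rewrite inE => /andP[].
  have yS' : y \in S by move: yS; rewrite inE => /andP[].
  case/orP: (e x y xS' yS' xy) => /andP[x1 y1].
    by rewrite x1 y1 (eX1 x y) // in1.
  have := in2 x xS x1; have := in2 y yS y1; rewrite !inE => hy hx.
  have /negPf -> : x \notin S1 by case/and3P: hx.
  have /negPf -> : y \notin S1 by case/and3P: hy.
  by rewrite (eX2 x y) // in2.
- move=> b; case eb : (odd b).
    apply: mono (fX2 b./2); apply/subsetP => x; rewrite inE => /andP[xS].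
    case: (boolP (x \in S1)) => [_ /eqP e1|x1 /eqP e1]; first by move: eb; rewrite -e1 odd_double.
    by rewrite inE in2 ?in12 //= -e1 /= uphalf_double eqxx.
  apply: mono (fX1 b./2); apply/subsetP => x; rewrite inE => /andP[xS].
  case: (boolP (x \in S1)) => [x1 /eqP e1|_ /eqP e1]; last by move: eb; rewrite -e1 /= odd_double.
  by rewrite inE in1 //= -e1 doubleK eqxx.
Qed.
End Scale.

Lemma scale_exists (M j0 : nat) (x : R) : (0 < M)%N -> exists i, x <= M%:R * (4 / 3) ^+ (j0 + i).
Proof.
move=> M0; have [|i hi] := @pow_large R (4 / 3) x; first by lra.
exists i; apply: le_trans hi _; rewrite exprD.
have h1 : 1 <= M%:R * (4 / 3 : R) ^+ j0.
  by rewrite mulr_ege1 // ?ler1n //; apply: exprn_ege1; lra.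
rewrite mulrA ler_peMl // exprn_ge0 //; lra.
Qed.

Lemma sparse_family : exists Cd : nat, (0 < Cd)%N /\
  forall H, F H -> forall S : {set H}, (arcs_in S <= Cd * #|S|)%N.
Proof.
have [|j0 hj] := @tail_small (1 / 12); first by lra.
have [Cd hC] := nat_ub (2 * (n0.+1%:R * (4 / 3) ^+ j0) : R).
exists Cd.+1; split=> // H FH S.
have [i hi] := @scale_exists n0.+1 j0 #|S|%:R (ltn0Sn _).
have := sparse_scale (ltn0Sn n0) (leqnSn n0) hj FH hi.
rewrite -(ler_nat R) natrM => h; apply: le_trans h _; apply: ler_wpM2r => //.
apply: le_trans (_ : Cd%:R <= _); last by rewrite ler_nat.
apply: le_trans hC; rewrite ler_piMr //; last first.
  by rewrite gerBl ltW // tail_gt0.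
by rewrite !mulr_ge0 ?ler0n // exprn_ge0 //; lra.
Qed.

(** The splitting stops at scale [j0 + c * J], where [lam ^+ c <= 1 / 2]: then [tail] is at most
    [1 / 2 ^ J], and [(4 / 3) ^+ (c * J)] is at most [L ^ J] for [L = 2 ^ c]. *)
Lemma small_pieces : exists M L : nat, [/\ (0 < M)%N, (0 < L)%N & forall J H, F H ->
  exists (X : {set H}) (f : H -> nat),
    [/\ (#|X| * 2 ^ J <= nverts H)%N,
        forall x y, x \notin X -> y \notin X -> adj x y -> f x = f y &
        forall c, (#|[set x | (x \notin X) && (f x == c)]| <= M * L ^ J)%N]].
Proof.
have [|j0 hj] := @tail_small (1 / 12); first by lra.
have [|c hc] := @pow_small R lam (1 / 2) lam0 lam1; first by lra.
have [M hM] := nat_ub (n0.+1%:R * (4 / 3) ^+ j0 : R).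
exists M.+1, (2 ^ c)%N; split; rewrite ?expn_gt0 // => J H FH.
have tJ : tail (j0 + c * J) * 2 ^+ J <= 1 / 12.
{ have -> : tail (j0 + c * J) = tail j0 * (lam ^+ c) ^+ J.
    by rewrite /tail exprD exprM; ring.
  rewrite -mulrA -exprMn; apply: le_trans hj; apply: ler_piMr; first exact/ltW/tail_gt0.
  apply: exprn_ile1; first by rewrite mulr_ge0 // exprn_ge0 // ltW.
  by move: hc; lra. }
have p1 : 1 <= (2 : R) ^+ J by apply: exprn_ege1; lra.
have t12 : tail (j0 + c * J) <= 1 / 12.
  by apply: le_trans tJ; rewrite ler_peMr // ltW // tail_gt0.
have [i hi] := @scale_exists n0.+1 (j0 + c * J) #|[set: H]|%:R (ltn0Sn _).
have [X [f [_ cX eX fX]]] := break_scale (ltn0Sn n0) (leqnSn n0) t12 FH hi.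
exists X, f; split.
- rewrite -(ler_nat R) natrM natrX cardsT -/(nverts H) in cX *.
  have : #|X|%:R <= tail (j0 + c * J) * (nverts H)%:R.
    apply: le_trans cX _; apply: ler_wpM2r => //; rewrite gerBl ltW //; exact: tail_gt0.
  move=> h; apply: le_trans (_ : tail (j0 + c * J) * 2 ^+ J * (nverts H)%:R <= _).
    by rewrite mulrAC; apply: ler_wpM2r => //; rewrite exprn_ge0.
  by rewrite ler_piMl // (le_trans tJ) //; lra.
- by move=> x y xX yX; apply: eX; rewrite !inE andbT.
- move=> b; rewrite -(ler_nat R); apply: le_trans (_ : M%:R * (2 ^+ c) ^+ J <= _); last first.
    by rewrite natrM !natrX; apply: ler_wpM2r; rewrite ?ler_nat // !exprn_ge0.
  apply: le_trans (_ : (n0.+1%:R * (4 / 3) ^+ j0) * (2 ^+ c) ^+ J <= _); last first.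
    by apply: ler_wpM2r => //; rewrite !exprn_ge0.
  apply: le_trans (_ : n0.+1%:R * (4 / 3) ^+ (j0 + c * J) <= _).
    apply: le_trans (fX b); rewrite ler_nat; apply: subset_leq_card.
    by apply/subsetP => x; rewrite !inE andbT.
  rewrite exprD mulrA -exprM; apply: ler_wpM2l; first by rewrite mulr_ge0 ?ler0n // exprn_ge0 //; lra.
  by apply: lerXn2r; rewrite ?nnegrE //; lra.
Qed.
End Separators.

(** With [lam = (4 / 3) ^ (beta - 1)]: the bound [#|S| ^ beta] is [#|S|] times [#|S| ^ (beta - 1)],
    and the last factor is at most [lam ^+ j]. Closure under subgraphs passes from [H] to its
    subsets. *)
Lemma separator_decay (R : realType) (F : sgraph -> Prop) :
  strongly_sublinear_separators R F ->
  exists (C1 lam : R) (n0 : nat), [/\ 0 < lam, lam < 1, 0 < C1 &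
   forall (H : sgraph), F H -> forall S : {set H}, (n0 <= #|S|)%N ->
  forall j, (4 / 3) ^+ j <= #|S|%:R :> R -> exists S1 S2 : {set H},
    [/\ S1 :|: S2 = S, #|S|%:R <= 3 * #|S1|%:R :> R /\ #|S|%:R <= 3 * #|S2|%:R :> R,
        #|S1 :&: S2|%:R <= C1 * lam ^+ j * #|S|%:R &
        forall x y, x \in S -> y \in S -> adj x y ->
          ((x \in S1) && (y \in S1)) || ((x \in S2) && (y \in S2))]].
Proof.
move=> [Fc [beta [C [n0 [b1 C0 hsep]]]]].
have b0 : 0 < 1 - beta by rewrite subr_gt0.
have l1 : 1 < (4 / 3 : R) `^ (1 - beta).
  have := @gt0_ltr_powR R (1 - beta) b0 1 (4 / 3); rewrite powR1 !nnegrE; apply; lra.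
have l0 : 0 < (4 / 3 : R) `^ (1 - beta) by apply: lt_trans l1.
exists C, ((4 / 3) `^ (1 - beta))^-1, n0; split=> //; rewrite ?invr_gt0 ?invf_lt1 //.
move=> H FH S nS j jS.
have FS : F (induced S) by apply: Fc FH; apply: induced_subgraph.
have [|A1 [A2 [[AU Ae _ _] [A1b A2b] Ao]]] := hsep (induced S) FS; first by rewrite nverts_induced.
rewrite !nverts_induced in A1b A2b Ao.
have cv (A : {set induced S}) : #|val @: A| = #|A| by rewrite card_imset //; apply: val_inj.
exists (val @: A1), (val @: A2); split.
- apply/setP => x; rewrite -imsetU AU; apply/imsetP/idP => [[y _ ->]|xS]; first exact: (valP y).
  by exists (Sub x xS); rewrite ?SubK.
- by rewrite !cv; move: A1b A2b; clear; lra.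
- rewrite -imsetI; last by move=> x y _ _; apply: val_inj.
  rewrite cv; apply: le_trans Ao _; rewrite -mulrA; apply: ler_wpM2l; first exact: ltW.
  have p0 : 0 < (4 / 3 : R) ^+ j by apply: exprn_gt0; lra.
  have S0 : 0 < #|S|%:R :> R by apply: lt_le_trans jS.
  have -> : #|S|%:R `^ beta = #|S|%:R * (#|S|%:R `^ (1 - beta))^-1 :> R.
    apply: (mulIf (x := #|S|%:R `^ (1 - beta))); first by rewrite gt_eqF ?powR_gt0.
    rewrite mulfVK ?gt_eqF ?powR_gt0 // -powRD; last by rewrite (gt_eqF S0) implybT.
    by rewrite addrC subrK powRr1 ?ltW.
  rewrite mulrC; apply: ler_wpM2r; first exact: ltW.
  have q0 : 0 < (4 / 3 : R) by lra.
  rewrite exprVn lef_pV2 ?posrE ?exprn_gt0 ?powR_gt0 //.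
  have e43 : (4 / 3 : R) `^ j%:R = (4 / 3) ^+ j by apply: powR_mulrn; lra.
  rewrite -powR_mulrn ?powR_ge0 // -powRrM [(1 - beta) * _]mulrC powRrM e43.
  apply: ge0_ler_powR jS; rewrite ?nnegrE; exact: ltW.
- move=> x y xS yS xy; have /= := Ae (Sub x xS) (Sub y yS).
  rewrite /induced_adj !SubK => /(_ xy).
  have im (A : {set induced S}) z zS : Sub z zS \in A -> z \in val @: A.
    by move=> zA; apply/imsetP; exists (Sub z zS).
  by move=> /orP[/andP[h1 h2]|/andP[h1 h2]]; rewrite (im _ _ _ h1) (im _ _ _ h2) ?orbT.
Qed.

(** * Groups of bounded size *)

Lemma vertex_coverT (H : sgraph) : vertex_cover [set: H].
Proof. by apply/forallP => x; apply/forallP => y; apply/implyP => _; rewrite inE. Qed.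

Lemma tau_cover (H : sgraph) : exists C : {set H}, vertex_cover C /\ #|C| = tau H.
Proof.
rewrite /tau; case: arg_minnP => [|C cC _]; first exact: vertex_coverT.
by exists C.
Qed.

Lemma tau_le (H : sgraph) (C : {set H}) : vertex_cover C -> (tau H <= #|C|)%N.
Proof.
by move=> cC; rewrite /tau; case: arg_minnP => [|D _]; [exact: vertex_coverT|apply].
Qed.

Lemma tau_leq (H : sgraph) : (tau H <= nverts H)%N.
Proof. by apply: leq_trans (tau_le (vertex_coverT H)) _; rewrite cardsT. Qed.

Lemma cover_ratio_ge (R : realType) (F : sgraph -> Prop) (H : sgraph) :
  (0 < nverts H)%N -> (forall k, F (copies k H)) ->
  (tau H)%:R <= cover_ratio R F * (nverts H)%:R.
Proof.
move=> n0 hk; rewrite -ler_pdivrMr ?ltr0n //; apply: ub_le_sup; last by exists H.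
exists 1 => _ [H' [h1 _ ->]]; rewrite ler_pdivrMr ?ltr0n // mul1r ler_nat; exact: tau_leq.
Qed.

Lemma subgraph_copies (k : nat) (H G : sgraph) : subgraph H G -> subgraph (copies k H) (copies k G).
Proof.
move=> [f [fi fe]]; exists (fun p => (p.1, f p.2)); split=> [[i x] [j y] [-> /fi -> //]|[i x] [j y]].
by rewrite /= /copies_adj /= => /andP[-> /fe].
Qed.

Lemma subgraph_inducedS (H : sgraph) (S Q : {set H}) : S \subset Q ->
  subgraph (induced S) (induced Q).
Proof.
move=> sub; exists (fun x : induced S => Sub (val x) (subsetP sub _ (valP x)) : induced Q); split=> //.
by move=> x y /(congr1 val) /= /val_inj.
Qed.

(** The copies of [induced S] lie in the family too, so [S] has a vertex cover of proportion at most
    [cover_ratio R F]; its complement is the independent set. *)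
Lemma persistent_thin (R : realType) (F : sgraph -> Prop) (H : sgraph) (Q : {set H}) :
  subgraph_closed F -> (forall k, F (copies k (induced Q))) -> thin (cover_ratio R F) Q.
Proof.
move=> Fc hk S SQ; case: (posnP #|S|) => [S0|S0].
  by exists set0; split; rewrite ?sub0set ?S0 ?mulr0 ?cards0 // => x y; rewrite inE.
have hS k : F (copies k (induced S)).
  by apply: Fc (hk k); apply: subgraph_copies; apply: subgraph_inducedS.
have nS := nverts_induced S.
have := @cover_ratio_ge R F (induced S); rewrite nS => /(_ S0 hS) hr.
have [C [cC sC]] := tau_cover (induced S).
exists (val @: ~: C); split.
- by apply/subsetP => _ /imsetP[y _ ->]; apply: (valP y).
- move=> _ _ /imsetP[x xC ->] /imsetP[y yC ->]; apply/negP => xy.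
  have /forallP/(_ x)/forallP/(_ y)/implyP := cC; rewrite inE in xC; rewrite inE in yC.
  by rewrite (negPf xC) (negPf yC) => /(_ xy).
- rewrite card_imset; last exact: val_inj.
  have : (#|C| + #|~: C|)%:R = #|S|%:R :> R by rewrite cardsC -/(nverts (induced S)) nS.
  by rewrite natrD sC; move: hr; clear; lra.
Qed.

(** * Finitely many isomorphism types of groups *)

Section Codes.
Variable q0 : nat.

(* Finitely many labelled graphs represent all isomorphism types of graphs with at
   most [q0] vertices. *)
Definition code := ({set 'I_q0} * {ffun 'I_q0 * 'I_q0 -> bool})%type.

Definition code_adj (c : code) : rel 'I_q0 :=
  fun i j => [&& i != j, c.2 (i, j) & c.2 (j, i)].

Lemma code_sym c : symmetric (code_adj c).
Proof. by move=> i j; rewrite /code_adj eq_sym; case: (c.2 (i, j)); case: (c.2 (j, i)). Qed.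

Lemma code_irrefl c : irreflexive (code_adj c).
Proof. by move=> i; rewrite /code_adj eqxx. Qed.

Definition code_graph c : sgraph := SGraph (@code_sym c) (@code_irrefl c).

Definition encodes (H : sgraph) (S : {set H}) (c : code) (f : 'I_q0 -> H) : Prop :=
  [/\ {in c.1 &, injective f}, f @: c.1 = S &
      {in c.1 &, forall i j, adj (f i) (f j) = code_adj c i j}].

Lemma encoding (H : sgraph) (x0 : H) (S : {set H}) : (#|S| <= q0)%N ->
  exists (c : code) (f : 'I_q0 -> H), encodes S c f.
Proof.
move=> le; pose f (i : 'I_q0) := nth x0 (enum S) i.
pose A := [set i : 'I_q0 | (i < #|S|)%N].
have fi : {in A &, injective f}.
  move=> i j; rewrite !inE => iS jS /eqP; rewrite /f nth_uniq -?cardE ?enum_uniq // => /eqP.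
  exact: val_inj.
exists (A, [ffun p => adj (f p.1) (f p.2)]), f; split=> //=.
- apply/setP => x; apply/imsetP/idP => [[i]|xS].
    by rewrite inE => iS ->; rewrite -mem_enum mem_nth // -cardE.
  have ix : (index x (enum S) < #|S|)%N by rewrite cardE index_mem mem_enum.
  by exists (Ordinal (leq_trans ix le)); rewrite ?inE // /f /= nth_index // mem_enum.
- move=> i j iA jA; rewrite /code_adj /= !ffunE /= [adj (f j) _]adjC andbb.
  by case: eqP => //= ->; rewrite adjxx.
Qed.

Lemma encodes_thin (R : realType) (r : R) (H : sgraph) (S : {set H}) c f :
  encodes S c f -> thin r (c.1 : {set code_graph c}) -> thin r S.
Proof.
move=> [fi fS fa] tc T TS; pose T' : {set code_graph c} := [set i in c.1 | f i \in T].
have T'c : T' \subset c.1 by apply/subsetP => i; rewrite inE => /andP[].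
have cf (A : {set 'I_q0}) : A \subset c.1 -> #|f @: A| = #|A|.
  by move=> s; apply: card_in_imset => i j iA jA; apply: fi; apply: (subsetP s).
have fT : f @: T' = T.
{ apply/setP => x; apply/imsetP/idP => [[i]|xT]; first by rewrite inE => /andP[_ h] ->.
  have : x \in f @: c.1 by rewrite fS (subsetP TS).
  by move=> /imsetP[i ic e]; exists i; rewrite // inE ic -e. }
have [I [IT iI cI]] := tc T' T'c; have Ic := subset_trans IT T'c.
exists (f @: I); split.
- by rewrite -fT imsetS.
- move=> _ _ /imsetP[i iI' ->] /imsetP[j jI' ->]; rewrite fa; try exact: (subsetP Ic).
  exact: iI.
- by rewrite -fT !cf.
Qed.

Lemma encoded_copies (k g : nat) (H : sgraph) (P : nat -> {set H}) c (f : nat -> 'I_q0 -> H)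
    (Z : {set 'I_g}) :
  (forall i j, (i < g)%N -> (j < g)%N -> i != j -> [disjoint P i & P j]) ->
  (forall i, i \in Z -> encodes (P i) c (f i)) -> (k <= #|Z|)%N ->
  subgraph (copies k (induced (c.1 : {set code_graph c}))) H.
Proof.
move=> dP eZ kZ.
pose z (a : 'I_k) : 'I_g := enum_val (widen_ord kZ a).
have zZ a : z a \in Z by apply: enum_valP.
exists (fun p => f (z p.1) (val p.2)); split=> [[a v] [b w] /=|[a v] [b w] /=].
- move=> e; case: (eqVneq (z a) (z b)) => [ez|nz].
    have /(congr1 val) /= eab := enum_val_inj ez.
    have ab : a = b by apply: val_inj.
    subst b; have [fi _ _] := eZ _ (zZ a).
    by congr pair; apply: val_inj; apply: fi => //; [exact: (valP v)|exact: (valP w)].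
  have /pred0P/(_ (f (z a) (val v))) := dP _ _ (ltn_ord (z a)) (ltn_ord (z b)) nz.
  have [_ <- _] := eZ _ (zZ a); have [_ <- _] := eZ _ (zZ b).
  rewrite /= imset_f; last exact: (valP v).
  by rewrite /= e imset_f //; apply: (valP w).
- rewrite /copies_adj /= => /andP[/eqP <- h].
  by have [_ _ ->] := eZ _ (zZ a); [exact: h|exact: (valP v)|exact: (valP w)].
Qed.
End Codes.

(** For each code whose graph is not thin, [persistent_thin] gives a number [K c] of copies that is
    not in the family, so at most [K c] of the disjoint groups have this type. *)
Lemma few_thick (R : realType) (F : sgraph -> Prop) (q0 : nat) : subgraph_closed F ->
  exists B : nat, forall H, F H -> (0 < nverts H)%N -> forall (g : nat) (P : nat -> {set H}),
    (forall i, (i < g)%N -> #|P i| <= q0)%N ->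
    (forall i j, (i < g)%N -> (j < g)%N -> i != j -> [disjoint P i & P j]) ->
    exists Bad : {set 'I_g}, (#|Bad| <= B)%N /\
      forall i : 'I_g, i \notin Bad -> thin (cover_ratio R F) (P i).
Proof.
move=> Fc; set r := cover_ratio R F.
have exk (c : code q0) : exists k, ~ thin r (c.1 : {set code_graph c}) ->
    ~ F (copies k (induced (c.1 : {set code_graph c}))).
{ case: (classic (thin r (c.1 : {set code_graph c}))) => [t|nt]; first by exists 0%N.
  apply: NNPP => no; apply: nt; apply: persistent_thin => // k; apply: NNPP => nF.
  by apply: no; exists k. }
have [K hK] := boolp.choice exk.
exists (\sum_c K c)%N => H FH /card_gt0P[x0 _] g P sP dP.
have exc i : exists cf : code q0 * ('I_q0 -> H), (i < g)%N -> encodes (P i) cf.1 cf.2.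
{ case: (ltnP i g) => lti.
    by have [c [f h]] := encoding x0 (sP i lti); exists (c, f).
  have [|c [f _]] := @encoding q0 H x0 set0; first by rewrite cards0.
  by exists (c, f). }
have [cf hcf] := boolp.choice exc.
pose Bad := [set i : 'I_g | boolp.asbool (~ thin r ((cf i).1.1 : {set code_graph (cf i).1}))].
exists Bad; split; last first.
  move=> i; rewrite inE => /boolp.asboolPn h.
  by apply: encodes_thin (hcf i (ltn_ord i)) _; apply: NNPP.
rewrite -sum1_card (partition_big (fun i : 'I_g => (cf i).1) xpredT) //=.
apply: leq_sum => c _; rewrite sum1_card leqNgt; apply/negP => lt.
pose Z := [set i in Bad | (cf i).1 == c].
have eZ : #|Z| = #|[pred i : 'I_g | (i \in Bad) && ((cf i).1 == c)]|.
  by apply: eq_card => i; rewrite !inE.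
rewrite -eZ in lt.
have [i] : exists i, i \in Z by apply/card_gt0P; apply: leq_ltn_trans lt.
rewrite !inE => /andP[/boolp.asboolP h /eqP ec]; rewrite ec in h.
apply: (hK c h); apply: Fc FH.
apply: (encoded_copies (P := P) (f := fun i => (cf i).2) (Z := Z)) => //; last exact: ltnW.
by move=> j; rewrite !inE => /andP[_ /eqP <-]; apply: hcf.
Qed.

(* Pieces are laid end to end and cut at multiples of [q0 - C0], a piece being
   kept whole in the bin in which it starts. *)
Lemma bin_packing (H : finType) (X : {set H}) (f : H -> nat) (C0 q0 : nat) : (C0 < q0)%N ->
  (forall c, #|[set x | (x \notin X) && (f x == c)]| <= C0)%N ->
  exists lab : H -> nat, [/\ forall x y, f x = f y -> lab x = lab y,
    forall x, (lab x < #|H| %/ (q0 - C0) + 1)%N &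
    forall i, (#|[set x | (x \notin X) && (lab x == i)]| <= q0)%N].
Proof.
move=> Cq fib; set w := (q0 - C0)%N; have w0 : (0 < w)%N by rewrite subn_gt0.
pose below a := [set y | (y \notin X) && (f y < a)%N].
exists (fun x => #|below (f x)| %/ w)%N; split=> [x y -> //|x|i].
  by rewrite addn1 ltnS leq_div2r // max_card.
set Gi := [set x | _].
case: (set_0Vmem Gi) => [->|[v vG]]; first by rewrite cards0.
case: (arg_maxnP f vG) => x xG hx; case: (arg_minnP f vG) => z zG hz.
have sub : Gi \subset (below (f x) :\: below (f z)) :|: [set y | (y \notin X) && (f y == f x)].
{ apply/subsetP => y yG; have := hx y yG; have := hz y yG.
  move: yG; rewrite !inE => /andP[-> _] /=; rewrite -leqNgt => -> /=.
  by rewrite orbC -leq_eqVlt. }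
apply: leq_trans (subset_leq_card sub) _.
have [h1 _] := leq_card_setU (below (f x) :\: below (f z)) [set y | (y \notin X) && (f y == f x)].
apply: leq_trans h1 _; have h2 := fib (f x).
have zx : below (f z) \subset below (f x).
  apply/subsetP => y; rewrite !inE => /andP[-> /= lt]; apply: leq_trans lt _; exact: hx.
rewrite cardsD (setIidPr zx).
have ex : (#|below (f x)| %/ w = i)%N by move: (xG : x \in Gi); rewrite inE => /andP[_ /eqP].
have ez : (#|below (f z)| %/ w = i)%N by move: (zG : z \in Gi); rewrite inE => /andP[_ /eqP].
have := ltn_ceil #|below (f x)| w0; have := leq_trunc_div #|below (f z)| w; rewrite ex ez mulSn.
by move: h2 Cq w0; rewrite /w; clear; lia.
Qed.

(** The groups are disjoint, and each member of [group_nbr] is the head of an arc leaving the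
    group. *)
Lemma sum_group_nbr (H : sgraph) (X : {set H}) (lab : H -> nat) (g : nat) :
  (\sum_(i < g) #|group_nbr X lab i| <= arcs H)%N.
Proof.
apply: leq_trans (_ : \sum_(i < g) \sum_(x in group X lab i) #|nbr x| <= _)%N.
  apply: leq_sum => i _; apply: leq_trans (card_bigcup_le _ _).
  apply: subset_leq_card; apply/subsetP => y; rewrite inE => /andP[_ /existsP[x /andP[xi xy]]].
  by apply/bigcupP; exists x; rewrite // in_nbr.
rewrite (eq_bigr (fun i : 'I_g => \sum_(x | x \in group X lab i) #|nbr x|)%N) //.
rewrite (exchange_big_dep xpredT) //= /arcs; apply: leq_sum => x _.
rewrite sum_nat_const; apply: leq_trans (_ : 1 * #|nbr x| <= _)%N; last by rewrite mul1n.
rewrite leq_mul2r; apply/orP; right; apply/card_le1_eqP => i j.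
move=> h1 h2; have k1 : x \in group X lab i := h1; have k2 : x \in group X lab j := h2.
by move: k1 k2; rewrite !inE => /andP[_ /eqP e1] /andP[_ /eqP e2]; apply: val_inj; rewrite /= -e1.
Qed.

(** Groups that are not thin or have too many neighbours in [X] are moved into [X] and become empty.
    The second kind is rare because the family is sparse. The separators and the two kinds of groups
    each contribute at most [nverts H] to the final bound [3 * nverts H]. *)
Lemma family_structure (R : realType) (F : sgraph -> Prop) :
  strongly_sublinear_separators R F ->
  exists Cd M L : nat, [/\ (0 < Cd)%N, (0 < M)%N, (0 < L)%N,
    (forall H, F H -> forall S : {set H}, arcs_in S <= Cd * #|S|)%N &
    forall J q0, (M * L ^ J < q0)%N -> exists n0, forall H, F H -> (n0 <= nverts H)%N ->
    exists (X : {set H}) (lab : H -> nat), let g := (nverts H %/ (q0 - M * L ^ J) + 1)%N in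
      [/\ forall x y, x \notin X -> y \notin X -> adj x y -> lab x = lab y,
          forall x, x \notin X -> (lab x < g)%N,
          forall i, (i < g)%N -> (#|group X lab i| <= q0)%N /\ thin (cover_ratio R F) (group X lab i),
          forall i, (i < g)%N -> (#|group_nbr X lab i| <= Cd * q0 * 2 ^ J)%N &
          (#|X| * 2 ^ J <= 3 * nverts H)%N]].
Proof.
move=> hF; have [C1 [lam [n1 [lam0 lam1 C10 sepS]]]] := separator_decay hF.
have [Cd [Cd0 hCd]] := sparse_family lam0 lam1 C10 sepS.
have [M [L [M0 L0 hML]]] := small_pieces lam0 lam1 C10 sepS.
exists Cd, M, L; split=> // J q0 hq; set C0 := (M * L ^ J)%N in hq *.
have Fc : subgraph_closed F by case: hF.
have [B hB] := @few_thick R F q0 Fc.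
exists (2 ^ J * (q0 * B)).+1 => H FH nH.
have [X [f [sX eX fX]]] := hML J H FH.
have [lab [lab1 lab2 lab3]] := bin_packing hq fX.
set g := (nverts H %/ (q0 - C0) + 1)%N.
have dG i j : (i < g)%N -> (j < g)%N -> i != j -> [disjoint group X lab i & group X lab j].
  move=> _ _ ij; apply/pred0P => x /=; rewrite !inE; apply/negP => /andP[/andP[_ /eqP e1] /andP[_ /eqP e2]].
  by move: ij; rewrite -e1 e2 eqxx.
have H0 : (0 < nverts H)%N by apply: leq_trans nH.
have [Bad [sB hBad]] := hB H FH H0 g (group X lab) (fun i _ => lab3 i) dG.
pose Heavy := [set i : 'I_g | (Cd * q0 * 2 ^ J < #|group_nbr X lab i|)%N].
pose Removed := Bad :|: Heavy.
pose X' := X :|: [set x | [exists i : 'I_g, (i \in Removed) && (lab x == i)]].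
have XX' x : x \notin X' -> x \notin X by rewrite inE negb_or => /andP[].
have grp (i : 'I_g) : i \notin Removed -> group X' lab i = group X lab i.
{ move=> iD; apply/setP => x; rewrite !inE negb_or; case: (eqVneq (lab x) i) => e; rewrite ?andbF //=.
  rewrite !andbT; case: (x \in X) => //=; apply/existsPn => j; apply: contra iD => /andP[jD /eqP ej].
  by rewrite (_ : i = j) //; apply: val_inj; rewrite /= -e ej. }
have grp0 (i : 'I_g) : i \in Removed -> group X' lab i = set0.
{ move=> iD; apply/setP => x; rewrite !inE negb_or; apply/negP => /andP[/andP[_ /existsPn /(_ i)]].
  by rewrite iD /= => /negPf ->. }
have nbr0 i : group X' lab i = set0 -> group_nbr X' lab i = set0.
  by move=> e; apply/setP => y; rewrite !inE e; apply/negP => /andP[_ /existsP[x]]; rewrite inE.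
have thin0 : thin (cover_ratio R F) (set0 : {set H}).
  move=> S; rewrite subset0 => /eqP ->; exists set0; split; rewrite ?sub0set ?cards0 ?mulr0 // => x y.
  by rewrite inE.
exists X', lab; split.
- by move=> x y /XX' xX /XX' yX xy; apply: lab1; apply: eX.
- by move=> x _; apply: lab2.
- move=> i lti; have := grp (Ordinal lti); have := grp0 (Ordinal lti).
  case: (boolP (Ordinal lti \in Removed)) => [iD /(_ isT) -> _|iD _ /(_ isT) ->]; first by rewrite cards0.
  split; first exact: lab3.
  by apply: (hBad (Ordinal lti)); apply: contra iD => h; rewrite inE h.
- move=> i lti; case: (boolP (Ordinal lti \in Removed)) => iD.
    by rewrite nbr0 ?cards0 //; apply: (grp0 (Ordinal lti)).
  have e := grp _ iD; rewrite /= in e.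
  have nH' : (#|group_nbr X lab i| <= Cd * q0 * 2 ^ J)%N.
    by rewrite leqNgt; apply: contra iD => h; rewrite !inE h orbT.
  apply: leq_trans nH'; apply: subset_leq_card; apply/subsetP => y; rewrite !inE e.
  move=> /andP[yX' /existsP[x /andP[xi xy]]].
  (* A vertex moved into [X'] with its group has no neighbour in other groups, so a surviving group
     gains no neighbours. *)
  have yX : y \in X.
  { case: (boolP (y \in X)) => // yX; rewrite (negPf yX) /= in yX'.
    have /existsP[j /andP[jD /eqP ej]] := yX'.
    have [xX /eqP ex] : x \notin X /\ lab x == i by move: xi; rewrite inE => /andP.
    have exy : lab x = lab y by apply: lab1; apply: eX.
    by move: iD; rewrite (_ : Ordinal lti = j) ?jD //; apply: val_inj; rewrite /= -ex exy ej. }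
  by rewrite yX /=; apply/existsP; exists x; rewrite xi.
- have sX' : (#|X'| <= #|X| + #|Removed| * q0)%N.
  { have sub : X' \subset X :|: \bigcup_(i in Removed) group X lab i.
      apply/subsetP => x; rewrite !inE => /orP[->//|/existsP[i /andP[iD e]]].
      by case: (boolP (x \in X)) => //= xX; apply/bigcupP; exists i; rewrite // inE xX.
    apply: leq_trans (subset_leq_card sub) _.
    have [h _] := leq_card_setU X (\bigcup_(i in Removed) group X lab i).
    apply: leq_trans h _; rewrite leq_add2l; apply: leq_trans (card_bigcup_le _ _) _.
    by rewrite -sum_nat_const; apply: leq_sum => i _; apply: lab3. }
  have sD : (#|Removed| <= B + #|Heavy|)%N.
    by have [h _] := leq_card_setU Bad Heavy; apply: leq_trans h _; rewrite leq_add2r.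
  have sH : (#|Heavy| * (q0 * 2 ^ J) <= nverts H)%N.
  { rewrite -(leq_pmul2l Cd0); have := hCd H FH [set: H]; rewrite arcs_setT cardsT => hA.
    apply: leq_trans hA; apply: leq_trans (sum_group_nbr X lab g).
    apply: leq_trans (_ : \sum_(i in Heavy) #|group_nbr X lab i| <= _)%N.
      have -> : (Cd * (#|Heavy| * (q0 * 2 ^ J)) = #|Heavy| * (Cd * q0 * 2 ^ J))%N.
        by rewrite mulnCA !mulnA.
      by rewrite -sum_nat_const; apply: leq_sum => i; rewrite inE => /ltnW.
    by rewrite [leqRHS](bigID (mem Heavy)) /= leq_addr. }
  apply: leq_trans (_ : (#|X| + (B + #|Heavy|) * q0) * 2 ^ J <= _)%N.
    by rewrite leq_mul2r (leq_trans sX') ?orbT // leq_add2l leq_mul2r sD orbT.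
  rewrite !mulnDl; move: sX sH nH; rewrite -!mulnA [(2 ^ J * _)%N]mulnC -!mulnA; clear.
  by lia.
Qed.

(** * The upper bound *)

Lemma truncn_near (R : realType) (x : R) : 0 <= x ->
  exists n : nat, x < n%:R /\ n%:R <= x + 1.
Proof. by move=> x0; exists (Num.truncn x).+1; rewrite truncnS_gt -natr1 lerD2r truncn_le. Qed.

(* The sizes needed by [tile_universal] for groups of size [E]; the inequalities
   between them, needed by [rich_cheap], are where [2 / 3 <= r] is used. *)
Lemma tile_sizes (R : realType) (r : R) (E : nat) : 2 / 3 <= r -> r <= 1 ->
  exists e1 e2 t1 t2 t3 : nat,
  [/\ [/\ (1 - r + r ^+ 3) * E%:R + 1 <= t1%:R, r * (1 - r) * E%:R + 1 <= t2%:R &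
          r ^+ 2 * E%:R <= t3%:R],
      (1 - r + r ^+ 2) * E%:R + 1 <= e1%:R /\ r * E%:R <= e2%:R,
      [/\ (t1 <= t2 + t3)%N, (e2 <= t2 + t3)%N & (e1 <= 2 * (t2 + t3))%N],
      [/\ (0 < t1)%N, (0 < e1)%N & (0 < t2 + t3)%N] &
      (t2 + t3)%:R <= r * E%:R + 3].
Proof.
move=> r0 r1; set e := E%:R; have e0 : 0 <= e by rewrite ler0n.
(* Up to rounding, [t1 <= t2 + t3] follows from [1 <= r ^+ 2 + r], and [e1 <= 2 * (t2 + t3)] from
   [1 + r ^+ 2 <= 3 * r]. *)
have i1 : 0 <= (r * e - (1 - r + r ^+ 3) * e).
  have -> : r * e - (1 - r + r ^+ 3) * e = (1 - r) * (r ^+ 2 + r - 1) * e by ring.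
  apply: mulr_ge0 => //; apply: mulr_ge0; first by rewrite subr_ge0.
  by move: r0; clear; nra.
have i2 : 0 <= (2 * r * e - (1 - r + r ^+ 2) * e).
  have -> : 2 * r * e - (1 - r + r ^+ 2) * e = (3 * r - 1 - r ^+ 2) * e by ring.
  by apply: mulr_ge0 => //; move: r0 r1; clear; nra.
have p1 : 0 <= (1 - r + r ^+ 3) * e.
  apply: mulr_ge0 => //; apply: addr_ge0; [by rewrite subr_ge0|apply: exprn_ge0; lra].
have p2 : 0 <= r * (1 - r) * e by apply: mulr_ge0 => //; apply: mulr_ge0; lra.
have p3 : 0 <= r ^+ 2 * e by apply: mulr_ge0 => //; apply: exprn_ge0; lra.
have p4 : 0 <= (1 - r + r ^+ 2) * e.
  apply: mulr_ge0 => //; apply: addr_ge0; [by rewrite subr_ge0|apply: exprn_ge0; lra].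
have p5 : 0 <= r * e by apply: mulr_ge0 => //; lra.
have [t1 [a1 b1]] := truncn_near p1; have [t2 [a2 b2]] := truncn_near p2.
have [t3 [a3 b3]] := truncn_near p3; have [e1 [a4 b4]] := truncn_near p4.
have [e2 [a5 b5]] := truncn_near p5.
have s23 : r * (1 - r) * e + r ^+ 2 * e = r * e by ring.
have cv (x y : nat) : x%:R < y%:R + 1 :> R -> (x <= y)%N by rewrite natr1 ltr_nat ltnS.
exists e1.+1, e2, t1.+1, t2.+1, t3; split.
- by split; rewrite -?natr1; lra.
- by split; rewrite -?natr1; lra.
- by split; apply: cv; rewrite ?natrM ?natrD -?natr1; lra.
- by split; rewrite // addSn.
- by rewrite natrD -natr1; lra.
Qed.

Lemma dense_host (H G : sgraph) (D p q : nat) : (0 < p)%N -> (9 * p <= D)%N -> (D <= q * p)%N ->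
  (0 < nverts G)%N -> ~ minor H G -> (2 * D * nverts G < arcs G)%N ->
  exists G' : sgraph, ~ minor H G' /\ host G' (D - 2 * p) p (40 * q + 20).
Proof.
move=> p0 pD Dq G0 nm hA.
have vG : (2 * p <= nverts G)%N.
{ have := arcs_le G; have : (nverts G * (nverts G).-1 <= nverts G * nverts G)%N.
    by rewrite leq_mul2l leq_pred orbT.
  move=> h1 h2; have : (2 * D * nverts G < nverts G * nverts G)%N by apply: leq_trans hA (leq_trans h2 h1).
  by rewrite ltn_pmul2r // => h; move: h pD; clear; lia. }
have Pm (G1 G2 : sgraph) : ~ minor H G1 -> minor G2 G1 -> ~ minor H G2.
  by move=> n1 m12 h; apply: n1; apply: minor_trans m12.
have p2D : (2 * p <= D)%N by move: pD; clear; lia.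
have hA' : (2 * D * nverts G < arcs G + 2 * D * p)%N by exact: leq_trans hA (leq_addr _ _).
have [G1 [nm1 [deg cod con sz ar]]] := minimal_graph Pm p0 p2D nm vG hA'.
have ar' : (arcs G1 <= 2 * D * nverts G1 + 2)%N by move: ar; clear; lia.
have [G2 [m2 h2]] := @host_exists G1 D p q p0 pD Dq deg cod con ar' sz.
by exists G2; split=> //; apply: Pm nm1 m2.
Qed.

(** Everything is compared after multiplication by [rho * s]: the groups need at most
    [(1 - 5 * eta) * D1], the tiles offer [(1 - 3 * eta) * D1], and the difference pays [eta * D1]
    for tiles with undominated vertices and [eta * D1] for the two roundings. *)
Lemma room (R : realType) (eps r eta E rho n D1 s g1 u1 t : R) :
  0 < eps -> eps <= 1 -> 2 / 3 <= r -> r <= 1 -> eta = eps / 168 -> 0 < s -> 0 < E ->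
  16 <= eps * E -> 0 < rho -> rho <= r * E + 3 -> 0 <= n -> 0 < D1 ->
  (1 - eta) * ((r + eps / 3) * n) <= D1 -> g1 * ((1 - eta) * (E * s)) <= n ->
  rho * s * u1 <= eta * D1 -> 2 * (rho * s) <= eta * D1 ->
  (1 - eta) * ((1 - 2 * eta) * D1 / rho) <= s * t -> g1 + 1 + (u1 + 1) <= t.
Proof.
move=> e0 e1 r0 r1 he s0 E0 hE rho0 hrho n0 D0 hD hg hu h2 ht.
have eta0 : 0 < eta by rewrite he; lra.
have eta1 : eta <= 1 / 168 by rewrite he; lra.
(* The additive 3 costs at most [eps / 4 * E], and the loss [7 * eta = eps / 24] fits between
   [eps / 4] and [eps / 3]. *)
have h1 : rho <= (1 - 7 * eta) * (r + eps / 3) * E.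
{ apply: le_trans hrho _; apply: le_trans (_ : (r + eps / 4) * E <= _).
    by move: hE; clear; nra.
  by apply: ler_wpM2r; [exact: ltW|rewrite he; move: e0 e1 r0 r1; clear; nra]. }
have h3 : rho * n <= (1 - eta) * ((1 - 5 * eta) * (E * D1)).
{ apply: le_trans (_ : (1 - 7 * eta) * (r + eps / 3) * E * n <= _); first exact: ler_wpM2r.
  apply: le_trans (_ : (1 - eta) * (1 - 5 * eta) * E * ((1 - eta) * ((r + eps / 3) * n)) <= _); last first.
    have -> : (1 - eta) * ((1 - 5 * eta) * (E * D1)) = (1 - eta) * (1 - 5 * eta) * E * D1 by ring.
    by apply: ler_wpM2l hD; apply: mulr_ge0; [apply: mulr_ge0; lra|exact: ltW].
  have -> : (1 - eta) * (1 - 5 * eta) * E * ((1 - eta) * ((r + eps / 3) * n)) =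
     ((1 - eta) * (1 - 5 * eta) * (1 - eta)) * ((r + eps / 3) * (E * n)) by ring.
  have -> : (1 - 7 * eta) * (r + eps / 3) * E * n = (1 - 7 * eta) * ((r + eps / 3) * (E * n)) by ring.
  apply: ler_wpM2r; last by move: eta0 eta1; clear; nra.
  by apply: mulr_ge0; [lra|apply: mulr_ge0; [exact: ltW|]]. }
have h4 : rho * s * g1 <= (1 - 5 * eta) * D1.
{ have c0 : 0 < (1 - eta) * E by apply: mulr_gt0 => //; lra.
  rewrite -(ler_pM2l c0); apply: le_trans (_ : rho * n <= _).
    have -> : (1 - eta) * E * (rho * s * g1) = rho * (g1 * ((1 - eta) * (E * s))) by ring.
    by apply: ler_wpM2l hg; exact: ltW.
  by apply: le_trans h3 _; rewrite le_eqVlt; apply/orP; left; apply/eqP; ring. }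
have h5 : (1 - 3 * eta) * D1 <= rho * s * t.
{ have : rho * ((1 - eta) * ((1 - 2 * eta) * D1 / rho)) <= rho * (s * t).
    by apply: ler_wpM2l ht; exact: ltW.
  have -> : rho * ((1 - eta) * ((1 - 2 * eta) * D1 / rho)) = (1 - eta) * (1 - 2 * eta) * D1.
    by field; rewrite gt_eqF.
  rewrite mulrA; apply: le_trans; apply: ler_wpM2r; [exact: ltW|by move: eta0; clear; nra]. }
have rs : 0 < rho * s by apply: mulr_gt0.
rewrite -(ler_pM2l rs); move: h4 h5 hu h2; clear; nra.
Qed.

Lemma linear_exponential (B : nat) : exists J : nat, (B * J.+1 <= 2 ^ J)%N.
Proof.
exists (2 * (2 * B))%N; set i := (2 * B)%N.
have h1 : (i < 2 ^ i)%N by apply: ltn_expl.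
rewrite mul2n -addnn expnD; apply: leq_trans (_ : i * i.+1 <= _)%N.
  by rewrite /i; clear; nia.
by apply: leq_mul => //; exact: ltnW.
Qed.

(** Bernoulli's inequality [(1 + 1 / k) ^ k >= 2] for [k = 2 * K - 1], cleared of denominators. *)
Lemma halving_power (K : nat) : (0 < K)%N -> exists n, ((2 * K - 1) ^ n * 2 <= (2 * K) ^ n)%N.
Proof.
move=> K0; exists (2 * K - 1)%N; set k := (2 * K - 1)%N.
have -> : (2 * K = k.+1)%N by rewrite /k; move: K0; clear; lia.
have k0 : (0 < k)%N by rewrite /k; move: K0; clear; lia.
have bern i : (k ^ i * (k + i) <= k.+1 ^ i * k)%N.
{ elim: i => [|i IH]; first by rewrite !expn0 addn0.
  rewrite !expnS; apply: leq_trans (_ : k.+1 * (k ^ i * (k + i)) <= _)%N; last first.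
    by rewrite -mulnA leq_mul2l IH orbT.
  have e1 (a b c d : nat) : (b * c <= d * a)%N -> (b * (k ^ i) * c <= d * (k ^ i * a))%N.
    by move=> h; rewrite mulnAC [(d * _)%N]mulnCA mulnC leq_mul2l h orbT.
  apply: e1; clear; lia. }
have := bern k; rewrite addnn -mul2n mulnA leq_pmul2r //.
Qed.

Lemma cover_ratio_le1 (R : realType) (F : sgraph -> Prop) : cover_ratio R F <= 1.
Proof.
rewrite /cover_ratio; set A := (X in sup X).
case: (classic (exists x, A x)) => [[x Ax]|no].
  apply: ge_sup; first by exists x.
  by move=> _ [H' [h1 _ ->]]; rewrite ler_pdivrMr ?ltr0n // mul1r ler_nat; exact: tau_leq.
by rewrite sup_out ?ler01 // => -[[x Ax] _]; apply: no; exists x.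
Qed.

Lemma embed_in_host (R : realType) (r : R) (G : sgraph) (D1 k K : nat) (H : sgraph)
    (X : {set H}) (lab : H -> nat) (g Delta CX d n u : nat) (a0 a1 a2 : bool -> nat) (s q0 : nat) :
  let w := (#|X| * (n * plen K + 1) + CX * plen K)%N in
  0 <= r -> r <= 1 ->
  host G D1 k K -> (0 < D1)%N -> (0 < K)%N -> (0 < d)%N ->
  (forall x y, x \notin X -> y \notin X -> adj x y -> lab x = lab y) ->
  (forall x, x \notin X -> lab x < g)%N ->
  (forall i, (i < g)%N -> (#|group X lab i| <= q0)%N /\ thin r (group X lab i)) ->
  (forall i, (i < g)%N -> #|group_nbr X lab i| <= Delta)%N ->
  (#|arcset X| <= CX)%N -> ((2 * K - 1) ^ n * d <= (2 * K) ^ n)%N ->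
  (w < k)%N -> (2 * w <= D1)%N -> (Delta * nverts G <= d * u)%N ->
  (1 - r + r ^+ 3) * q0%:R + 1 <= (a0 true * s)%:R ->
  r * (1 - r) * q0%:R + 1 <= (a1 true * s)%:R ->
  r ^+ 2 * q0%:R <= (a2 true * s)%:R ->
  (1 - r + r ^+ 2) * q0%:R + 1 <= (a0 false * s)%:R ->
  r * q0%:R <= (a2 false * s)%:R ->
  (forall W : {set G}, (#|W| <= w)%N ->
     exists l, packing a0 a1 a2 s W l /\ (g + u <= size l)%N) ->
  minor H G.
Proof.
move=> w r0 r1 hG D10 K0 d0 h1 h2 h3 h4 h5 h6 h7 h8 h9 k1 k2 k3 k4 k5 pk.
apply: (assemble hG D10 K0 d0 h1 h2 h4 h5 h6 h7 h8 h9) => W wW.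
have [l [/and3P[/allP tl /allP dl pl] sl]] := pk W wW.
exists [seq supp t | t <- l]; split; first by rewrite pairwise_map.
  by rewrite size_map.
move=> _ /mapP[t tin ->]; split; first exact: dl.
move=> i lti; have [sq tq] := h3 i lti.
apply: (tile_universal r0 r1 tq (sigma := q0%:R) _ (tl t tin) k1 k2 k3 k4 k5).
by rewrite ler_nat.
Qed.

(** Order of choice: [eta], [E], [K], [delta] and with them the tolerance [om] do not depend on [J].
    The depth [J] comes next, then the tile size [s] and the group size [q0 = E * s], and last the
    lower bound on the order of [H]. *)
Lemma upper_bound_le1 (R : realType) (F : sgraph -> Prop) (eps : R) :
  strongly_sublinear_separators R F -> 2 / 3 <= cover_ratio R F -> 0 < eps -> eps <= 1 ->
  exists n0 : nat, forall H, F H -> (n0 <= nverts H)%N -> forall G, (0 < nverts G)%N ->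
    ~ minor H G -> density R G <= (cover_ratio R F + eps) * (nverts H)%:R.
Proof.
move=> hF r0 eps0 eps1; set r := cover_ratio R F in r0 *.
have r1 : r <= 1 by apply: cover_ratio_le1.
have [Cd [M [L [Cd0 M0 L0 sparse strf]]]] := family_structure hF.
pose eta := eps / 168.
have eta0 : 0 < eta by rewrite /eta; move: eps0; clear; lra.
have eta1 : eta <= 1 / 168 by rewrite /eta; move: eps1; clear; lra.
have [E0 hE0] := nat_ub (16 / eps); pose E := E0.+1.
have hE : 16 <= eps * E%:R.
{ rewrite mulrC -ler_pdivrMr //; apply: le_trans hE0 _; by rewrite ler_nat. }
have [e1 [e2 [t1 [t2 [t3 [[u1 u2 u3] [u4 u5] [c1 c2 c3] [t10 e10 rho0] hrho]]]]]] := tile_sizes E r0 r1.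
have rhoR : 0 < (t2 + t3)%:R :> R by rewrite ltr0n.
have [qq0 hqq0] := nat_ub (2 / eta); pose qq := (qq0 + 9)%N.
have hqq : 2 <= eta * qq%:R.
{ rewrite mulrC -ler_pdivrMr //; apply: le_trans hqq0 _; by rewrite ler_nat leq_addr. }
have qq9 : (9 <= qq)%N by rewrite leq_addl.
pose K := (40 * (2 * qq) + 20)%N.
have K0 : (0 < K)%N by rewrite addn_gt0 orbT.
have KR : 0 < K%:R :> R by rewrite ltr0n.
pose delta := eta / (4 * K%:R).
have delta0 : 0 < delta by rewrite divr_gt0 // mulr_gt0.
have delta1 : delta <= 1.
{ rewrite ler_pdivrMr ?mulr_gt0 // mul1r; apply: le_trans (_ : 1 <= _); first by move: eta1; clear; lra.
  have : 1 <= K%:R :> R by rewrite ler1n.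
  by clear; lra. }
pose v1 := (1 - 2 * eta) / (K%:R * (t2 + t3)%:R).
have v10 : 0 < v1 by rewrite divr_gt0 ?mulr_gt0 //; move: eta1; clear; lra.
have a00 k : (0 < size0 e1 t1 k)%N by case: k.
have [om [om0 hpack]] := tile_packing (size1 t2) (size2 e2 t3) a00 (exprn_gt0 4 delta0) eta0 v10.
have [n1 hn1] := halving_power K0.
(* [a1] makes the pieces of size [M * L ^ J] negligible against [s = a1 * L ^ J]; [a2] enters [d]
   and makes the number of tiles lost to undominated vertices negligible. Both are fixed before
   [J]. *)
have [A1 hA1] := nat_ub (M%:R / eta); pose a1 := A1.+1.
have ha1 : M%:R <= eta * a1%:R.
{ rewrite mulrC -ler_pdivrMr //; apply: le_trans hA1 _; by rewrite ler_nat. }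
have [A2 hA2] := nat_ub ((Cd * E * (a1 * a1) * K * (t2 + t3))%:R / eta); pose a2 := A2.+1.
have ha2 : (Cd * E * (a1 * a1) * K * (t2 + t3))%:R <= eta * a2%:R.
{ rewrite mulrC -ler_pdivrMr //; apply: le_trans hA2 _; by rewrite ler_nat. }
pose B2 := (plen K * (n1 * (a2 + 2 * L + 1) + 1 + Cd))%N.
(* The bags will occupy at most [n / N] vertices, which must stay below [p], [D1 / 2] and
   [om * nverts G']. *)
have [N hN] := nat_ub ((8 * qq + 8)%:R + 4 / om).
(* The room reserved per vertex of [X] is linear in [J], whereas [X] has at most [3 * n / 2 ^ J]
   vertices. *)
have [J hJ] := linear_exponential (3 * B2 * N).
pose C0 := (M * L ^ J)%N; pose s := (a1 * L ^ J)%N; pose q0 := (E * s)%N.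
pose Delta := (Cd * q0 * 2 ^ J)%N; pose d := (a2 * (L ^ J * L ^ J) * 2 ^ J)%N.
pose nd := (n1 * (a2 + (2 * (L * J)) + J))%N.
have LJ0 : (0 < L ^ J)%N by rewrite expn_gt0 L0.
have s0 : (0 < s)%N by rewrite muln_gt0.
have d0 : (0 < d)%N by rewrite !muln_gt0 LJ0 expn_gt0.
have sR : 0 < s%:R :> R by rewrite ltr0n.
have sq : (s <= q0)%N by rewrite leq_pmull.
have Ceta : C0%:R <= eta * q0%:R.
{ apply: le_trans (_ : eta * s%:R <= _); last by apply: ler_wpM2l; [exact: ltW|rewrite ler_nat].
  by rewrite /C0 /s !natrM mulrA; apply: ler_wpM2r. }
have q0R : 0 < q0%:R :> R by rewrite ltr0n (leq_trans s0).
have Cq : (C0 < q0)%N.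
{ rewrite -(ltr_nat R); apply: le_lt_trans Ceta _; move: q0R eta1; clear; nra. }
have hd : ((2 * K - 1) ^ nd * d <= (2 * K) ^ nd)%N.
{ have pw b : ((2 * K - 1) ^ (n1 * b) * 2 ^ b <= (2 * K) ^ (n1 * b))%N.
    by case: b => [|b]; [rewrite muln0|rewrite !expnM -expnMn leq_exp2r].
  apply: leq_trans (pw _); rewrite leq_mul2l; apply/orP; right.
  rewrite /d expnD leq_mul2r; apply/orP; right; rewrite expnD; apply: leq_mul.
    exact/ltnW/ltn_expl.
  have h : (L ^ J <= 2 ^ (L * J))%N.
    rewrite expnM; case: (J) => // j; rewrite leq_exp2r //; exact/ltnW/ltn_expl.
  by rewrite mul2n -addnn expnD leq_mul. }
have hDelta : Delta%:R * K%:R * (s%:R * (t2 + t3)%:R) <= eta * d%:R.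
{ have -> : Delta%:R * K%:R * (s%:R * (t2 + t3)%:R) =
    (Cd * E * (a1 * a1) * K * (t2 + t3))%:R * (L ^ J * L ^ J * 2 ^ J)%:R :> R.
    by rewrite /Delta /q0 /s !natrM; ring.
  have -> : eta * d%:R = eta * a2%:R * (L ^ J * L ^ J * 2 ^ J)%:R by rewrite /d !natrM; ring.
  by apply: ler_wpM2r. }
have hnd : (nd * plen K + 1 + Cd * plen K <= B2 * J.+1)%N.
{ have p0 : (1 <= plen K)%N by rewrite /plen muln_gt0.
  have h : (a2 + 2 * (L * J) + J <= (a2 + 2 * L + 1) * J.+1)%N by clear; nia.
  have h2 : (nd <= n1 * (a2 + 2 * L + 1) * J.+1)%N by rewrite /nd -mulnA leq_mul2l h orbT.
  apply: leq_trans (_ : plen K * (nd + 1 + Cd) <= _)%N.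
    by move: p0; clear; nia.
  rewrite /B2 -mulnA leq_mul2l; apply/orP; right.
  move: h2; set z := (n1 * _)%N; clear; nia. }
have [ns hstr] := strf J q0 Cq.
have [m0 hm] := hpack s s0.
have [N3 hN3] := nat_ub (8 * (s%:R * (t2 + t3)%:R) / eta).
have [N4 hN4] := nat_ub (6 / eps).
exists (ns + 4 * m0 + N3 + N4 + 4 * qq + 1)%N => H FH nH G G0 nm.
have hns : (ns <= nverts H)%N by move: nH; clear; lia.
have [X [lab [l1 l2 l3 l4 l5]]] := hstr H FH hns.
set n := nverts H in nH l1 l2 l3 l4 l5 *.
rewrite leNgt; apply/negP => dens.
have n0 : (0 < n)%N by move: nH; clear; lia.
have nR : 0 < n%:R :> R by rewrite ltr0n.
have n6 : 1 <= eps / 6 * n%:R.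
{ have : 6 / eps <= n%:R by apply: le_trans hN4 _; rewrite ler_nat; move: nH; clear; lia.
  by rewrite ler_pdivrMr //; clear; lra. }
have n8 : 8 * (s%:R * (t2 + t3)%:R) <= eta * n%:R.
{ have : 8 * (s%:R * (t2 + t3)%:R) / eta <= n%:R.
    by apply: le_trans hN3 _; rewrite ler_nat; move: nH; clear; lia.
  by rewrite ler_pdivrMr // [n%:R * _]mulrC. }
pose D := Num.truncn ((r + eps / 2) * n%:R).
have x0 : 0 <= (r + eps / 2) * n%:R by apply: mulr_ge0 => //; move: r0 eps0; clear; lra.
have Dle : D%:R <= (r + eps / 2) * n%:R by rewrite /D truncn_le.
have Dge : (r + eps / 3) * n%:R <= D%:R.
{ have := truncnS_gt ((r + eps / 2) * n%:R); rewrite -/D -[D.+1%:R]natr1.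
  by move: n6; clear; lra. }
have nD : (n <= 2 * D)%N.
{ rewrite -(ler_nat R) natrM; apply: le_trans (_ : 2 * ((r + eps / 3) * n%:R) <= _).
    by move: r0 eps0 nR; clear; nra.
  by rewrite ler_pM2l. }
(* As [qq >= 2 / eta], the loss [2 * p] in the degree is at most [eta * D]. *)
pose p := (D %/ qq)%N.
have qq0' : (0 < qq)%N by apply: leq_trans qq9.
have pq : (p * qq <= D)%N by apply: leq_trunc_div.
have pq' : (D < p.+1 * qq)%N by apply: ltn_ceil.
have p0 : (0 < p)%N.
{ rewrite divn_gt0 //; move: nD nH; clear; lia. }
have p9 : (9 * p <= D)%N by apply: leq_trans pq; rewrite mulnC leq_mul2l qq9 orbT.
have Dq : (D <= 2 * qq * p)%N.
{ have : (p.+1 * qq <= (2 * p) * qq)%N by rewrite leq_mul2r; apply/orP; right; move: p0; clear; lia.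
  move: pq'; rewrite [(2 * qq * p)%N]mulnAC; clear; lia. }
have hA : (2 * D * nverts G < arcs G)%N.
{ move: dens; rewrite /density ltr_pdivlMr ?ltr0n // => dens.
  rewrite arcsE -mul2n -mulnA ltn_pmul2l // -(ltr_nat R) natrM; apply: le_lt_trans dens.
  apply: ler_wpM2r => //; apply: le_trans Dle _; apply: ler_wpM2r; rewrite ?ler0n //.
  by move: eps0; clear; lra. }
have [G' [nm' hG']] := dense_host p0 p9 Dq G0 nm hA.
have [deg sz rob rich] := hG'; rewrite -/K in hG' sz.
pose D1 := (D - 2 * p)%N; rewrite -/D1 in hG' deg sz rich.
have D1D : (D <= 2 * D1)%N by rewrite /D1; move: p9; clear; lia.
have D10 : (0 < D1)%N by move: D1D nD n0; clear; lia.
have n4 : (n <= 4 * D1)%N by move: D1D nD; clear; lia.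
have D1R : 0 < D1%:R :> R by rewrite ltr0n.
have mD : (D1 <= nverts G')%N.
{ have [/set0Pn[x _] _] := rob set0 (leq_ltn_trans (eq_leq (cards0 _)) p0).
  exact: leq_trans (deg x) (max_card _). }
have D1eta : (1 - eta) * D%:R <= D1%:R.
{ rewrite /D1 natrB ?natrM; last by move: p9; clear; lia.
  have : p%:R * qq%:R <= D%:R :> R by rewrite -natrM ler_nat.
  have : (0 : R) <= p%:R by rewrite ler0n.
  by move: hqq eta0; clear; nra. }
pose w := (#|X| * (nd * plen K + 1) + (Cd * #|X|) * plen K)%N.
have hw : (N * w <= n)%N.
{ have w1 : (w <= #|X| * (B2 * J.+1))%N.
    apply: leq_trans (_ : #|X| * (nd * plen K + 1 + Cd * plen K) <= _)%N.
      by rewrite [leqRHS]mulnDr /w leq_add2l -mulnA mulnCA.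
    by rewrite leq_mul2l hnd orbT.
  rewrite -(leq_pmul2l (m := 3)) //; apply: leq_trans l5.
  apply: leq_trans (_ : 3 * (N * (#|X| * (B2 * J.+1))) <= _)%N; first by rewrite !leq_mul2l w1 !orbT.
  have -> : (3 * (N * (#|X| * (B2 * J.+1))) = #|X| * (3 * B2 * N * J.+1))%N by ring.
  by rewrite leq_mul2l hJ orbT. }
have N1 : (8 * qq + 8 <= N)%N.
{ rewrite -(ler_nat R); apply: le_trans hN; rewrite lerDl divr_ge0 // ltW //. }
have hw1 : ((8 * qq + 8) * w <= n)%N by apply: leq_trans hw; rewrite leq_mul2r N1 orbT.
have wp : (w < p)%N.
{ have h : (qq * (8 * w) <= qq * (4 * p))%N by move: hw1 nD Dq; clear; nia.
  by rewrite leq_pmul2l // in h; move: h p0; clear; lia. }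
have wD : (2 * w <= D1)%N by move: hw1 n4; clear; nia.
have wom : w%:R <= om * (nverts G')%:R.
{ have h : 4 / om * w%:R <= n%:R.
    apply: le_trans (_ : N%:R * w%:R <= _); last by rewrite -natrM ler_nat.
    apply: ler_wpM2r => //; apply: le_trans hN; by rewrite lerDr ler0n.
  apply: le_trans (_ : om * D1%:R <= _); last by apply: ler_wpM2l; [exact: ltW|rewrite ler_nat].
  have h4 : n%:R <= 4 * D1%:R :> R by rewrite -natrM ler_nat.
  rewrite -(ler_pM2l (x := 4 / om)) ?divr_gt0 //.
  have -> : 4 / om * (om * D1%:R) = 4 * D1%:R by field; rewrite gt_eqF.
  exact: le_trans h h4. }
pose D2 := (1 - 2 * eta) * D1%:R.
have D20 : 0 < D2 by apply: mulr_gt0 => //; move: eta1; clear; lra.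
have szR : (nverts G')%:R <= K%:R * D1%:R :> R by rewrite -natrM ler_nat.
have D2lt : D2 < D1%:R - 4 * (delta * (nverts G')%:R).
{ have : 4 * (delta * (nverts G')%:R) <= eta * D1%:R.
    apply: le_trans (_ : 4 * (delta * (K%:R * D1%:R)) <= _).
      by rewrite ler_pM2l //; apply: ler_wpM2l => //; exact: ltW.
    by rewrite /delta le_eqVlt; apply/orP; left; apply/eqP; field; rewrite gt_eqF.
  have : 0 < eta * D1%:R by apply: mulr_gt0.
  by rewrite /D2; clear; lra. }
have cheap : cheap_tiles G' (size0 e1 t1) (size1 t2) (size2 e2 t3) (delta ^+ 4) (D2 / (t2 + t3)%:R).
  exact: (@rich_cheap R G' e1 e2 t1 t2 t3 D1 delta D2 rho0 c1 c2 c3 delta0 delta1 rich D20 D2lt).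
pose u := ((Delta * nverts G') %/ d + 1)%N.
apply: nm'.
have rge0 : 0 <= r by move: r0; clear; lra.
have s1 : 1 <= s%:R :> R by rewrite ler1n.
have conv (x : R) (t : nat) : x * E%:R + 1 <= t%:R -> x * q0%:R + 1 <= (t * s)%:R.
  rewrite (natrM R E) (natrM R t) => h; have := ler_wpM2r (ltW sR) h.
  by move: s1; clear; lra.
have conv' (x : R) (t : nat) : x * E%:R <= t%:R -> x * q0%:R <= (t * s)%:R.
  by rewrite (natrM R E) (natrM R t) mulrA => h; apply: ler_wpM2r.
apply: (@embed_in_host R r G' D1 p K H X lab _ Delta (Cd * #|X|) d nd u (size0 e1 t1) (size1 t2)
  (size2 e2 t3) s q0 rge0 r1 hG' D10 K0 d0 l1 l2 l3 l4 _ hd wp wD) => //=; try (exact: conv); try (exact: conv').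
- by rewrite -arcs_inE; apply: sparse.
- by rewrite /u addn1; apply/ltnW; rewrite [X in (_ < X)%N]mulnC; apply: ltn_ceil.
move=> W wW.
have [||||l [pl sl]] := hm G' W (D2 / (t2 + t3)%:R) _ _ _ _ cheap.
- by move: nH n4 mD; clear; lia.
- by apply: le_trans wom; rewrite ler_nat.
- rewrite /v1 /D2 ler_pdivlMr //.
  have fr (a b c x : R) : 0 < b -> 0 < c -> a / (b * c) * x * c = a * (x / b).
    by move=> b0 c0; field; rewrite !gt_eqF.
  rewrite fr //.
  by apply: ler_wpM2l; [move: eta1; clear; lra|rewrite ler_pdivrMr // mulrC].
- rewrite ler_pdivrMr //; apply: le_trans (_ : D1%:R <= _).
    by rewrite /D2; move: eta0 D1R; clear; nra.
  rewrite -natrM ler_nat; apply: leq_trans mD _; exact: leq_pmulr.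
exists l; split=> //.
rewrite -(ler_nat R) /u !natrD.
apply: (@room R eps r eta E%:R (t2 + t3)%:R n%:R D1%:R s%:R) => //.
- apply: le_trans D1eta; apply: ler_wpM2l; [move: eta1; clear; lra|exact: Dge].
- have h : ((n %/ (q0 - C0)) * (q0 - C0) <= n)%N by apply: leq_trunc_div.
  rewrite -(ler_nat R) natrM natrB in h; last exact: ltnW.
  apply: le_trans h; apply: ler_wpM2l => //; rewrite -natrM -/q0.
  by move: Ceta; clear; lra.
- have h : (((Delta * nverts G') %/ d) * d <= Delta * nverts G')%N by apply: leq_trunc_div.
  rewrite -(ler_nat R) (natrM R ((Delta * nverts G') %/ d) d) (natrM R Delta) in h.
  have dR : 0 < d%:R :> R by rewrite ltr0n.
  rewrite -(ler_pM2r dR); apply: le_trans (_ : (t2 + t3)%:R * s%:R * (Delta%:R * (K%:R * D1%:R)) <= _).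
    rewrite -[leLHS]mulrA; apply: ler_wpM2l; first by rewrite mulr_ge0 ?ltW.
    by apply: le_trans h _; apply: ler_wpM2l.
  have -> : (t2 + t3)%:R * s%:R * (Delta%:R * (K%:R * D1%:R)) =
      Delta%:R * K%:R * (s%:R * (t2 + t3)%:R) * D1%:R :> R by ring.
  have -> : eta * D1%:R * d%:R = eta * d%:R * D1%:R by ring.
  by apply: ler_wpM2r => //; exact: ltW.
- have h4 : n%:R <= 4 * D1%:R :> R by rewrite -natrM ler_nat.
  by move: n8 h4 eta0; clear; nra.
Qed.

Lemma upper_bound (R : realType) (F : sgraph -> Prop) (eps : R) :
  strongly_sublinear_separators R F -> 2 / 3 <= cover_ratio R F -> 0 < eps ->
  exists n0 : nat, forall H, F H -> (n0 <= nverts H)%N -> forall G, (0 < nverts G)%N ->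
    ~ minor H G -> density R G <= (cover_ratio R F + eps) * (nverts H)%:R.
Proof.
move=> hF hr e0; have [||n0 h] := @upper_bound_le1 R F (Num.min eps 1) hF hr.
- by rewrite lt_min e0 ltr01.
- by rewrite ge_min lexx orbT.
exists n0 => H FH nH G G0 nm; apply: le_trans (h H FH nH G G0 nm) _.
by apply: ler_wpM2r => //; rewrite lerD2l ge_min lexx.
Qed.

(** * Complete bipartite graphs and finite bounds *)

Section Bipartite.
Variables t m : nat.

Definition bip_adj : rel ('I_t + 'I_m)%type :=
  fun x y => match x, y with inl _, inr _ | inr _, inl _ => true | _, _ => false end.

Lemma bip_sym : symmetric bip_adj. Proof. by case=> [?|?] [?|?]. Qed.
Lemma bip_irrefl : irreflexive bip_adj. Proof. by case. Qed.
Definition bip : sgraph := SGraph bip_sym bip_irrefl.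

Lemma nverts_bip : nverts bip = (t + m)%N.
Proof. by rewrite /nverts /= card_sum !card_ord. Qed.

Lemma nedges_bip : (t * m <= nedges bip)%N.
Proof.
have h : (2 * (t * m) <= arcs bip)%N.
{ rewrite /arcs big_sumType /=.
  apply: leq_trans (_ : \sum_(i < t) m + \sum_(j < m) t <= _)%N.
    by rewrite !sum_nat_const !card_ord; clear; nia.
  apply: leq_add; apply: leq_sum => i _.
    rewrite -{1}(card_ord m) -(card_imset _ (@inr_inj 'I_t 'I_m)); apply: subset_leq_card.
    by apply/subsetP => _ /imsetP[j _ ->]; rewrite inE.
  rewrite -{1}(card_ord t) -(card_imset _ (@inl_inj 'I_t 'I_m)); apply: subset_leq_card.
  by apply/subsetP => _ /imsetP[j _ ->]; rewrite inE. }
by move: h; rewrite arcsE -mul2n leq_pmul2l.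
Qed.

(* The bags that meet the left side form a vertex cover. *)
Lemma minor_bip_tau (H : sgraph) : minor H bip -> (tau H <= t)%N.
Proof.
move=> [B [_ dB eB]].
pose N : {set bip} := [set x | if x is inl _ then true else false].
have cN : (#|N| <= t)%N.
{ rewrite -[X in (_ <= X)%N](card_ord t) -(card_imset predT (@inl_inj 'I_t 'I_m)); apply: subset_leq_card.
  by apply/subsetP => -[i|j]; rewrite !inE // => _; apply: imset_f. }
pose C := [set x : H | ~~ [disjoint B x & N]].
have cC : vertex_cover C.
{ apply/forallP => x; apply/forallP => y; apply/implyP => xy; rewrite !inE -negb_and.
  apply/negP => /andP[dx dy]; have [a [b [aB bB ab]]] := eB x y xy.
  have := disjointFr dx aB; have := disjointFr dy bB; rewrite !inE.
  by case: a b ab {aB bB} => [?|?] [?|?]. }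
apply: leq_trans (tau_le cC) _; apply: leq_trans cN; rewrite cardE -(size_map B).
apply: pairwise_meet_card.
  rewrite pairwise_map; have := enum_uniq C; rewrite uniq_pairwise; apply: sub_pairwise => x y /=.
  exact: dB.
by move=> A /mapP[x]; rewrite mem_enum inE => h ->.
Qed.
End Bipartite.

(** With [t = tau H - 1] and [m = t * t + 1], the density is at least
    [t * m / (t + m) = t - t ^ 2 / (t + m)], which exceeds [t - 1]. *)
Lemma dense_without_minor (R : realType) (H : sgraph) : (0 < tau H)%N ->
  exists G : sgraph, [/\ (0 < nverts G)%N, ~ minor H G & (tau H)%:R - 2 <= density R G].
Proof.
move=> t0; pose t := (tau H).-1; exists (bip t (t * t).+1); split.
- by rewrite nverts_bip addnS.
- by move=> /minor_bip_tau; rewrite /t; case: (tau H) t0 => // k _; rewrite ltnn.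
- have -> : (tau H)%:R = t%:R + 1 :> R by rewrite natr1 /t prednK.
  rewrite /density ler_pdivlMr; last by rewrite ltr0n nverts_bip addnS.
  apply: le_trans (_ : (t * (t * t).+1)%:R <= _); last by rewrite ler_nat nedges_bip.
  have e : (t * t).+1%:R = t%:R * t%:R + 1 :> R by rewrite -natr1 natrM.
  rewrite nverts_bip natrM natrD e; have : 0 <= t%:R :> R by rewrite ler0n.
  by clear; nra.
Qed.

Lemma tau_copies (k : nat) (H : sgraph) : (k * tau H <= tau (copies k H))%N.
Proof.
have [C [cC <-]] := tau_cover (copies k H).
pose S (i : 'I_k) := [set v : H | (i, v) \in C].
have cS i : (tau H <= #|S i|)%N.
{ apply: tau_le; apply/forallP => x; apply/forallP => y; apply/implyP => xy; rewrite !inE.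
  move/forallP/(_ (i, x))/forallP/(_ (i, y))/implyP: cC; apply.
  by rewrite /= /copies_adj /= eqxx. }
rewrite -sum1_card; rewrite (eq_bigl (fun p : 'I_k * H => xpredT p.1 && ((p.1, p.2) \in C))); last by case.
rewrite -(pair_big_dep xpredT (fun i v => (i, v) \in C) (fun _ _ => 1%N)) /=.
rewrite -[X in (X * _)%N]card_ord -sum_nat_const; apply: leq_sum => i _.
apply: leq_trans (cS i) _; rewrite -sum1_card; apply: eq_leq; apply: eq_bigl => v.
by rewrite inE.
Qed.

Lemma nverts_copies (k : nat) (H : sgraph) : nverts (copies k H) = (k * nverts H)%N.
Proof. by rewrite /nverts /= card_prod card_ord. Qed.

Section Complete.
Variable k : nat.
Definition complete_adj : rel 'I_k := fun i j => i != j.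
Lemma complete_sym : symmetric complete_adj.
Proof. by move=> i j; rewrite /complete_adj eq_sym. Qed.
Lemma complete_irrefl : irreflexive complete_adj.
Proof. by move=> i; rewrite /complete_adj eqxx. Qed.
Definition complete : sgraph := SGraph complete_sym complete_irrefl.
End Complete.

Lemma conn_val (G : sgraph) (S : {set G}) (B : {set induced S}) :
  connected_in B -> connected_in (val @: B).
Proof.
move=> [/set0Pn[b bB] cB]; split; first by apply/set0Pn; exists (val b); apply: imset_f.
move=> _ _ /imsetP[x xB ->] /imsetP[y yB ->].
have /connectP[p pp ->] := cB x y xB yB; elim: p x {xB} pp => [|z p IH] x; first by rewrite connect0.
move=> /= /andP[/and3P[xB zB xz] pp]; apply: connect_trans (IH z pp); apply: connect1.
by rewrite /= !imset_f.
Qed.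

(** In a minor-minimal graph the neighbourhood of a vertex induces minimum degree at least [D], so
    by induction it contains a model of the smaller complete graph, to which the vertex itself is
    added. *)
Lemma complete_minor (k : nat) : exists D : nat, forall G, (0 < nverts G)%N ->
  (D * nverts G <= arcs G)%N -> minor (complete k) G.
Proof.
elim: k => [|k [D IH]].
  by exists 0%N => G _ _; exists (fun _ => set0); split=> -[].
pose E := (D + 2)%N; exists (2 * E)%N => G G0 hA; apply: NNPP => nm.
have E2 : (2 * 1 <= E)%N by rewrite /E; clear; lia.
have vG : (2 * 1 <= nverts G)%N.
{ have := arcs_le G; move: hA G0; case: (nverts G) => [//|[|v //]]; rewrite /E; clear; lia. }
have Pm (G1 G2 : sgraph) : ~ minor (complete k.+1) G1 -> minor G2 G1 -> ~ minor (complete k.+1) G2.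
  by move=> n1 m12 h; apply: n1; apply: minor_trans m12.
have hA' : (2 * E * nverts G < arcs G + 2 * E * 1)%N by move: hA; rewrite /E; clear; lia.
have [G1 [nm1 [deg cod con _ _]]] := minimal_graph Pm (ltn0Sn 0) E2 nm vG hA'.
apply: nm1; have [/set0Pn[x _] _] := con set0 (eq_leq (congr1 succn (cards0 _))).
have S0 : (0 < #|nbr x|)%N by apply: leq_ltn_trans (deg x).
have [||B [cB dB eB]] := IH (induced (nbr x)).
- by rewrite nverts_induced.
- rewrite nverts_induced arcs_induced /arcs_in mulnC -sum_nat_const; apply: leq_sum => y xy.
  by rewrite setIC; apply: leq_trans (cod x y _); [rewrite leq_addr|rewrite -in_nbr].
pose B' (i : 'I_k.+1) : {set G1} := if unlift ord0 i is Some j then val @: B j else [set x].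
have B0 : B' ord0 = [set x] by rewrite /B' unlift_none.
have BS j : B' (lift ord0 j) = val @: B j by rewrite /B' liftK.
have xB j : [disjoint [set x] & val @: B j].
  rewrite disjoints1; apply/imsetP => -[y _ e]; have := valP y; rewrite -e in_nbr adjxx //.
have eB0 j : exists a b : G1, [/\ a \in [set x], b \in val @: B j & adj a b].
  have [/set0Pn[y yB] _] := cB j; exists x, (val y); rewrite inE eqxx imset_f //.
  by split=> //; have := valP y; rewrite in_nbr.
exists B'; split.
- move=> i; case: (unliftP ord0 i) => [j|] ->; first by rewrite BS; apply: conn_val.
  by rewrite B0; apply: conn1.
- move=> i j; case: (unliftP ord0 i) => [i'|] ->; case: (unliftP ord0 j) => [j'|] -> ij.
  + rewrite !BS; have /dB dd : i' != j' by apply: contra ij => /eqP ->.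
    apply/pred0P => z /=; apply/negP => /andP[/imsetP[u uB ->] /imsetP[v vB /val_inj e]].
    by have /pred0P/(_ u) := dd; rewrite /= uB e vB.
  + by rewrite BS B0 disjoint_sym.
  + by rewrite BS B0.
  + by rewrite eqxx in ij.
- move=> i j; case: (unliftP ord0 i) => [i'|] ->; case: (unliftP ord0 j) => [j'|] ->; rewrite ?BS ?B0.
  + move=> ij; have [|a [b [aB bB ab]]] := eB i' j'.
      by apply: contra ij => /eqP ->.
    by exists (val a), (val b); rewrite !imset_f.
  + by move=> _; have [a [b [h1 h2 h3]]] := eB0 i'; exists b, a; rewrite adjC.
  + by move=> _; apply: eB0.
  + by rewrite /= /complete_adj eqxx.
Qed.

(** Serves the small orders, where the asymptotic bound says nothing but the error term must still
    be finite. *)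
Lemma finite_extremal (R : realType) (k : nat) : exists D : nat, forall H, (nverts H <= k)%N ->
  forall G, (0 < nverts G)%N -> ~ minor H G -> density R G <= D%:R.
Proof.
have [D hD] := complete_minor k; exists D => H Hk G G0 nm.
rewrite /density ler_pdivrMr ?ltr0n // -natrM ler_nat leqNgt; apply/negP => lt.
apply: nm; apply: minor_trans (_ : minor H (complete k)) (hD G G0 _).
  apply: subgraph_minor; exists (fun x => widen_ord Hk (enum_rank x)); split=> [x y|x y xy].
    by move=> /(congr1 val) /= e; apply: enum_rank_inj; apply: val_inj.
  apply/negP => /eqP /(congr1 val) /= e; have := adj_neq xy.
  by rewrite (_ : x = y) ?eqxx //; apply: enum_rank_inj; apply: val_inj.
by rewrite arcsE -addnn; apply: leq_trans (ltnW lt) (leq_addr _ _).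
Qed.

(** * The theorem *)

From mathcomp Require Import all_classical all_reals all_analysis.
Import numFieldNormedType.Exports.
Local Open Scope classical_set_scope.

Lemma extremal_c_le (R : realType) (H : sgraph) (x : R) :
  (forall G, (0 < nverts G)%N -> ~ minor H G -> density R G <= x) ->
  (extremal_c R H <= x%:E)%E.
Proof. by move=> h; apply: ge_ereal_sup => _ [G [G0 nm ->]]; rewrite lee_fin; apply: h. Qed.

Lemma extremal_c_ge (R : realType) (H : sgraph) : (0 < tau H)%N ->
  (((tau H)%:R - 2)%:E <= extremal_c R H)%E.
Proof.
move=> t0; have [G [G0 nm hG]] := dense_without_minor R t0.
apply: (@le_trans _ _ (density R G)%:E); first by rewrite lee_fin.
by apply: ereal_sup_ubound; exists G.
Qed.

(** [H] consists of many copies of a graph [Q] that nearly attains the supremum. Taking copies does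
    not lower the ratio of cover number to order, while the loss of 2 in [extremal_c_ge] becomes
    negligible. *)
Lemma near_extremal (R : realType) (F : sgraph -> Prop) (eps : R) (N : nat) :
  strongly_sublinear_separators R F -> 2 / 3 <= cover_ratio R F -> 0 < eps ->
  exists H (c : R), [/\ F H, (2 <= nverts H)%N, (N <= nverts H)%N, extremal_c R H = c%:E &
    `|c / (nverts H)%:R - cover_ratio R F| <= eps].
Proof.
move=> hF hr e0; set r := cover_ratio R F in hr *.
(* The cap [1 / 2] keeps [r - e / 2] positive, so that [tau H] is positive. *)
pose e := Num.min eps (1 / 2).
have e0' : 0 < e by rewrite lt_min e0 /=; lra.
have e1 : e <= eps by rewrite ge_min lexx.
have e2 : e <= 1 / 2 by rewrite ge_min lexx orbT.
have [n0 hn0] := upper_bound hF hr e0'.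
have [Q [Q0 hQ rQ]] : exists Q, [/\ (0 < nverts Q)%N, forall k, F (copies k Q) &
    r - e / 2 < (tau Q)%:R / (nverts Q)%:R].
{ move: hr; rewrite /r /cover_ratio; set A := (X in sup X) => hr.
  (* A set without a supremum would get the default value 0, against [2 / 3 <= r]. *)
  have hA : has_sup A by apply: contrapT => h; move: hr; rewrite sup_out //; lra.
  have [|_ [Q [Q0 hQ ->]] lt] := @sup_adherent R A (e / 2) _ hA; first by rewrite divr_gt0.
  by exists Q. }
have v0 : 0 < (nverts Q)%:R :> R by rewrite ltr0n.
have [k1 hk1] := nat_ub (4 / e).
pose k := (n0 + N + k1 + 2)%N; pose H := copies k Q.
have nH : nverts H = (k * nverts Q)%N by apply: nverts_copies.
have kn : (k <= nverts H)%N by rewrite nH leq_pmulr.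
have [kn0 kN kk1 k2] : [/\ n0 <= k, N <= k, k1 <= k & 2 <= k]%N by rewrite /k; clear; split; lia.
have n2 : (2 <= nverts H)%N := leq_trans k2 kn.
have nR : 0 < (nverts H)%:R :> R by rewrite ltr0n; exact: ltnW.
have lo : (r - e / 2) * (nverts H)%:R <= (tau H)%:R.
{ apply: le_trans (_ : (k * tau Q)%:R <= _); last by rewrite ler_nat tau_copies.
  rewrite nH !natrM mulrCA; apply: ler_wpM2l => //.
  by rewrite -ler_pdivlMr // ltW. }
have t0 : (0 < tau H)%N.
{ rewrite -(ltr0n R); apply: lt_le_trans lo; apply: mulr_gt0 => //; lra. }
have up : (extremal_c R H <= ((r + e) * (nverts H)%:R)%:E)%E.
  by apply: extremal_c_le; apply: hn0 (hQ k) (leq_trans kn0 kn).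
have low := @extremal_c_ge R H t0.
have [c hc] : exists c : R, extremal_c R H = c%:E.
  by move: up low; case: (extremal_c R H) => [c| |] //; exists c.
exists H, c; split; [exact: hQ|exact: n2|exact: leq_trans kN kn|exact: hc|].
rewrite hc !lee_fin in up low; apply: le_trans e1.
have k4 : 4 <= e * (nverts H)%:R.
{ rewrite mulrC -ler_pdivrMr //; apply: le_trans hk1 _; rewrite ler_nat; exact: leq_trans kk1 kn. }
rewrite ler_norml lerBrDr lerBlDr ler_pdivlMr // ler_pdivrMr //; apply/andP; split.
  by move: low lo k4; clear; lra.
by rewrite addrC.
Qed.

Lemma eventually_small (R : realType) (u : nat -> R) :
  (forall e : R, 0 < e -> exists n0 : nat, forall n, (n0 <= n)%N -> `|u n| <= e) ->
  u n @[n --> \oo] --> (0 : R).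
Proof.
move=> h; apply/cvgr0Pnorm_le => e e0; have [n0 hn] := h e e0.
by near=> n; apply: hn; near: n; exists n0.
Unshelve. all: by end_near.
Qed.

Lemma inv_small (R : realType) (e : R) : 0 < e -> exists n0 : nat, forall n,
  (n0 <= n)%N -> n.+1%:R^-1 <= e.
Proof.
move=> e0; have [n0 h] := nat_ub e^-1; exists n0 => n le.
rewrite -[leRHS]invrK lef_pV2 ?posrE ?invr_gt0 //.
by apply: le_trans h _; rewrite ler_nat leqW.
Qed.

Theorem theorem1p3 (R : realType) (F : sgraph -> Prop)
    (hF : strongly_sublinear_separators R F)
    (hr : 2 / 3 <= cover_ratio R F) :
  (exists o : nat -> R,
     o n @[n --> \oo] --> (0 : R) /\
     forall H : sgraph, F H -> (2 <= nverts H)%N ->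
       (extremal_c R H <= ((cover_ratio R F + o (nverts H)) * (nverts H)%:R)%:E)%E) /\
  (exists o : nat -> R,
     o n @[n --> \oo] --> (0 : R) /\
     forall N : nat, exists H : sgraph,
       [/\ F H, (2 <= nverts H)%N, (N <= nverts H)%N &
           extremal_c R H = ((cover_ratio R F + o (nverts H)) * (nverts H)%:R)%:E]).
Proof.
set r := cover_ratio R F in hr *; split.
(* [A n] is the set of admissible errors at order [n]. The error term is its infimum plus
   [n.+1%:R^-1]; the second summand lets [inf_adherent] find an admissible error below it. *)
- pose A (n : nat) : set R := [set x | 0 <= x /\ forall H, F H -> nverts H = n ->
    forall G, (0 < nverts G)%N -> ~ minor H G -> density R G <= (r + x) * n%:R].
  have A0 n : lbound (A n) 0 by move=> x [].
  have An n : (0 < n)%N -> A n !=set0.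
  { move=> n0; have [D hD] := finite_extremal R n; exists D%:R; split; first by rewrite ler0n.
    move=> H FH nH G G0 nm; apply: le_trans (hD H _ G G0 nm) _; first by rewrite nH.
    have : 1 <= n%:R :> R by rewrite ler1n.
    have : 0 <= D%:R :> R by rewrite ler0n.
    by move: hr; clear; nra. }
  exists (fun n => inf (A n) + n.+1%:R^-1); split.
    apply: eventually_small => e e0.
    have e2 : 0 < e / 2 by rewrite divr_gt0.
    have [n0 hn0] := upper_bound hF hr e2; have [n1 hn1] := inv_small e2.
    exists (n0 + n1 + 1)%N => n le.
    have npos : (0 < n)%N by lia.
    have i0 : 0 <= inf (A n) by apply: lb_le_inf; [exact: An|exact: A0].
    have i1 : inf (A n) <= e / 2.
    { apply: ge_inf; first by exists 0.
      split; first exact: ltW.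
      by move=> H FH nH G G0 nm; rewrite -nH; apply: hn0 => //; lia. }
    have i2 : n.+1%:R^-1 <= e / 2 by apply: hn1; lia.
    have i3 : 0 <= n.+1%:R^-1 :> R by rewrite invr_ge0.
    by rewrite ger0_norm ?addr_ge0 // [leRHS]splitr lerD.
  move=> H FH H2; apply: extremal_c_le => G G0 nm.
  have hi : has_inf (A (nverts H)) by split; [apply: An; lia|exists 0].
  have [|x [x0 hx] lt] := @inf_adherent R (A (nverts H)) (nverts H).+1%:R^-1 _ hi; first by rewrite invr_gt0.
  apply: le_trans (hx H FH erefl G G0 nm) _; apply: ler_wpM2r => //.
  by rewrite lerD2l ltW.
- have hN N := @near_extremal R F N.+1%:R^-1 N hF hr.
  have ex N : exists Hc : sgraph * R, [/\ F Hc.1, (2 <= nverts Hc.1)%N, (N <= nverts Hc.1)%N,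
      extremal_c R Hc.1 = Hc.2%:E & `|Hc.2 / (nverts Hc.1)%:R - r| <= N.+1%:R^-1].
    by have [|H [c h]] := hN N; [rewrite invr_gt0|exists (H, c)].
  have [f hf] := boolp.choice ex.
  (* [o] may depend on the order only, and several [f N] may have the same order; [sel] fixes one
     index for each order that occurs. *)
  have exsel (n : nat) : exists i : nat, (exists N, nverts (f N).1 = n) -> nverts (f i).1 = n.
    by case: (pselect (exists N, nverts (f N).1 = n)) => [[N h]|no]; [exists N|exists 0%N].
  have [sel hsel] := boolp.choice exsel.
  pose o n : R := if nverts (f (sel n)).1 == n then (f (sel n)).2 / n%:R - r else 0.
  exists o; split.
    apply: eventually_small => e e0; have [J hJ] := inv_small e0.
    (* An order above this sum is not attained at an index below [J], so the index selected for it
       is at least [J]. *)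
    exists (\sum_(i < J) nverts (f i).1).+1 => n le; rewrite /o.
    case: eqP => h; last by rewrite normr0 ltW.
    have [_ _ _ _ b] := hf (sel n); rewrite h in b; apply: le_trans b _; apply: hJ.
    rewrite leqNgt; apply/negP => lt.
    by move: le; rewrite (bigD1 (Ordinal lt)) //= h ltnNge leq_addr.
  move=> N; have [_ _ nN _ _] := hf N; set n := nverts (f N).1 in nN.
  have sn : nverts (f (sel n)).1 = n by apply: hsel; exists N.
  have [h1 h2 _ h4 _] := hf (sel n); exists (f (sel n)).1; split=> //; first by rewrite sn.
  rewrite h4 sn /o sn eqxx; congr EFin; rewrite addrC subrK mulfVK //.
  by rewrite pnatr_eq0 -sn; lia.
Qed.
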